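(* Let $g:[0,1]\times E\to\mathbb R$ be bounded and measurable and assume: (i) there is $L>0$ such that $\sup_{x\in E}\|\delta_xQ_u-\delta_xQ_v\|_{\mathrm{TV}}\le L|u-v|$ for all $u,v\in[0,1]$; (ii) there are an integer $m\ge 1$ and $r_0\in(0,1)$ such that $\sup_{u\in[0,1]}\sup_{x,y\in E}\|\delta_xQ_u^m-\delta_yQ_u^m\|_{\mathrm{TV}}\le r_0$; (iii) there is $K<\infty$ such that $\sup_{u\in[0,1]}\|g(u,\cdot)\|_\infty\le K$; (iv) there is $C_g\ge 0$ such that $|g(u,x)-g(v,x)|\le C_g|u-v|$ for all $u,v\in[0,1]$, $x\in E$. Then there exist $\delta,C>0$ and $\kappa\in(0,1)$ such that for all $z\in\mathbb C$ with $|z|<\delta$ and all $u\in[0,1]$ the operator $Q_{u,z}$ has a decomposition $$Q_{u,z}=\lambda(u,z)\,\upsilon(u,z)\otimes\varphi(u,z)+N_{u,z},$$ where: 1. the leading eigenvalue $\lambda(u,z)\in\mathbb C$ of $Q_{u,z}$ is simple and isolated; 2. $\upsilon(u,z)\in\mathfrak B$ and $\varphi(u,z)\in\mathfrak B'$ satisfy $Q_{u,z}\upsilon(u,z)=\lambda(u,z)\upsilon(u,z)$, $\varphi(u,z)Q_{u,z}=\lambda(u,z)\varphi(u,z)$, with the normalization $\langle\varphi(u,z),\upsilon(u,z)\rangle=1$; 3. $\mathfrak B=F_{u,z}\oplus H_{u,z}$, where $F_{u,z}=\operatorname{span}\{\upsilon(u,z)\}$ and $H_{u,z}=\{h\in\mathfrak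 B:\langle\varphi(u,z),h\rangle=0\}$; 4. with $\Pi_{u,z}:=\upsilon(u,z)\otimes\varphi(u,z)$ and $\Pi_{H_{u,z}}:=I-\Pi_{u,z}$, one has $N_{u,z}=Q_{u,z}\Pi_{H_{u,z}}$ and $\sup_{u\in[0,1]}\sup_{|z|<\delta}r(N_{u,z})/|\lambda(u,z)|<\kappa$; 5. $\sup_{u\in[0,1]}\sup_{|z|<\delta}\sup_{n\in\mathbb Z^+}\left\|\frac{\partial^2}{\partial z^2}N_{u,z}^n\right\|_\infty\le C$; 6. for every $u\in[0,1]$ the maps $z\mapsto\lambda(u,z)$, $z\mapsto\upsilon(u,z)$, $z\mapsto\varphi(u,z)$, $z\mapsto N_{u,z}$ are analytic on $\{|z|<\delta\}$, and for each $j=1,2,3$, $$\sup_{u,\,|z|<\delta}|\partial_z^j\lambda(u,z)|\le C,\quad \sup_{u,\,|z|<\delta}\|\partial_z^j\upsilon(u,z)\|_\infty\le C,\quad \sup_{u,\,|z|<\delta}\|\partial_z^j\varphi(u,z)\|_{\mathfrak B'}\le C,\quad \sup_{u,\,|z|<\delta}\|\partial_z^jN_{u,z}\|_\infty\le C,$$ the suprema being over $u\in[0,1]$ and $|z|<\delta$; 7. for all $u,v\in[0,1]$ and $|z|<\delta$, $$|\lambda(u,z)-\lambda(v,z)|\le C|u-v|,\quad\|\upsilon(u,z)-\upsilon(v,z)\|_\infty\le C|u-v|,$$ $$\|\varphi(u,z)-\varphi(v,z)\|_{\mathfrak B'}\le C|u-v|,\quad\|N_{u,z}-N_{v,z}\|_\infty\le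 C|u-v|.$$
   Context: $(E,d)$ is a metric space with Borel $\sigma$-algebra $\mathcal B(E)$ and $\{Q_u:u\in[0,1]\}$ is a family of Markov transition kernels on $(E,\mathcal B(E))$. $\mathfrak B$ is the Banach space of bounded $\mathcal B(E)$-measurable functions $f:E\to\mathbb C$ with the supremum norm $\|\cdot\|_\infty$; $\mathfrak B'$ is its dual with the dual norm $\|\varphi\|_{\mathfrak B'}=\sup_{\|f\|_\infty\le1}|\langle\varphi,f\rangle|$. For a bounded linear operator $T$ on $\mathfrak B$, $\|T\|_\infty=\sup_{\|f\|_\infty\le1}\|Tf\|_\infty$ and $r(T)$ is its spectral radius. For $\upsilon\in\mathfrak B$, $\varphi\in\mathfrak B'$, the operator $\upsilon\otimes\varphi$ is $(\upsilon\otimes\varphi)f=\langle\varphi,f\rangle\upsilon$; $\varphi T$ denotes the functional $f\mapsto\langle\varphi,Tf\rangle$. For probability measures, $\|\mu-\nu\|_{\mathrm{TV}}=\sup_{\|f\|_\infty\le1}|\int f\,d\mu-\int f\,d\nu|=2\sup_{A\in\mathcal B(E)}|\mu(A)-\nu(A)|$; $\delta_x$ is the Dirac mass at $x$. For $u\in[0,1]$ and $z\in\mathbb C$ the twisted operator $Q_{u,z}$ on $\mathfrak B$ is $Q_{u,z}f(x)=\int e^{zg(u,y)}f(y)\,Q_u(x,dy)$. *)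

(* Defs.v *)
From HB Require Import structures.
From mathcomp Require Import all_boot all_order all_algebra.
From mathcomp Require Import all_classical all_reals all_analysis.
From mathcomp Require Import measurable_realfun.
From mathcomp Require Import complex lra.
Set Implicit Arguments. Unset Strict Implicit. Unset Printing Implicit Defensive.
Import Order.TTheory GRing.Theory Num.Theory.
Import numFieldNormedType.Exports.
Local Open Scope classical_set_scope.
Local Open Scope ring_scope.
Local Open Scope complex_scope.

Local Notation Re := (@complex.Re _).
Local Notation Im := (@complex.Im _).

HB.instance Definition _ (R : rcfType) := NormedModule.copy R[i] R[i]^o.

Section nrm.
Context {R : realType}.

(** In a normed module over [R[i]] the norm [`|x|] is [R[i]]-valued (with zero
    imaginary part); [nrm x] is the same norm as an element of [R]. *)
Definition nrm {V : normedModType R[i]} (x : V) : R := Re `|x|.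

Lemma nrmE (V : normedModType R[i]) (x : V) : `|x| = (nrm x)%:C.
Proof. by rewrite RRe_real // ger0_real. Qed.

Lemma nrm_ge0 (V : normedModType R[i]) (x : V) : 0 <= nrm x.
Proof. by rewrite -lecR -nrmE normr_ge0. Qed.

Lemma nrmD (V : normedModType R[i]) (x y : V) : nrm (x + y) <= nrm x + nrm y.
Proof. by rewrite -lecR rmorphD /= -!nrmE ler_normD. Qed.

Lemma nrm0 (V : normedModType R[i]) : nrm (0 : V) = 0.
Proof. by rewrite /nrm normr0. Qed.

Lemma nrm0_eq0 (V : normedModType R[i]) (x : V) : nrm x = 0 -> x = 0.
Proof. by move=> x0; apply/eqP; rewrite -normr_eq0 nrmE x0. Qed.

Lemma nrmZ (V : normedModType R[i]) (a : R[i]) (x : V) :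
  nrm (a *: x) = nrm a * nrm x.
Proof.
apply: (fmorph_inj (real_complex R)).
by rewrite rmorphM /= -!nrmE normrZ.
Qed.

Lemma nrmC (z : R[i]) : nrm z = Num.sqrt (Re z ^+ 2 + Im z ^+ 2).
Proof. by rewrite /nrm normc_def. Qed.

Lemma le_Re_nrm (z : R[i]) : `|Re z| <= nrm z.
Proof. by rewrite nrmC -sqrtr_sqr ler_wsqrtr // lerDl sqr_ge0. Qed.

Lemma le_Im_nrm (z : R[i]) : `|Im z| <= nrm z.
Proof. by rewrite nrmC -sqrtr_sqr ler_wsqrtr // lerDr sqr_ge0. Qed.

Lemma nrm_le_ReIm (z : R[i]) : nrm z <= `|Re z| + `|Im z|.
Proof.
rewrite nrmC -(ger0_norm (addr_ge0 (normr_ge0 (Re z)) (normr_ge0 (Im z)))).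
rewrite -sqrtr_sqr ler_wsqrtr // sqrrD !real_normK ?num_real //.
by rewrite addrAC lerDl mulrn_wge0 // mulr_ge0.
Qed.

Lemma nrmcM (a b : R[i]) : nrm (a * b) = nrm a * nrm b.
Proof. exact: nrmZ. Qed.

End nrm.

Definition borel (T : ptopologicalType) := g_sigma_algebraType (@open T).
HB.instance Definition _ (T : ptopologicalType) := Measurable.on (borel T).

Lemma measurable_complexP d (T : measurableType d) (R : realType)
    (f : T -> R[i]) :
  measurable_fun [set: T] (f : T -> borel R[i]) <->
  measurable_fun [set: T] (Re \o f) /\ measurable_fun [set: T] (Im \o f).
Proof.
split=> [mf | [mRe mIm]].
  have openRe (U : set R) : open U -> open (Re @^-1` U : set R[i]).
    move=> oU; rewrite openE => z /= Uz.
    have /nbhs_ballP[e /= e0 Be] := open_nbhs_nbhs (conj oU Uz).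
    apply/nbhs_ballP; exists e%:C; first by rewrite /= ltcR.
    move=> w; rewrite -ball_normE /= nrmE ltcR => zw; apply: Be.
    rewrite -ball_normE /=; apply: le_lt_trans zw.
    by have := le_Re_nrm (z - w); rewrite raddfB.
  have openIm (U : set R) : open U -> open (Im @^-1` U : set R[i]).
    move=> oU; rewrite openE => z /= Uz.
    have /nbhs_ballP[e /= e0 Be] := open_nbhs_nbhs (conj oU Uz).
    apply/nbhs_ballP; exists e%:C; first by rewrite /= ltcR.
    move=> w; rewrite -ball_normE /= nrmE ltcR => zw; apply: Be.
    rewrite -ball_normE /=; apply: le_lt_trans zw.
    by have := le_Im_nrm (z - w); rewrite raddfB.
  by split; apply: (measurability _ (RGenOInfty.measurableE R)) => _
    [_ [r ->] <-]; rewrite setTI comp_preimage -[X in measurable X]setTI;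
    apply: mf => //; apply: sub_sigma_algebra;
    [apply: openRe | apply: openIm]; exact: interval_open.
apply: (measurability _ (erefl : @measurable _ (borel R[i]) = _)) => _
  [U oU <-]; rewrite setTI.
pose box (p : rat * rat * nat) : set R[i] := [set z |
  (ratr p.1.1 - p.2.+1%:R^-1 < Re z < ratr p.1.1 + p.2.+1%:R^-1) /\
  (ratr p.1.2 - p.2.+1%:R^-1 < Im z < ratr p.1.2 + p.2.+1%:R^-1)].
have -> : f @^-1` U = \bigcup_(p in [set p | box p `<=` U]) (f @^-1` box p).
  apply/seteqP; split => [x /= Ufx|x [p /= pU] /pU //].
  have /nbhs_ballP[e /= e0 Be] := open_nbhs_nbhs (conj oU Ufx).
  move: e0 Be; rewrite ltcE /= => /andP[/eqP Ime e0] Be.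
  have {}Be w : nrm (f x - w) < Re e -> U w.
    move=> we; apply: Be; rewrite -ball_normE /= nrmE.
    by move: Ime we {e0}; case: e => a b /= -> ?; rewrite ltcR.
  pose n := Num.truncn (4 / Re e).
  have en : n.+1%:R^-1 < Re e / 4.
    rewrite -[X in _ < X]invrK ltf_pV2 ?posrE ?invr_gt0 ?divr_gt0 //.
    by rewrite invf_div truncnS_gt.
  have rat_near (a : R) : exists q : rat,
      ratr q - n.+1%:R^-1 < a < ratr q + n.+1%:R^-1.
    have [|q] := @rat_in_itvoo R (a - n.+1%:R^-1) (a + n.+1%:R^-1).
      by rewrite ltrBlDr -addrA ltrDl addr_gt0 // invr_gt0.
    rewrite in_itv /= => /andP[q1 q2]; exists q.
    by rewrite ltrBlDr q2 /= -ltrBlDr q1.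
  have [q1 q1P] := rat_near (Re (f x)); have [q2 q2P] := rat_near (Im (f x)).
  exists (q1, q2, n) => //= w [/= w1 w2]; apply: Be.
  apply: le_lt_trans (nrm_le_ReIm _) _; rewrite !raddfB /=.
  have close (a b c : R) : c - n.+1%:R^-1 < a < c + n.+1%:R^-1 ->
      c - n.+1%:R^-1 < b < c + n.+1%:R^-1 -> `|a - b| < Re e / 2.
    move=> /andP[a1 a2] /andP[b1 b2]; rewrite ltr_norml.
    by move: a1 a2 b1 b2 en; set h := n.+1%:R^-1; lra.
  by have := close _ _ _ q1P w1; have := close _ _ _ q2P w2; lra.
rewrite bigcup_mkcond; apply: countable_bigcupT_measurable => [|p].
  exact: countableP.
case: ifP => // _.
have mitv (g : T -> R) (a b : R) : measurable_fun [set: T] g ->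
    measurable [set x | a < g x < b].
  move=> mg; have := mg measurableT `]a, b[%classic (measurable_itv _).
  by rewrite setTI; congr measurable; apply/seteqP; split=> x /=;
    rewrite in_itv.
by apply: measurableI; [exact: (mitv (Re \o f)) | exact: (mitv (Im \o f))].
Qed.

Section bmfun.
Context d (T : measurableType d) (R : realType).

Definition bm : {pred T -> R[i]} := [pred f : T -> R[i] |
  `[< measurable_fun [set: T] (f : T -> borel R[i]) /\
      exists M : R, forall x, nrm (f x) <= M >]].

Record bmfun := BMFun { bmfun_val :> T -> R[i]; bmfunP : bmfun_val \in bm }.

HB.instance Definition _ := [isSub for bmfun_val].
HB.instance Definition _ := [Choice of bmfun by <:].

Lemma bmP (f : T -> R[i]) : reflect
  ([/\ measurable_fun [set: T] (Re \o f), measurable_fun [set: T] (Im \o f) &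
     exists M : R, forall x, nrm (f x) <= M]) (f \in bm).
Proof.
apply: (iffP (asboolP _)) => [[/measurable_complexP[? ?] ?]|[? ? ?]] //.
by split=> //; apply/measurable_complexP.
Qed.

Lemma bm_submod : submod_closed bm.
Proof.
split.
  apply/bmP; split; [exact: (measurable_cst (0 : R)) ..|].
  by exists 0 => x; rewrite nrm0.
move=> a f g /bmP[mRf mIf [M fM]] /bmP[mRg mIg [N gN]]; apply/bmP; split.
- rewrite [X in measurable_fun _ X](_ : _ = (fun x =>
    Re a * Re (f x) - Im a * Im (f x) + Re (g x))); last first.
    apply/funext => x /=; rewrite !fctE.
    by case: a (f x) (g x) => [? ?] [? ?] [? ?].
  apply: measurable_funD => //.
  by apply: measurable_funB; apply: measurable_funM => //; exact: measurable_cst.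
- rewrite [X in measurable_fun _ X](_ : _ = (fun x =>
    Re a * Im (f x) + Im a * Re (f x) + Im (g x))); last first.
    apply/funext => x /=; rewrite !fctE.
    by case: a (f x) (g x) => [? ?] [? ?] [? ?].
  apply: measurable_funD => //.
  by apply: measurable_funD; apply: measurable_funM => //; exact: measurable_cst.
- exists (nrm a * M + N) => x; apply: le_trans (nrmD _ _) _.
  by rewrite nrmcM lerD // ler_wpM2l // nrm_ge0.
Qed.

HB.instance Definition _ := GRing.isSubmodClosed.Build _ _ bm bm_submod.
HB.instance Definition _ := [SubChoice_isSubLmodule of bmfun by <:].

Definition bmfun_norm (f : bmfun) : R := sup [set nrm (f x) | x in [set: T]].

Lemma bmfun_bounded (f : bmfun) : exists M : R, forall x, nrm (f x) <= M.
Proof. by have /bmP[] := bmfunP f. Qed.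

Lemma bmfun_has_sup (f : bmfun) : has_sup [set nrm (f x) | x in [set: T]].
Proof.
split; first by exists (nrm (f point)), point.
by have [M fM] := bmfun_bounded f; exists M => _ [x _ <-].
Qed.

Lemma bmfun_le_norm (f : bmfun) x : nrm (f x) <= bmfun_norm f.
Proof. by apply: sup_upper_bound; [exact: bmfun_has_sup|exists x]. Qed.

Lemma bmfun_norm_le (f : bmfun) M : (forall x, nrm (f x) <= M) ->
  bmfun_norm f <= M.
Proof.
move=> fM; apply: ge_sup; first by exists (nrm (f point)), point.
by move=> _ [x _ <-].
Qed.

Lemma bmfun_normD (f g : bmfun) :
  (bmfun_norm (f + g))%:C <= (bmfun_norm f)%:C + (bmfun_norm g)%:C :> R[i].
Proof.
rewrite -rmorphD lecR; apply: bmfun_norm_le => x.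
by apply: le_trans (nrmD _ _) _; rewrite lerD // bmfun_le_norm.
Qed.

Lemma bmfun_normZ (a : R[i]) (f : bmfun) :
  (bmfun_norm (a *: f))%:C = `|a| * (bmfun_norm f)%:C :> R[i].
Proof.
rewrite nrmE -rmorphM; congr (_%:C); apply/eqP; rewrite eq_le.
have H b g : bmfun_norm (b *: g) <= nrm b * bmfun_norm g.
  apply: bmfun_norm_le => x; apply: le_trans (_ : nrm b * nrm (g x) <= _).
    by rewrite -nrmcM.
  by rewrite ler_wpM2l ?nrm_ge0 // bmfun_le_norm.
rewrite H /=; have [->|a0] := eqVneq a 0.
  rewrite nrm0 mul0r; apply: le_trans (bmfun_le_norm _ point).
  exact: nrm_ge0.
have na0 : 0 < nrm a.
  by rewrite lt_neqAle nrm_ge0 andbT eq_sym; apply: contra a0 => /eqP/nrm0_eq0->.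
rewrite mulrC -ler_pdivlMr // mulrC.
have := H a^-1 (a *: f); rewrite scalerA mulVf // scale1r.
suff -> : nrm a^-1 = (nrm a)^-1 by [].
apply: (mulfI (lt0r_neq0 na0)); rewrite -nrmcM !mulfV // ?lt0r_neq0 //.
by rewrite /nrm normr1.
Qed.

Lemma bmfun_norm_eq0 (f : bmfun) : (bmfun_norm f)%:C = 0 :> R[i] -> f = 0.
Proof.
move=> /(congr1 (fun z => Re z)) /= f0; apply/val_inj/funext => x /=.
apply: nrm0_eq0; apply/eqP; rewrite eq_le nrm_ge0 andbT -f0.
exact: bmfun_le_norm.
Qed.

HB.instance Definition _ := Lmodule_isNormed.Build R[i] bmfun
  bmfun_normD bmfun_normZ bmfun_norm_eq0.

Lemma bmfun_nrmE (f : bmfun) : nrm f = sup [set nrm (f x) | x in [set: T]].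
Proof. by []. Qed.

Lemma bmfun_measurable (f : bmfun) :
  measurable_fun [set: T] (Re \o f) /\ measurable_fun [set: T] (Im \o f).
Proof. by have /bmP[] := bmfunP f. Qed.

(** [f] as an element of [bmfun], with the junk value [0] when [f] is not
    bounded and measurable. *)
Definition bm_of (f : T -> R[i]) : bmfun := insubd 0 f.

Lemma bm_ofE (f : T -> R[i]) : f \in bm -> bm_of f = f :> (T -> R[i]).
Proof. exact: insubdK. Qed.

End bmfun.
Arguments bm {d T R}.

Section bop.
Context {R : realType} (V W : normedModType R[i]).

Definition bounded_linear : {pred V -> W} := [pred T : V -> W |
  `[< (forall (a : R[i]) x y, T (a *: x + y) = a *: T x + T y) /\
      exists M : R, forall x, nrm (T x) <= M * nrm x >]].

Record bop := BOp { bop_val :> V -> W; bopP : bop_val \in bounded_linear }.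

HB.instance Definition _ := [isSub for bop_val].
HB.instance Definition _ := [Choice of bop by <:].

Lemma bounded_linearP (T : V -> W) : reflect
  ((forall (a : R[i]) x y, T (a *: x + y) = a *: T x + T y) /\
   exists M : R, forall x, nrm (T x) <= M * nrm x) (T \in bounded_linear).
Proof. exact: asboolP. Qed.

Lemma bounded_linear_submod : submod_closed bounded_linear.
Proof.
split.
  apply/bounded_linearP; split=> [a x y|]; first by rewrite scaler0 addr0.
  by exists 0 => x; rewrite nrm0 mul0r.
move=> a S T /bounded_linearP[lS [M SM]] /bounded_linearP[lT [N TN]].
apply/bounded_linearP; split=> [b x y|].
  rewrite !fctE lS lT !scalerDr !scalerA (mulrC b a) -!addrA; congr (_ + _).
  by rewrite addrCA.
exists (nrm a * M + N) => x; apply: le_trans (nrmD _ _) _.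
by rewrite nrmZ mulrDl lerD // -mulrA ler_wpM2l // nrm_ge0.
Qed.

HB.instance Definition _ :=
  GRing.isSubmodClosed.Build _ _ bounded_linear bounded_linear_submod.
HB.instance Definition _ := [SubChoice_isSubLmodule of bop by <:].

Lemma bop_linear (T : bop) (a : R[i]) x y : T (a *: x + y) = a *: T x + T y.
Proof. by have /bounded_linearP[] := bopP T. Qed.

Lemma bopD (T : bop) x y : T (x + y) = T x + T y.
Proof. by have := bop_linear T 1 x y; rewrite !scale1r. Qed.

Lemma bop0 (T : bop) : T 0 = 0.
Proof. by apply: (addrI (T 0)); rewrite -bopD !addr0. Qed.

Lemma bopZ (T : bop) (a : R[i]) x : T (a *: x) = a *: T x.
Proof. by have := bop_linear T a x 0; rewrite bop0 !addr0. Qed.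

Lemma bop_bounded (T : bop) : exists M : R, forall x, nrm (T x) <= M * nrm x.
Proof. by have /bounded_linearP[] := bopP T. Qed.

Definition bop_norm (T : bop) : R :=
  sup [set nrm (T x) | x in [set x | nrm x <= 1]].

Lemma bop_has_sup (T : bop) :
  has_sup [set nrm (T x) | x in [set x | nrm x <= 1]].
Proof.
split; first by exists (nrm (T 0)), 0 => //=; rewrite nrm0.
have [M TM] := bop_bounded T; exists `|M| => _ [x /= x1 <-].
apply: le_trans (TM x) _; apply: le_trans (_ : `|M| * nrm x <= _).
  by rewrite ler_wpM2r ?nrm_ge0 // ler_norm.
by rewrite ler_piMr.
Qed.

Lemma bop_norm_ge0 (T : bop) : 0 <= bop_norm T.
Proof.
apply: (@le_trans _ _ (nrm (T 0))); first exact: nrm_ge0.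
by apply: sup_upper_bound; [exact: bop_has_sup|exists 0 => //=; rewrite nrm0].
Qed.

Lemma bop_le_norm (T : bop) x : nrm (T x) <= bop_norm T * nrm x.
Proof.
have [->|x0] := eqVneq x 0; first by rewrite bop0 !nrm0 mulr0.
have nx0 : 0 < nrm x.
  by rewrite lt_neqAle nrm_ge0 andbT eq_sym; apply: contra x0 => /eqP/nrm0_eq0->.
have nV : nrm (nrm x)^-1%:C = (nrm x)^-1.
  by rewrite nrmC /= expr0n addr0 sqrtr_sqr ger0_norm // invr_ge0 ltW.
rewrite -ler_pdivrMr // mulrC -nV -nrmZ -bopZ.
apply: sup_upper_bound; first exact: bop_has_sup.
by exists ((nrm x)^-1%:C *: x) => //=; rewrite nrmZ nV mulVf // lt0r_neq0.
Qed.

Lemma bop_norm_le (T : bop) M : 0 <= M ->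
  (forall x, nrm (T x) <= M * nrm x) -> bop_norm T <= M.
Proof.
move=> M0 TM; apply: ge_sup; first by have [] := bop_has_sup T.
by move=> _ [x /= x1 <-]; apply: le_trans (TM x) _; rewrite ler_piMr.
Qed.

Lemma bop_normD (S T : bop) :
  (bop_norm (S + T))%:C <= (bop_norm S)%:C + (bop_norm T)%:C :> R[i].
Proof.
rewrite -rmorphD lecR; apply: bop_norm_le => [|x].
  by rewrite addr_ge0 ?bop_norm_ge0.
by apply: le_trans (nrmD _ _) _; rewrite mulrDl lerD // bop_le_norm.
Qed.

Lemma bop_normZ (a : R[i]) (T : bop) :
  (bop_norm (a *: T))%:C = `|a| * (bop_norm T)%:C :> R[i].
Proof.
rewrite nrmE -rmorphM; congr (_%:C); apply/eqP; rewrite eq_le.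
have H b S : bop_norm (b *: S) <= nrm b * bop_norm S.
  apply: bop_norm_le => [|x]; first by rewrite mulr_ge0 ?nrm_ge0 ?bop_norm_ge0.
  by rewrite nrmZ -mulrA ler_wpM2l ?nrm_ge0 // bop_le_norm.
rewrite H /=; have [->|a0] := eqVneq a 0.
  by rewrite nrm0 mul0r bop_norm_ge0.
have na0 : 0 < nrm a.
  by rewrite lt_neqAle nrm_ge0 andbT eq_sym; apply: contra a0 => /eqP/nrm0_eq0->.
rewrite mulrC -ler_pdivlMr // mulrC.
have := H a^-1 (a *: T); rewrite scalerA mulVf // scale1r.
suff -> : nrm a^-1 = (nrm a)^-1 by [].
apply: (mulfI (lt0r_neq0 na0)); rewrite -nrmcM !mulfV // ?lt0r_neq0 //.
by rewrite /nrm normr1.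
Qed.

Lemma bop_norm_eq0 (T : bop) : (bop_norm T)%:C = 0 :> R[i] -> T = 0.
Proof.
move=> /(congr1 (fun z => Re z)) /= T0; apply/val_inj/funext => x /=.
apply: nrm0_eq0; apply/eqP; rewrite eq_le nrm_ge0 andbT.
by have := bop_le_norm T x; rewrite T0 mul0r.
Qed.

HB.instance Definition _ := Lmodule_isNormed.Build R[i] bop
  bop_normD bop_normZ bop_norm_eq0.

Lemma bop_nrmE (T : bop) :
  nrm T = sup [set nrm (T x) | x in [set x | nrm x <= 1]].
Proof. by []. Qed.

End bop.
Arguments bounded_linear {R} V W.

Definition dual {R : realType} (V : normedModType R[i]) := bop V R[i].

Section bop_algebra.
Context {R : realType}.
Implicit Types U V W : normedModType R[i].

Lemma bcomp_subproof U V W (S : bop V W) (T : bop U V) :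
  (fun x => S (T x)) \in bounded_linear U W.
Proof.
apply/bounded_linearP; split=> [a x y|]; first by rewrite !bop_linear.
exists (bop_norm S * bop_norm T) => x; apply: le_trans (bop_le_norm _ _) _.
by rewrite -mulrA ler_wpM2l ?bop_norm_ge0 // bop_le_norm.
Qed.

Definition bcomp U V W (S : bop V W) (T : bop U V) : bop U W :=
  BOp (bcomp_subproof S T).

Lemma bid_subproof V : id \in bounded_linear V V.
Proof. by apply/bounded_linearP; split=> //; exists 1 => x; rewrite mul1r. Qed.

Definition bid V : bop V V := BOp (bid_subproof V).

Definition bpow V (T : bop V V) (n : nat) : bop V V := iter n (bcomp T) (bid V).

Lemma tensor_subproof V (v : V) (phi : dual V) :
  (fun f => phi f *: v) \in bounded_linear V V.
Proof.
apply/bounded_linearP; split=> [a x y|].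
  by rewrite bop_linear scalerDl scalerA.
exists (bop_norm phi * nrm v) => x; rewrite nrmZ mulrAC ler_wpM2r ?nrm_ge0 //.
exact: bop_le_norm.
Qed.

Definition tensor V (v : V) (phi : dual V) : bop V V :=
  BOp (tensor_subproof v phi).

Definition spectrum V (T : bop V V) : set R[i] := [set mu |
  ~ exists S : bop V V, bcomp S (mu *: bid V - T) = bid V /\
                        bcomp (mu *: bid V - T) S = bid V].

Definition spectral_radius V (T : bop V V) : \bar R :=
  ereal_sup [set (nrm mu)%:E | mu in spectrum T].

Definition leading_eigenvalue V (T : bop V V) (lam : R[i]) :=
  (exists2 v : V, v != 0 & T v = lam *: v) /\
  (forall mu, spectrum T mu -> mu != lam -> nrm mu < nrm lam).

(** Algebraic multiplicity one: the generalized eigenspace is a line. *)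
Definition simple_eigenvalue V (T : bop V V) (lam : R[i]) :=
  exists2 v : V, v != 0 & forall h : V,
    (exists n, bpow (T - lam *: bid V) n h = 0) <-> (exists a, h = a *: v).

Definition isolated_in_spectrum V (T : bop V V) (lam : R[i]) :=
  spectrum T lam /\
  exists2 e : R, 0 < e &
    forall mu, spectrum T mu -> mu != lam -> e <= nrm (mu - lam).

Definition direct_sum V (F H : set V) :=
  forall x : V, exists! p : V * V, [/\ F p.1, H p.2 & x = p.1 + p.2].

Definition analytic_at V (f : R[i] -> V) (z0 : R[i]) :=
  exists (a : nat -> V) (rho : R), 0 < rho /\ forall z, nrm (z - z0) < rho ->
    series (fun k => (z - z0) ^+ k *: a k) @ \oo --> f z.

End bop_algebra.

Section cint.
Context d (T : measurableType d) (R : realType).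

Definition cint (mu : {measure set T -> \bar R}) (f : T -> R[i]) : R[i] :=
  (\int[mu]_x Re (f x)) +i* (\int[mu]_x Im (f x)).

(** For probability measures this is [2 * sup_A |mu A - nu A|]. *)
Definition tv (mu nu : {measure set T -> \bar R}) : \bar R :=
  ereal_sup [set (nrm (cint mu f - cint nu f))%:E |
    f in [set f : bmfun T R | nrm f <= 1]].

(** [kpow k n x] is the measure [delta_x k^n]. *)
Fixpoint kpow (k : R.-spker T ~> T) (n : nat) : R.-spker T ~> T :=
  if n is n'.+1 then mkcomp_noparam k (kpow k n')
  else kdirac (@measurable_id _ T [set: T]).

End cint.

Section kint.
Context d d' (T : measurableType d) (T' : measurableType d') (R : realType).
Variable k : R.-pker T ~> T'.

Let integrable_bounded x (h : T' -> R) M : measurable_fun [set: T'] h ->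
  (forall y, `|h y| <= M) -> (k x).-integrable [set: T'] (EFin \o h).
Proof.
move=> mh hM; apply: measurable_bounded_integrable => //.
  by rewrite prob_kernel ltry.
exists M; split; first exact: num_real.
by move=> r Mr y _; apply: le_trans (hM y) (ltW Mr).
Qed.

Let measurable_kint_real (h : T' -> R) M : measurable_fun [set: T'] h ->
  (forall y, `|h y| <= M) ->
  measurable_fun [set: T] (fun x => \int[k x]_y h y).
Proof.
move=> mh hM.
have mM : measurable_fun [set: T'] (fun=> M) by exact: measurable_cst.
rewrite [X in measurable_fun _ X](_ : _ = (fun x =>
    fine (\int[k x]_y (h y + M)%:E) - M)); last first.
  apply/funext => x; rewrite -/(Rintegral _ _ (fun y => h y + M)).
  rewrite RintegralD //; last 2 first.
  - exact: (integrable_bounded _ _ hM).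
  - by apply: (@integrable_bounded x _ `|M|).
  by rewrite Rintegral_cst // prob_kernel /= mulr1 addrK.
apply: measurable_funB; last exact: measurable_cst.
apply: measurableT_comp; first exact: fine_measurable.
apply: (measurable_fun_integral_kernel (l := k)).
- exact: measurable_kernel.
- move=> y; rewrite lee_fin -lerBlDr sub0r.
  by have := hM y; rewrite ler_norml => /andP[].
- by apply/measurable_EFinP; exact: measurable_funD.
Qed.

Let kint_real_le x (h : T' -> R) M : measurable_fun [set: T'] h ->
  (forall y, `|h y| <= M) -> `|\int[k x]_y h y| <= M.
Proof.
move=> mh hM; apply: le_trans (le_normr_Rintegral _ _) _ => //.
  exact: (integrable_bounded _ _ hM).
apply: (@le_trans _ _ (\int[k x]_y (fun=> M) y)).
  apply: le_Rintegral => //.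
  - apply: (@integrable_bounded x _ M) => [|y]; first exact: measurableT_comp.
    by rewrite normr_id.
  - by apply: (@integrable_bounded x _ `|M|).
by rewrite Rintegral_cst // prob_kernel /= mulr1.
Qed.

Let Re_le (f : bmfun T' R) y : `|Re (f y)| <= nrm f.
Proof. exact: le_trans (le_Re_nrm _) (bmfun_le_norm _ _). Qed.

Let Im_le (f : bmfun T' R) y : `|Im (f y)| <= nrm f.
Proof. exact: le_trans (le_Im_nrm _) (bmfun_le_norm _ _). Qed.

Lemma kint_subproof (f : bmfun T' R) : (fun x => cint (k x) f) \in bm.
Proof.
have [mRe mIm] := bmfun_measurable f.
apply/bmP; split.
- exact: (measurable_kint_real mRe (Re_le f)).
- exact: (measurable_kint_real mIm (Im_le f)).
exists (nrm f + nrm f) => x; apply: le_trans (nrm_le_ReIm _) _.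
by rewrite lerD //; exact: kint_real_le.
Qed.

Definition kint_fun (f : bmfun T' R) : bmfun T R := BMFun (kint_subproof f).

Let kint_bounded_linear : kint_fun \in bounded_linear _ _.
Proof.
apply/bounded_linearP; split=> [a f g|].
  apply/val_inj/funext => x; rewrite /= !fctE /cint /=.
  have [mRf mIf] := bmfun_measurable f; have [mRg mIg] := bmfun_measurable g.
  have iRf := integrable_bounded x mRf (Re_le f).
  have iIf := integrable_bounded x mIf (Im_le f).
  have iRg := integrable_bounded x mRg (Re_le g).
  have iIg := integrable_bounded x mIg (Im_le g).
  have iZ (c : R) h : (k x).-integrable [set: T'] (EFin \o h) ->
      (k x).-integrable [set: T'] (EFin \o (fun y => c * h y)).
    by move=> ih; exact: (integrableZl measurableT c ih).
  have iD h1 h2 : (k x).-integrable [set: T'] (EFin \o h1) ->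
      (k x).-integrable [set: T'] (EFin \o h2) ->
      (k x).-integrable [set: T'] (EFin \o (fun y => h1 y + h2 y)).
    by move=> i1 i2; exact: (integrableD measurableT i1 i2).
  have -> : \int[k x]_y Re ((a *: f + g) y) =
      Re a * \int[k x]_y Re (f y) + - Im a * \int[k x]_y Im (f y) +
      \int[k x]_y Re (g y).
    rewrite -!RintegralZl // -!RintegralD //; last 3 first.
    - by apply: iD; exact: iZ.
    - exact: iZ.
    - exact: iZ.
    apply: eq_Rintegral => y _ /=; rewrite !fctE.
    by case: a (f y) (g y) => [? ?] [? ?] [? ?] /=; rewrite mulNr.
  have -> : \int[k x]_y Im ((a *: f + g) y) =
      Re a * \int[k x]_y Im (f y) + Im a * \int[k x]_y Re (f y) +
      \int[k x]_y Im (g y).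
    rewrite -!RintegralZl // -!RintegralD //; last 3 first.
    - by apply: iD; exact: iZ.
    - exact: iZ.
    - exact: iZ.
    apply: eq_Rintegral => y _ /=; rewrite !fctE.
    by case: a (f y) (g y) => [? ?] [? ?] [? ?].
  by case: a => a b /=; rewrite mulNr.
exists 2 => f; apply: bmfun_norm_le => x; rewrite mulr_natl mulr2n.
have [mRe mIm] := bmfun_measurable f.
apply: le_trans (nrm_le_ReIm _) _.
by rewrite lerD //; exact: kint_real_le.
Qed.

Definition kint : bop (bmfun T' R) (bmfun T R) := BOp kint_bounded_linear.

End kint.

Section bmul.
Context d (T : measurableType d) (R : realType).

Lemma bmul_subproof (f g : bmfun T R) : (fun x => f x * g x) \in bm.
Proof.
have [mRf mIf] := bmfun_measurable f; have [mRg mIg] := bmfun_measurable g.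
apply/bmP; split.
- rewrite [X in measurable_fun _ X](_ : _ = (fun x =>
    Re (f x) * Re (g x) - Im (f x) * Im (g x))); last first.
    by apply/funext => x /=; case: (f x) (g x) => [? ?] [? ?].
  by apply: measurable_funB; apply: measurable_funM.
- rewrite [X in measurable_fun _ X](_ : _ = (fun x =>
    Re (f x) * Im (g x) + Im (f x) * Re (g x))); last first.
    by apply/funext => x /=; case: (f x) (g x) => [? ?] [? ?].
  by apply: measurable_funD; apply: measurable_funM.
- exists (nrm f * nrm g) => x; rewrite nrmcM ler_pM ?nrm_ge0 //;
  exact: bmfun_le_norm.
Qed.

Definition bmul_fun (f g : bmfun T R) : bmfun T R := BMFun (bmul_subproof f g).

Let bmul_bounded_linear (f : bmfun T R) : bmul_fun f \in bounded_linear _ _.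
Proof.
apply/bounded_linearP; split=> [a g h|].
  apply/val_inj/funext => x; rewrite /= !fctE.
  by rewrite mulrDr; congr (_ + _); exact: mulrCA.
exists (nrm f) => g; apply: bmfun_norm_le => x /=.
by rewrite nrmcM ler_pM ?nrm_ge0 //; exact: bmfun_le_norm.
Qed.

Definition bmul (f : bmfun T R) : bop (bmfun T R) (bmfun T R) :=
  BOp (bmul_bounded_linear f).

End bmul.

Definition cexp {R : realType} (z : R[i]) : R[i] :=
  (expR (Re z) * cos (Im z)) +i* (expR (Re z) * sin (Im z)).

(** For [h] bounded and measurable this is the operator
    [f |-> (x |-> \int exp(z * h y) * f y k(x, dy))], see [twistedE]. *)
Definition twisted d (T : measurableType d) (R : realType)
    (k : R.-pker T ~> T) (h : T -> R) (z : R[i]) : bop (bmfun T R) (bmfun T R) :=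
  bcomp (kint k) (bmul (bm_of (fun y => cexp (z * (h y)%:C)))).

Lemma nrm_cexp (R : realType) (z : R[i]) : nrm (cexp z) = expR (Re z).
Proof.
by rewrite nrmC /= !exprMn -mulrDr cos2Dsin2 mulr1 sqrtr_sqr ger0_norm ?expR_ge0.
Qed.

Lemma bm_cexp d (T : measurableType d) (R : realType) (h : T -> R) (M : R)
    (z : R[i]) : measurable_fun [set: T] h -> (forall y, `|h y| <= M) ->
  (fun y => cexp (z * (h y)%:C)) \in bm.
Proof.
move=> mh hM.
have eRe y : Re (z * (h y)%:C) = Re z * h y.
  by case: z => a b /=; rewrite mulr0 subr0.
have eIm y : Im (z * (h y)%:C) = Im z * h y.
  by case: z {eRe} => a b /=; rewrite mulr0 add0r.
have mexp : measurable_fun [set: T] (fun y => expR (Re z * h y)).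
  apply: measurableT_comp; first exact: measurable_expR.
  by apply: measurable_funM => //; exact: measurable_cst.
have mIm : measurable_fun [set: T] (fun y => Im z * h y).
  by apply: measurable_funM => //; exact: measurable_cst.
apply/bmP; split.
- rewrite [X in measurable_fun _ X](_ : _ = (fun y =>
    expR (Re z * h y) * cos (Im z * h y))); last first.
    by apply/funext => y; rewrite /= eRe eIm.
  apply: measurable_funM => //; apply: (measurableT_comp (f := cos)) => //.
  by apply: continuous_measurable_fun; exact: continuous_cos.
- rewrite [X in measurable_fun _ X](_ : _ = (fun y =>
    expR (Re z * h y) * sin (Im z * h y))); last first.
    by apply/funext => y; rewrite /= eRe eIm.
  apply: measurable_funM => //; apply: (measurableT_comp (f := sin)) => //.
  by apply: continuous_measurable_fun; exact: continuous_sin.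
- exists (expR (`|Re z| * M)) => y; rewrite nrm_cexp eRe ler_expR.
  by apply: le_trans (ler_norm _) _; rewrite normrM ler_wpM2l.
Qed.

Lemma twistedE d (T : measurableType d) (R : realType) (k : R.-pker T ~> T)
    (h : T -> R) (M : R) (z : R[i]) (f : bmfun T R) (x : T) :
  measurable_fun [set: T] h -> (forall y, `|h y| <= M) ->
  twisted k h z f x = cint (k x) (fun y => cexp (z * (h y)%:C) * f y).
Proof.
move=> mh hM; rewrite /=; congr cint; apply/funext => y /=.
by rewrite bm_ofE //; exact: bm_cexp hM.
Qed.

(** Nonempty metric spaces: measurable types in the library are pointed, and
    the base point is otherwise irrelevant. *)
#[short(type="pmetricType")]
HB.structure Definition PointedMetric (K : numDomainType) :=
  { M of Metric K M & Pointed M }.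

(* Main.v *)
From HB Require Import structures.
Require Import Defs.
From mathcomp Require Import all_boot all_order all_algebra.
From mathcomp Require Import all_classical all_reals all_analysis.
From mathcomp Require Import measurable_realfun.
From mathcomp Require Import complex lra ring.
Import Order.TTheory GRing.Theory Num.Theory.
Import numFieldNormedType.Exports.
Set Implicit Arguments. Unset Strict Implicit. Unset Printing Implicit Defensive.
Local Open Scope classical_set_scope.
Local Open Scope ring_scope.

(** Everything is expressed through power series in [z] whose coefficients are
    summable against the weights [rho ^+ k]. This weighted l1 norm is
    submultiplicative under Cauchy products and bounds all derivatives on a
    smaller disc, so that analyticity, uniformity in [u] and uniformity in the
    exponent [n] come without contour integrals.

    At [z = 0] the contraction hypothesis says that [Q_u^m] is a rank-one
    operator plus an operator of norm [<= r0 < 1]; a Neumann series then yields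
    the invariant functional [p], with [||(Q_u - 1 (x) p)^m|| <= r0], and the
    reduced resolvent [S] of [1 - Q_u], all bounded uniformly in [u].
    The eigenvector, normalized by [<p, ups> = 1], and the eigenvalue are built
    by the Rayleigh-Schroedinger recursion on Taylor coefficients, whose l1
    partial sums are controlled by induction; the dual eigenvector is the sum of
    a geometric series. Since the constant coefficient of [N_{u,z}^m] has norm
    [<= r0], its weighted l1 norm is [< 1] on a small disc, which bounds all
    powers of [N_{u,z}] and localizes the spectrum. Lipschitz dependence on [u]
    follows by subtracting the eigenvalue equations for [u] and [v]. *)

(** * Norms and absolute summability *)

(** Only the power [Q_u ^+ m] contracts, so neither [Q_u - 1 (x) p] nor [N_{u,z}] need have norm
    below 1. Smallness is therefore always stated for an m-th power: resolvents come from [1 - T ^+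
    m = (1 - T) * (\sum_(k < m) T ^+ k)], and the spectrum is separated by a number [q < 1] whose
    m-th power still exceeds [(1 + r0) / 2]. Normalizing [ups] against the unperturbed [p] decouples
    the two eigenvectors: the recursion for [ups] and [lam] does not involve [phi], and [phi] then
    solves a linear equation with known data whose solution satisfies [<phi, ups> = 1] without
    dividing by a pairing. The radii depend only on [m], [r0] and [K]: on [rho] the exponential
    series is controlled, on [eps / 2 * rho] the nonconstant part of [Q_{u,z}] has weight at most
    [eps], on [rho2] the m-th power of the remainder has weight below 1, and [rho2 / 8] leaves room
    for three derivatives. *)

Section Norm.
Context {R : realType} {V : normedModType R[i]}.
Implicit Types (x y z : V) (a : nat -> V).

Lemma nrmN x : nrm (- x) = nrm x.
Proof. by rewrite /nrm normrN. Qed.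

Lemma nrm_distC x y : nrm (x - y) = nrm (y - x).
Proof. by rewrite -nrmN opprB. Qed.

Lemma nrm_distD y x z : nrm (x - z) <= nrm (x - y) + nrm (y - z).
Proof. by rewrite -[x - z](subrKA y) nrmD. Qed.

Lemma nrmB x y : nrm (x - y) <= nrm x + nrm y.
Proof. by rewrite -(nrmN y) nrmD. Qed.

Lemma nrm_sub x y : nrm x <= nrm (x - y) + nrm y.
Proof. by have := nrm_distD y x 0; rewrite !subr0. Qed.

Lemma nrm_sum (I : Type) (r : seq I) (P : pred I) (F : I -> V) :
  nrm (\sum_(i <- r | P i) F i) <= \sum_(i <- r | P i) nrm (F i).
Proof.
elim/big_ind2 : _ => [|x1 x2 y1 y2 h1 h2|//]; first by rewrite nrm0.
by rewrite (le_trans (nrmD _ _))// lerD.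
Qed.

Lemma nrm_le0 x : nrm x <= 0 -> x = 0.
Proof. by move=> x0; apply: nrm0_eq0; apply/eqP; rewrite eq_le x0 nrm_ge0. Qed.

Definition tends (s : nat -> V) (l : V) := forall e : R, 0 < e ->
  exists N, forall n, (N <= n)%N -> nrm (s n - l) <= e.

(** One-sided, since [u] stands for an upper bound on an error. *)
Definition vanishing (u : nat -> R) := forall e : R, 0 < e ->
  exists N, forall n, (N <= n)%N -> u n <= e.

Definition absum a (M : R) := forall n, \sum_(k < n) nrm (a k) <= M.

(** Completeness in its series form: an absolutely convergent series converges. The vector limits
    constructed below are sums of such series. *)
Definition banach := forall a M, absum a M ->
  exists l, tends (fun n => \sum_(k < n) a k) l.

Lemma eq0_of_small (r : R) : (forall e, 0 < e -> r <= e) -> r <= 0.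
Proof.
move=> h; rewrite leNgt; apply/negP => r0.
by have := h (r / 2); rewrite divr_gt0// => /(_ isT); lra.
Qed.

Lemma tends_unique s l l' : tends s l -> tends s l' -> l = l'.
Proof.
move=> h h'; apply/eqP; rewrite -subr_eq0; apply/eqP/nrm_le0/eq0_of_small => e e0.
have e2 : 0 < e / 2 by rewrite divr_gt0.
have [N hN] := h _ e2; have [N' hN'] := h' _ e2.
have := hN _ (leq_maxl N N'); have := hN' _ (leq_maxr N N').
have := nrm_distD (s (maxn N N')) l l'; rewrite (nrm_distC l (s _)); lra.
Qed.

Lemma tends_le s l c (B : R) (n0 : nat) : tends s l ->
  (forall n, (n0 <= n)%N -> nrm (s n - c) <= B) -> nrm (l - c) <= B.
Proof.
move=> h hB; rewrite -subr_le0; apply: eq0_of_small => e e0.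
have [N hN] := h _ e0.
have := hN _ (leq_maxl N n0); have := hB _ (leq_maxr N n0).
have := nrm_distD (s (maxn N n0)) l c; rewrite (nrm_distC l (s _)); lra.
Qed.

Lemma tends_squeeze s l u : vanishing u -> (forall n, nrm (s n - l) <= u n) ->
  tends s l.
Proof.
move=> hu h e /hu[N hN]; by exists N => n /hN; exact/le_trans/h.
Qed.

Lemma eq_tends s s' l : s =1 s' -> tends s l -> tends s' l.
Proof. by move=> E h e /h[N hN]; exists N => n /hN; rewrite E. Qed.

Lemma tendsD s s' l l' : tends s l -> tends s' l' ->
  tends (fun n => s n + s' n) (l + l').
Proof.
move=> h h' e e0; have e2 : 0 < e / 2 by rewrite divr_gt0.
have [N hN] := h _ e2; have [N' hN'] := h' _ e2.
exists (maxn N N') => n; rewrite geq_max => /andP[/hN H /hN' H'].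
by rewrite opprD addrACA (le_trans (nrmD _ _))//; lra.
Qed.

Lemma tends_cst l : tends (fun=> l) l.
Proof. by move=> e e0; exists 0%N => n _; rewrite subrr nrm0 ltW. Qed.

Lemma tends_cvg s l : tends s l <-> s @ \oo --> l.
Proof.
split=> [h|h e e0].
  apply/cvgrPdist_le => e; rewrite ltcE/= => /andP[/eqP Ie e0].
  have eE : e = (complex.Re e)%:C%C by case: (e) Ie => a b /= ->.
  have [N hN] := h _ e0; exists N => // n /= /hN.
  by rewrite nrm_distC nrmE eE lecR.
move/cvgrPdist_le: h => /(_ e%:C%C); rewrite ltcR => /(_ e0)[N _ hN].
by exists N => n /hN; rewrite /= nrmE lecR nrm_distC.
Qed.

End Norm.
Arguments banach {R} V.

Lemma tends_map {R : realType} {V W : normedModType R[i]} (F : V -> W) (M : R) (s : nat -> V) (l : V) :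
  (forall x y, nrm (F x - F y) <= M * nrm (x - y)) ->
  tends s l -> tends (fun n => F (s n)) (F l).
Proof.
move=> hF h e e0; have M0 : 0 < `|M| + 1 by rewrite ltr_wpDl.
have [N hN] := h _ (divr_gt0 e0 M0); exists N => n /hN H.
rewrite (le_trans (hF _ _))// (@le_trans _ _ ((`|M| + 1) * nrm (s n - l)))//.
  by rewrite ler_wpM2r ?nrm_ge0// (le_trans (ler_norm _))// lerDl.
by rewrite mulrC -ler_pdivlMr.
Qed.

(** * Completeness of the scalars, of operator spaces and of bounded measurable functions *)

Section RealSeq.
Context {R : realType}.

Lemma nondecreasing_limit (u : nat -> R) (M : R) :
  (forall n, u n <= u n.+1) -> (forall n, u n <= M) ->
  exists l : R, (forall n, u n <= l) /\ vanishing (fun n => l - u n).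
Proof.
move=> mu uM; pose A := range u; exists (sup A).
have hA : has_sup A by split; [exists (u 0%N), 0%N|exists M => _ [n _ <-]].
split=> [n|e e0]; first by apply: sup_upper_bound => //; exists n.
have [_ [N _ <-] hN] := sup_adherent e0 hA.
exists N => n Nn; have : u N <= u n.
  rewrite -(subnK Nn); elim: (n - N)%N => // k; rewrite addSn => h.
  exact: le_trans h (mu _).
lra.
Qed.

Lemma vanishing_expr (q : R) : 0 <= q < 1 -> vanishing (fun n => q ^+ n).
Proof.
move=> /andP[q0 q1] e e0; have : `|q| < 1 by rewrite ger0_norm.
move=> /(@cvg_expr R) /cvgrPdist_le /(_ _ e0)[N _ hN].
by exists N => n /hN /=; rewrite sub0r normrN ger0_norm// exprn_ge0.
Qed.

Lemma vanishingM (c : R) (u : nat -> R) : 0 <= c -> vanishing u ->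
  vanishing (fun n => c * u n).
Proof.
move=> c0 hu e e0; have M0 : 0 < c + 1 by rewrite ltr_wpDl.
have [N hN] := hu _ (divr_gt0 e0 M0); exists N => n /hN H.
have := ler_wpM2l c0 H; move/le_trans; apply.
rewrite mulrA ler_pdivrMr// mulrC ler_wpM2l ?ltW//; lra.
Qed.

(** The bound [t n] does not depend on the block length, so it survives the passage to the limit. In
    spaces of functions and operators it turns pointwise convergence into convergence in norm. *)
Lemma absum_tail (V : normedModType R[i]) (a : nat -> V) (M : R) : absum a M ->
  exists2 t : nat -> R, vanishing t &
    forall n k, \sum_(n <= i < n + k) nrm (a i) <= t n.
Proof.
move=> aM; pose u n := \sum_(i < n) nrm (a i).
have [|//|l [ul hl]] := @nondecreasing_limit u M.
  by move=> n; rewrite /u big_ord_recr/= lerDl nrm_ge0.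
exists (fun n => l - u n) => // n k.
have := ul (n + k)%N; rewrite /u -!(big_mkord xpredT (nrm \o a)).
rewrite (@big_cat_nat _ _ _ n)//= ?leq_addr//; lra.
Qed.

Lemma partial_sum_diff (V : zmodType) (a : nat -> V) n k :
  \sum_(i < n + k) a i - \sum_(i < n) a i = \sum_(n <= i < n + k) a i.
Proof.
rewrite -!(big_mkord xpredT a) (@big_cat_nat _ _ _ n)//= ?leq_addr//.
by rewrite addrAC subrr add0r.
Qed.

Lemma absum_tends_tail (V : normedModType R[i]) (a : nat -> V) (l : V) t :
  tends (fun n => \sum_(k < n) a k) l ->
  (forall n k, \sum_(n <= i < n + k) nrm (a i) <= t n) ->
  forall n, nrm (l - \sum_(k < n) a k) <= t n.
Proof.
move=> hl ht n; apply: (tends_le (n0 := n) hl) => m nm.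
rewrite -(subnKC nm) partial_sum_diff (le_trans (nrm_sum _ _ _))//; exact: ht.
Qed.

Lemma complex_tends (s : nat -> R[i]) (a b : R) :
  vanishing (fun n => `|complex.Re (s n) - a|) ->
  vanishing (fun n => `|complex.Im (s n) - b|) ->
  tends s (a +i* b)%C.
Proof.
move=> ha hb e e0; have e2 : 0 < e / 2 by rewrite divr_gt0.
have [N hN] := ha _ e2; have [N' hN'] := hb _ e2.
exists (maxn N N') => n; rewrite geq_max => /andP[/hN H /hN' H'].
by rewrite (le_trans (nrm_le_ReIm _))// !raddfB/=; lra.
Qed.

(** Monotone limits suffice, because [x = (x + y) - y] is a difference of two sequences of
    nonnegative terms. *)
Lemma real_absum_cvg (x y : nat -> R) (M : R) : (forall k, `|x k| <= y k) ->
  (forall n, \sum_(k < n) y k <= M) ->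
  exists l, vanishing (fun n => `|\sum_(k < n) x k - l|).
Proof.
move=> xy yM.
have xy1 k : 0 <= x k + y k by have := xy k; rewrite ler_norml; lra.
have xy2 k : x k <= y k by have := xy k; rewrite ler_norml; lra.
have y0 k : 0 <= y k by exact: le_trans (xy k).
have [|n|l [ul hl]] := @nondecreasing_limit (fun n => \sum_(k < n) (x k + y k)) (M + M).
- by move=> n; rewrite big_ord_recr/= lerDl.
- by rewrite big_split/= lerD// (le_trans _ (yM n))// ler_sum.
have [|//|l' [ul' hl']] := @nondecreasing_limit (fun n => \sum_(k < n) y k) M.
  by move=> n; rewrite big_ord_recr/= lerDl.
exists (l - l') => e e0; have e2 : 0 < e / 2 by rewrite divr_gt0.
have [N hN] := hl _ e2; have [N' hN'] := hl' _ e2.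
exists (maxn N N') => n; rewrite geq_max => /andP[/hN + /hN'].
have := ul n; have := ul' n; rewrite big_split/= ler_norml; lra.
Qed.

Lemma banach_complex : banach (R[i] : normedModType R[i]).
Proof.
move=> a M aM.
have [|l1 h1] := @real_absum_cvg (@complex.Re R \o a) (fun k => nrm (a k)) M _ aM.
  by move=> k; exact: le_Re_nrm.
have [|l2 h2] := @real_absum_cvg (@complex.Im R \o a) (fun k => nrm (a k)) M _ aM.
  by move=> k; exact: le_Im_nrm.
exists (l1 +i* l2)%C; apply: complex_tends => e e0.
  by have [N hN] := h1 _ e0; exists N => n /hN; rewrite raddf_sum.
by have [N hN] := h2 _ e0; exists N => n /hN; rewrite raddf_sum.
Qed.

End RealSeq.

Section BanachBop.
Context {R : realType} {V W : normedModType R[i]}.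

Lemma nrm_app (T : bop V W) x : nrm (T x) <= nrm T * nrm x.
Proof. exact: bop_le_norm. Qed.

Lemma nrm_bop_le (T : bop V W) (M : R) : 0 <= M ->
  (forall x, nrm (T x) <= M * nrm x) -> nrm T <= M.
Proof. exact: bop_norm_le. Qed.

Lemma bop_ext (S T : bop V W) : (forall x, S x = T x) -> S = T.
Proof. by move=> h; apply/val_inj/funext. Qed.

HB.instance Definition _ (T : bop V W) :=
  GRing.isLinear.Build R[i] V W _ (bop_val T) (bop_linear T).

Lemma bopBE (S T : bop V W) x : (S - T) x = S x - T x. Proof. by []. Qed.
Lemma bopZE (c : R[i]) (S : bop V W) x : (c *: S) x = c *: S x. Proof. by []. Qed.
Lemma bop_sumE (I : Type) (r : seq I) (P : pred I) (F : I -> bop V W) x :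
  (\sum_(i <- r | P i) F i) x = \sum_(i <- r | P i) F i x.
Proof. by elim/big_ind2 : _ => // ? ? ? ? <- <-. Qed.

(** The pointwise sum is the candidate; the tail of the operator norms bounds the error at [x] by
    [t n * nrm x], hence in operator norm. *)
Lemma banach_bop : banach W -> banach (bop V W : normedModType R[i]).
Proof.
move=> bW a M aM.
have /choice[F hF] : forall x, exists l, tends (fun n => \sum_(k < n) a k x) l.
  move=> x; apply: (bW (fun k => a k x) (M * nrm x)) => n.
  rewrite (le_trans _ (ler_wpM2r (nrm_ge0 x) (aM n)))// mulr_suml ler_sum//.
  by move=> k _; exact: nrm_app.
have FB : F \in bounded_linear V W.
  apply/bounded_linearP; split=> [c x y|].
    apply: tends_unique (hF _) _.
    apply: eq_tends (tendsD (tends_map (M := nrm c) (F := *:%R c) _ (hF x)) (hF y)).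
      move=> n /=; rewrite scaler_sumr -big_split/=; apply: eq_bigr => k _.
      by rewrite linearP.
    by move=> u v; rewrite -scalerBr nrmZ.
  exists M => x; rewrite -[F x]subr0; apply: (tends_le (n0 := 0) (hF x)) => n _.
  rewrite subr0 (le_trans (nrm_sum _ _ _))//.
  rewrite (le_trans _ (ler_wpM2r (nrm_ge0 x) (aM n)))// mulr_suml ler_sum//.
  by move=> k _; exact: nrm_app.
exists (BOp FB); have [t t0 ht] := absum_tail aM.
apply: tends_squeeze t0 _ => n; apply: nrm_bop_le => [|x].
  by have := ht n 0; rewrite addn0 big_geq.
rewrite bopBE bop_sumE/= nrm_distC.
apply: (@absum_tends_tail _ _ (fun k => a k x) _ (fun n => t n * nrm x) (hF x)) => {}n k.
rewrite (le_trans _ (ler_wpM2r (nrm_ge0 x) (ht n k)))// mulr_suml ler_sum//.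
by move=> i _; exact: nrm_app.
Qed.

End BanachBop.

Section BanachBm.
Context d (T : measurableType d) (R : realType).

Lemma bm_sumE (I : Type) (r : seq I) (P : pred I) (F : I -> bmfun T R) x :
  (\sum_(i <- r | P i) F i) x = \sum_(i <- r | P i) F i x.
Proof. by elim/big_ind2 : _ => // ? ? ? ? <- <-. Qed.

Lemma nrm_bm_le (f : bmfun T R) M : (forall x, nrm (f x) <= M) -> nrm f <= M.
Proof. exact: bmfun_norm_le. Qed.

Lemma nrm_bm_app (f : bmfun T R) x : nrm (f x) <= nrm f.
Proof. exact: bmfun_le_norm. Qed.

Lemma banach_bmfun : banach (bmfun T R : normedModType R[i]).
Proof.
move=> a M aM.
have /choice[F hF] : forall x, exists l, tends (fun n => \sum_(k < n) a k x) l.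
  move=> x; apply: (@banach_complex _ (fun k => a k x) M) => n.
  by rewrite (le_trans _ (aM n))// ler_sum// => k _; exact: nrm_bm_app.
have bmS n : (fun x => \sum_(k < n) a k x) \in bm.
  have -> : (fun x => \sum_(k < n) a k x) = bmfun_val (\sum_(k < n) a k).
    by apply/funext => x; rewrite bm_sumE.
  exact: bmfunP.
have FB : F \in bm.
  apply/bmP; split.
  - apply: (@measurable_fun_cvg _ _ _ _ (fun n x => complex.Re (\sum_(k < n) a k x))).
      by move=> n; have /bmP[] := bmS n.
    move=> x _; apply/cvgrPdist_le => e e0; have [N hN] := hF x _ e0.
    exists N => // n /= /hN; apply: le_trans; rewrite distrC.
    by rewrite -raddfB; exact: le_Re_nrm.
  - apply: (@measurable_fun_cvg _ _ _ _ (fun n x => complex.Im (\sum_(k < n) a k x))).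
      by move=> n; have /bmP[] := bmS n.
    move=> x _; apply/cvgrPdist_le => e e0; have [N hN] := hF x _ e0.
    exists N => // n /= /hN; apply: le_trans; rewrite distrC.
    by rewrite -raddfB; exact: le_Im_nrm.
  exists M => x; rewrite -[F x]subr0; apply: (tends_le (n0 := 0) (hF x)) => n _.
  rewrite subr0 (le_trans (nrm_sum _ _ _))// (le_trans _ (aM n))//.
  by rewrite ler_sum// => k _; exact: nrm_bm_app.
exists (BMFun FB); have [t t0 ht] := absum_tail aM.
apply: tends_squeeze t0 _ => n; apply: nrm_bm_le => x.
have -> : (\sum_(k < n) a k - BMFun FB) x = \sum_(k < n) a k x - F x.
  by rewrite -bm_sumE.
rewrite nrm_distC; apply: (@absum_tends_tail _ _ (fun k => a k x) _ t (hF x)) => {}n k.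
rewrite (le_trans _ (ht n k))// ler_sum//.
by move=> i _; exact: nrm_bm_app.
Qed.

End BanachBm.

(** * Power series with weighted summable coefficients *)

Section Lin.
Context {R : realType}.

Lemma nrm1 : nrm (1 : R[i]) = 1.
Proof. by rewrite /nrm normr1. Qed.

Lemma nrmX (z : R[i]) n : nrm (z ^+ n) = nrm z ^+ n.
Proof. by elim: n => [|n IH]; rewrite ?expr0 ?nrm1// !exprS nrmcM IH. Qed.

Lemma nrm_nat n : nrm (n%:R : R[i]) = n%:R.
Proof.
rewrite /nrm normr_nat; elim: n => // n IH.
by rewrite -[n.+1]addn1 !natrD raddfD/= IH.
Qed.

Lemma nrmMn (V : normedModType R[i]) (x : V) n : nrm (x *+ n) = nrm x *+ n.
Proof. by rewrite -scaler_nat nrmZ nrm_nat mulr_natl. Qed.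

Definition lin (V W : normedModType R[i]) (F : V -> W) :=
  forall (c : R[i]) x y, F (c *: x + y) = c *: F x + F y.

Section Lin1.
Context {V W : normedModType R[i]}.
Variables (F : V -> W) (lF : lin F).

Lemma lin0 : F 0 = 0.
Proof. by have := lF 1 0 0; rewrite !scale1r addr0 -[LHS]addr0 => /addrI. Qed.

Lemma linD x y : F (x + y) = F x + F y.
Proof. by have := lF 1 x y; rewrite !scale1r. Qed.

Lemma linZ c x : F (c *: x) = c *: F x.
Proof. by have := lF c x 0; rewrite lin0 !addr0. Qed.

Lemma linB x y : F (x - y) = F x - F y.
Proof. by rewrite linD -scaleN1r linZ scaleN1r. Qed.

Lemma lin_sum (I : Type) (r : seq I) (P : pred I) (G : I -> V) :
  F (\sum_(i <- r | P i) G i) = \sum_(i <- r | P i) F (G i).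
Proof. exact: (big_morph F linD lin0). Qed.

End Lin1.

(** With constant 1 in the norm bound, a single Cauchy product lemma with exactly multiplying
    weights serves scaling, composition, evaluation and [tensor]. *)
Record bilin (U V W : normedModType R[i]) (B : U -> V -> W) : Prop := Bilin {
  bilin_l : forall y, lin (B ^~ y);
  bilin_r : forall x, lin (B x);
  bilin_nrm : forall x y, nrm (B x y) <= nrm x * nrm y }.

Lemma bilin_scale (V : normedModType R[i]) :
  bilin (fun (c : R[i]) (x : V) => c *: x).
Proof.
split=> [y c x x'|x c y y'|x y]; last by rewrite nrmZ.
  by rewrite scalerDl scalerA.
by rewrite scalerDr !scalerA (mulrC x).
Qed.

Lemma bilin_bcomp (U V W : normedModType R[i]) : bilin (@bcomp R U V W).
Proof.
split=> [T c S S'|T c S S'|S T].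
- by apply: bop_ext.
- by apply: bop_ext => x; rewrite /= linearP.
- apply: nrm_bop_le => [|x]; first by rewrite mulr_ge0 ?nrm_ge0.
  rewrite (le_trans (nrm_app S _))// -mulrA ler_wpM2l ?nrm_ge0//; exact: nrm_app.
Qed.

Lemma bilin_app (V W : normedModType R[i]) : bilin (fun (T : bop V W) x => T x).
Proof. by split=> [x c S T|T c x y|T x] //; [rewrite linearP|exact: nrm_app]. Qed.

Lemma bilin_tensor (V : normedModType R[i]) : bilin (@tensor R V).
Proof.
split=> [p c x y|x c p q|x p].
- apply: bop_ext => z; rewrite [RHS](_ : _ = c *: (p z *: x) + p z *: y)//.
  by rewrite /= scalerDr !scalerA (mulrC c).
- apply: bop_ext => z; rewrite [RHS](_ : _ = c *: (p z *: x) + q z *: x)//.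
  by rewrite /= scalerDl scalerA.
- apply: nrm_bop_le => [|y]; first by rewrite mulr_ge0 ?nrm_ge0.
  by rewrite /= nrmZ mulrC -mulrA ler_wpM2l ?nrm_ge0//; exact: nrm_app.
Qed.

End Lin.

Lemma triangle_sum (V : nmodType) (F : nat -> nat -> V) K :
  \sum_(n < K) \sum_(i < n.+1) F i (n - i)%N =
  \sum_(i < K) \sum_(j < K | (i + j < K)%N) F i j.
Proof.
transitivity (\sum_(i < K) \sum_(j < K - i) F i j).
  elim: K => [|K IH]; first by rewrite !big_ord0.
  rewrite big_ord_recr/= IH [RHS]big_ord_recr/= subSnn big_ord1.
  rewrite [X in _ + X]big_ord_recr/= subnn addrA; congr (_ + _).
  rewrite -big_split/=; apply: eq_bigr => i _.
  by rewrite subSn ?(ltnW (ltn_ord i))// big_ord_recr.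
apply: eq_bigr => i _; rewrite (big_ord_widen K _ (leq_subr i K)).
by apply: eq_bigl => j; rewrite ltn_subRL.
Qed.

Lemma triangle_sum_le (R : realDomainType) (F : nat -> nat -> R) K :
  (forall i j, 0 <= F i j) ->
  \sum_(n < K) \sum_(i < n.+1) F i (n - i)%N <=
  \sum_(i < K) \sum_(j < K) F i j.
Proof.
move=> F0; rewrite triangle_sum ler_sum// => i _.
by rewrite [leLHS]big_mkcond ler_sum// => j _; case: ifP.
Qed.

(** The square of side [K] lies in the triangle [i + j < K + K]. This turns the truncation error of
    a Cauchy product into a tail of one nonnegative series. *)
Lemma triangle_sum_ge (R : realDomainType) (F : nat -> nat -> R) K :
  (forall i j, 0 <= F i j) ->
  \sum_(i < K) \sum_(j < K) F i j <=
  \sum_(n < K + K) \sum_(i < n.+1) F i (n - i)%N.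
Proof.
move=> F0; rewrite triangle_sum.
rewrite (big_ord_widen (K + K) (fun i => \sum_(j < K) F i j)) ?leq_addr//.
rewrite [leLHS]big_mkcond ler_sum// => i _; case: ifP => iK; last by rewrite sumr_ge0.
rewrite (big_ord_widen (K + K) (fun j => F i j)) ?leq_addr//.
rewrite [leLHS]big_mkcond [leRHS]big_mkcond ler_sum// => j _.
case: ifP => jK; last by case: ifP.
by rewrite (leq_trans (_ : _ < K + j)%N) ?ltn_add2r// leq_add2l ltnW.
Qed.

Lemma conv_sum_le (R : realDomainType) (x y : nat -> R) K :
  (forall i, 0 <= x i) -> (forall i, 0 <= y i) ->
  \sum_(n < K) \sum_(i < n.+1) x i * y (n - i)%N <=
  (\sum_(i < K) x i) * (\sum_(j < K) y j).
Proof.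
move=> x0 y0; rewrite mulr_suml.
under [leRHS]eq_bigr do rewrite mulr_sumr.
by apply: (triangle_sum_le (F := fun i j => x i * y j)) => i j; rewrite mulr_ge0.
Qed.

Section Pser.
Context {R : realType}.
Implicit Types (rho M : R).

(** [M] is only an upper bound for the weighted l1 norm, and [f] is unconstrained outside the closed
    disc. The coefficients are explicit because the constant one must remain identifiable through
    products and powers. *)
Definition pser (V : normedModType R[i]) rho M (a : nat -> V) (f : R[i] -> V) :=
  (forall n, \sum_(k < n) nrm (a k) * rho ^+ k <= M) /\
  (forall z : R[i], nrm z <= rho -> tends (fun n => \sum_(k < n) z ^+ k *: a k) (f z)).

Section PserBasic.
Context {V : normedModType R[i]}.
Implicit Types (a b : nat -> V) (f g : R[i] -> V).

Lemma nrm_term rho a k (z : R[i]) : nrm z <= rho ->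
  nrm (z ^+ k *: a k) <= nrm (a k) * rho ^+ k.
Proof.
move=> zr; rewrite nrmZ nrmX mulrC ler_wpM2l ?nrm_ge0//.
by rewrite lerXn2r ?nnegrE ?nrm_ge0// (le_trans (nrm_ge0 z)).
Qed.

Lemma pser_psum rho M a (z : R[i]) n :
  (forall n, \sum_(k < n) nrm (a k) * rho ^+ k <= M) -> nrm z <= rho ->
  nrm (\sum_(k < n) z ^+ k *: a k) <= M.
Proof.
move=> aM zr; rewrite (le_trans (nrm_sum _ _ _))// (le_trans _ (aM n))//.
by rewrite ler_sum// => k _; exact: nrm_term.
Qed.

Lemma pser_bound rho M a f (z : R[i]) : pser rho M a f -> nrm z <= rho -> nrm (f z) <= M.
Proof.
move=> [aM h] zr; rewrite -[f z]subr0; apply: (tends_le (n0 := 0) (h z zr)) => n _.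
by rewrite subr0; exact: pser_psum.
Qed.

Lemma pser_ge0 rho M a f : pser rho M a f -> 0 <= M.
Proof. by move=> [/(_ 0%N) + _]; rewrite big_ord0. Qed.

Lemma pser_uniq rho M M' a f g (z : R[i]) : pser rho M a f -> pser rho M' a g ->
  nrm z <= rho -> f z = g z.
Proof. by move=> [_ h] [_ h'] zr; exact: tends_unique (h z zr) (h' z zr). Qed.

Lemma eq_pser rho M a b f g : pser rho M a f -> (forall k, a k = b k) ->
  (forall z : R[i], nrm z <= rho -> f z = g z) -> pser rho M b g.
Proof.
move=> [aM h] ab fg; split=> [n|z zr].
  by under eq_bigr do rewrite -ab.
rewrite -fg//; apply: eq_tends (h z zr) => n.
by apply: eq_bigr => k _; rewrite ab.
Qed.

Lemma pser_mono rho M M' a f : M <= M' -> pser rho M a f -> pser rho M' a f.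
Proof. by move=> MM' [aM h]; split=> // n; exact: le_trans (aM n) _. Qed.

Lemma pser_rad rho rho' M a f : 0 <= rho' <= rho -> pser rho M a f ->
  pser rho' M a f.
Proof.
move=> /andP[r0 rr] [aM h]; split=> [n|z zr]; last exact: h (le_trans zr rr).
rewrite (le_trans _ (aM n))// ler_sum// => k _.
by rewrite ler_wpM2l ?nrm_ge0// lerXn2r ?nnegrE// (le_trans r0).
Qed.

Lemma pser_exists rho M a : banach V ->
  (forall n, \sum_(k < n) nrm (a k) * rho ^+ k <= M) -> exists f, pser rho M a f.
Proof.
move=> bV aM.
have /choice[f hf] : forall z : R[i], exists l, nrm z <= rho ->
    tends (fun n => \sum_(k < n) z ^+ k *: a k) l.
  move=> z; case: (lerP (nrm z) rho) => zr; last by exists 0.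
  have [|l hl] := bV (fun k => z ^+ k *: a k) M; last by exists l.
  move=> n; rewrite (le_trans _ (aM n))// ler_sum// => k _; exact: nrm_term.
by exists f; split=> // z /hf.
Qed.

Lemma pserD rho M M' a b f g : 0 <= rho -> pser rho M a f -> pser rho M' b g ->
  pser rho (M + M') (fun k => a k + b k) (fun z => f z + g z).
Proof.
move=> r0 [aM h] [bM h']; split=> [n|z zr]; last first.
  apply: eq_tends (tendsD (h z zr) (h' z zr)) => n /=.
  by rewrite -big_split/=; apply: eq_bigr => k _; rewrite scalerDr.
rewrite (le_trans _ (lerD (aM n) (bM n)))// -big_split/= ler_sum// => k _.
by rewrite -mulrDl ler_wpM2r ?exprn_ge0// nrmD.
Qed.

Lemma pser_cst rho (c : V) :
  pser rho (nrm c) (fun k => if k is 0 then c else 0) (fun=> c).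
Proof.
have E (W : nmodType) (F : nat -> W) n : (forall k, F k.+1 = 0) ->
    \sum_(k < n.+1) F k = F 0%N.
  by move=> F0; rewrite big_ord_recl big1 ?addr0// => i _; exact: F0.
split=> [[|n]|z zr].
- by rewrite big_ord0 nrm_ge0.
- by rewrite (E R (fun k => nrm (if k is 0 then c else 0) * rho ^+ k)) ?mulr1// => k;
    rewrite nrm0 mul0r.
move=> e e0; exists 1%N => -[//|n] _.
rewrite (E V (fun k => z ^+ k *: (if k is 0 then c else 0))) => [|k]; last exact: scaler0.
by rewrite scale1r subrr nrm0 ltW.
Qed.

Lemma pser_tail rho M eps a f : pser rho M a f ->
  (forall n, \sum_(k < n) nrm (a k.+1) * rho ^+ k.+1 <= eps) ->
  pser rho eps (fun k => if k is k'.+1 then a k else 0) (fun z => f z - a 0%N).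
Proof.
move=> [aM h] ae; split=> [[|n]|z zr].
- by have := ae 0%N; rewrite !big_ord0.
- by rewrite big_ord_recl nrm0 mul0r add0r; exact: ae.
move=> e e0; have [N hN] := h z zr e e0; exists N.+1 => -[//|n] Nn.
have := hN n.+1 (leqW Nn); rewrite !big_ord_recl/= scale1r scaler0 add0r.
by rewrite opprB addrCA addrA.
Qed.

(** Every positive power of [theta] is at most [theta], so shrinking the disc makes all but the
    constant coefficient small. Smallness at [z = 0] spreads to a disc in this way. *)
Lemma pser_shrink_tail rho M a f theta : 0 <= rho -> 0 <= theta <= 1 -> pser rho M a f ->
  forall n, \sum_(k < n) nrm (a k.+1) * (theta * rho) ^+ k.+1 <= theta * M.
Proof.
move=> r0 /andP[t0 t1] [aM _] n.
rewrite (le_trans _ (ler_wpM2l t0 (aM n.+1)))// big_ord_recl mulrDr.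
rewrite -[leLHS]add0r lerD ?mulr_ge0 ?nrm_ge0 ?exprn_ge0// mulr_sumr ler_sum// => k _.
rewrite exprMn mulrCA ler_wpM2r ?mulr_ge0 ?nrm_ge0 ?exprn_ge0//.
by rewrite exprS ler_piMr// exprn_ile1.
Qed.

Lemma pser_shrink rho M a f theta : 0 <= rho -> 0 <= theta <= 1 -> pser rho M a f ->
  pser (theta * rho) (nrm (a 0%N) + theta * M) a f.
Proof.
move=> r0 t01 h; have [t0 t1] := andP t01.
have [aM hz] : pser (theta * rho) M a f.
  by apply: pser_rad h; rewrite mulr_ge0//= ler_piMl.
split=> // -[|n]; first by rewrite big_ord0 addr_ge0 ?nrm_ge0 ?mulr_ge0 ?(pser_ge0 h).
by rewrite big_ord_recl mulr1 lerD2l; exact: pser_shrink_tail h n.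
Qed.

End PserBasic.

Lemma pser_map (V W : normedModType R[i]) (F : V -> W) (c rho M : R) a f :
  lin F -> 0 <= c -> 0 <= rho -> (forall x, nrm (F x) <= c * nrm x) ->
  pser rho M a f -> pser rho (c * M) (fun k => F (a k)) (fun z => F (f z)).
Proof.
move=> lF c0 r0 Fc [aM h]; split=> [n|z zr].
  rewrite (le_trans _ (ler_wpM2l c0 (aM n)))// mulr_sumr ler_sum// => k _.
  by rewrite mulrA ler_wpM2r ?exprn_ge0.
apply: eq_tends (tends_map (M := c) (F := F) _ (h z zr)) => [n|x y].
  by rewrite lin_sum//; apply: eq_bigr => k _; rewrite linZ.
by rewrite -linB.
Qed.

(** The product of two truncations and the truncated Cauchy product differ by the pairs of the
    square outside the triangle [i + j < K]. Their weight is at most [u (K + K) - u K], where [u] is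
    the bounded increasing sequence of weighted antidiagonal sums. *)
Lemma pser_bilin (U V W : normedModType R[i]) (B : U -> V -> W) (rho M M' : R)
    a b f g : bilin B -> 0 <= rho -> pser rho M a f -> pser rho M' b g ->
  pser rho (M * M') (fun n => \sum_(i < n.+1) B (a i) (b (n - i)%N))
    (fun z => B (f z) (g z)).
Proof.
move=> [Bl Br Bn] r0 hf hg; have [aM ha] := hf; have [bM hb] := hg.
have M0 := pser_ge0 hf; have M'0 := pser_ge0 hg.
pose x i := nrm (a i) * rho ^+ i; pose y j := nrm (b j) * rho ^+ j.
have x0 i : 0 <= x i by rewrite mulr_ge0 ?nrm_ge0 ?exprn_ge0.
have y0 i : 0 <= y i by rewrite mulr_ge0 ?nrm_ge0 ?exprn_ge0.
pose u K := \sum_(n < K) \sum_(i < n.+1) x i * y (n - i)%N.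
have uM K : u K <= M * M'.
  rewrite (le_trans (conv_sum_le _ _ _))// ler_pM// sumr_ge0//.
split=> [n|z zr].
  rewrite (le_trans _ (uM n))// ler_sum// => k _.
  rewrite -[X in _ <= X](_ : (\sum_(i < k.+1) nrm (a i) * nrm (b (k - i)%N)) * rho ^+ k = _).
    rewrite ler_wpM2r ?exprn_ge0// (le_trans (nrm_sum _ _ _))// ler_sum//.
  rewrite mulr_suml; apply: eq_bigr => i _; rewrite /x /y mulrACA -exprD subnKC//.
  by rewrite -ltnS.
pose A K := \sum_(k < K) z ^+ k *: a k; pose D K := \sum_(k < K) z ^+ k *: b k.
pose H i j := z ^+ (i + j) *: B (a i) (b j).
have BAD K : B (A K) (D K) = \sum_(i < K) \sum_(j < K) H i j.
  rewrite (lin_sum (Bl _)); apply: eq_bigr => i _.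
  rewrite (linZ (Bl _)) (lin_sum (Br _)) scaler_sumr; apply: eq_bigr => j _.
  by rewrite (linZ (Br _)) scalerA -exprD.
have CE K : \sum_(n < K) z ^+ n *: (\sum_(i < n.+1) B (a i) (b (n - i)%N)) =
    \sum_(i < K) \sum_(j < K | (i + j < K)%N) H i j.
  rewrite -triangle_sum; apply: eq_bigr => n _; rewrite scaler_sumr.
  by apply: eq_bigr => i _; rewrite /H subnKC// -ltnS.
have [|l [ul hl]] := @nondecreasing_limit R u (M * M') _ uM.
  by move=> n; rewrite /u big_ord_recr/= lerDl sumr_ge0// => i _; rewrite mulr_ge0.
have CB K : nrm (B (A K) (D K) - (\sum_(n < K) z ^+ n *: (\sum_(i < n.+1) B (a i) (b (n - i)%N)))) <=
    l - u K.
  have h1 := ul (K + K)%N; apply: le_trans (lerB h1 (lexx _)).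
  have := triangle_sum_ge (F := fun i j => x i * y j) K (fun i j => mulr_ge0 (x0 i) (y0 j)).
  move=> h2; apply: (@le_trans _ _ (\sum_(i < K) \sum_(j < K) x i * y j - u K)); last exact: lerB.
  rewrite BAD CE {1}/u (triangle_sum (fun i j => x i * y j)) -!sumrB.
  rewrite (le_trans (nrm_sum _ _ _))// ler_sum// => i _.
  rewrite (bigID (fun j : 'I_K => (i + j < K)%N))/= addrAC subrr add0r.
  rewrite [leRHS](_ : _ = \sum_(j < K | ~~ (i + j < K)%N) x i * y j); last first.
    by rewrite [X in X - _](bigID (fun j : 'I_K => (i + j < K)%N))/= addrAC subrr add0r.
  rewrite (le_trans (nrm_sum _ _ _))// ler_sum// => j _.
  rewrite /H nrmZ nrmX /x /y mulrACA mulrC -exprD ler_pM ?exprn_ge0 ?nrm_ge0//.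
  by rewrite lerXn2r ?nnegrE ?nrm_ge0.
have BB : tends (fun K => B (A K) (D K)) (B (f z) (g z)).
  have h1 : tends (fun K => B (A K) (D K) - B (f z) (D K)) 0.
    move=> e e0; have e1 : 0 < e / (M' + 1) by rewrite divr_gt0// ltr_wpDl.
    have [N hN] := ha z zr _ e1; exists N => n /hN h1.
    rewrite subr0 -(linB (Bl _)) (le_trans (Bn _ _))//.
    rewrite -[e](@mulfVK _ (M' + 1)) ?gt_eqF ?ltr_wpDl// ler_pM ?nrm_ge0//.
    by rewrite (le_trans (pser_psum n bM zr))// lerDl.
  have h2 : tends (fun K => B (f z) (D K)) (B (f z) (g z)).
    apply: (tends_map (M := M) (F := B (f z)) _ (hb z zr)) => v w.
    rewrite -(linB (Br _)) (le_trans (Bn _ _))// ler_wpM2r ?nrm_ge0//.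
    exact: pser_bound hf zr.
  by rewrite -[B (f z) (g z)]add0r; apply: eq_tends (tendsD h1 h2) => K; rewrite subrK.
rewrite -[B (f z) (g z)]subr0.
have h3 : tends (fun K => - (B (A K) (D K) -
    (\sum_(n < K) z ^+ n *: (\sum_(i < n.+1) B (a i) (b (n - i)%N))))) (- 0).
  by apply: tends_squeeze hl _ => K; rewrite oppr0 subr0 nrmN.
by apply: eq_tends (tendsD BB h3) => K; rewrite opprB subrKC.
Qed.

(** * Recentering, analyticity and differentiation of power series *)

Lemma binom_widen (A : comPzRingType) (x y : A) k n :
  (x + y) ^+ k = \sum_(j < n + k.+1) y ^+ j * (x ^+ (k - j) *+ 'C(k, j)).
Proof.
rewrite exprDn (big_ord_widen (n + k.+1)
  (fun i => x ^+ (k - i) * y ^+ i *+ 'C(k, i))) ?leq_addl//.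
rewrite big_mkcond; apply: eq_bigr => j _; case: ifP => jk.
  by rewrite mulrC mulrnAr.
by rewrite bin_small ?mulr0n ?mulr0// ltnNge -ltnS jk.
Qed.

(* The terms of index [j >= n] carry a factor [(t / t') ^+ j <= (t / t') ^+ n];
   what remains is bounded by the full binomial expansion of [(s + t') ^+ k]. *)
Lemma binom_remainder (z h : R[i]) (s t t' rho : R) k n :
  nrm z <= s -> nrm h <= t -> t <= t' -> 0 < t' -> s + t' <= rho ->
  nrm ((z + h) ^+ k - \sum_(j < n) h ^+ j * (z ^+ (k - j) *+ 'C(k, j)))
  <= (t / t') ^+ n * rho ^+ k.
Proof.
move=> zs ht tt' t'0 st.
have s0 := le_trans (nrm_ge0 z) zs; have t0 := le_trans (nrm_ge0 h) ht.
have q0 : 0 <= t / t' by rewrite divr_ge0// ltW.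
have q1 : t / t' <= 1 by rewrite ler_pdivrMr// mul1r.
rewrite (binom_widen z h k n).
rewrite (partial_sum_diff (fun j => h ^+ j * (z ^+ (k - j) *+ 'C(k, j)))) (le_trans (nrm_sum _ _ _))//.
apply: (@le_trans _ _ ((t / t') ^+ n * (s + t') ^+ k)); last first.
  by rewrite ler_wpM2l ?exprn_ge0// lerXn2r ?nnegrE ?addr_ge0 ?(ltW t'0)//;
    apply: le_trans st; rewrite addr_ge0// ltW.
rewrite (binom_widen s t' k n) mulr_sumr -(big_mkord xpredT
  (fun j => (t / t') ^+ n * (t' ^+ j * (s ^+ (k - j) *+ 'C(k, j))))).
rewrite [leRHS](@big_cat_nat _ _ _ n) ?leq_addr//= -[leLHS]add0r lerD//.
  by rewrite sumr_ge0// => j _; rewrite !mulr_ge0 ?exprn_ge0 ?(ltW t'0)//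
    mulrn_wge0// exprn_ge0.
rewrite big_nat_cond [leRHS]big_nat_cond ler_sum// => j /andP[/andP[nj _] _].
rewrite nrmcM nrmX nrmMn nrmX mulrA ler_pM ?exprn_ge0 ?mulrn_wge0 ?exprn_ge0 ?nrm_ge0//.
  apply: (@le_trans _ _ (t ^+ j)); first by rewrite lerXn2r ?nnegrE ?nrm_ge0.
  rewrite -{1}[t](@divfK _ t') ?gt_eqF// exprMn ler_wpM2r ?exprn_ge0 ?(ltW t'0)//.
  by rewrite ler_wiXn2l.
by rewrite lerMn2r lerXn2r ?orbT ?nnegrE ?nrm_ge0.
Qed.

Lemma tends_sum (V : normedModType R[i]) (s : nat -> nat -> V) (l : nat -> V) n :
  (forall j, tends (s j) (l j)) ->
  tends (fun K => \sum_(j < n) s j K) (\sum_(j < n) l j).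
Proof.
move=> h; elim: n => [|n IH].
  by rewrite big_ord0; apply: eq_tends (tends_cst 0) => K; rewrite big_ord0.
rewrite big_ord_recr/=; apply: eq_tends (tendsD IH (h n)) => K.
by rewrite big_ord_recr.
Qed.

Lemma tendsZ (V : normedModType R[i]) (c : R[i]) (s : nat -> V) l :
  tends s l -> tends (fun n => c *: s n) (c *: l).
Proof.
by apply: (tends_map (M := nrm c) (F := *:%R c)) => x y; rewrite -scalerBr nrmZ.
Qed.

(** Taylor expansion at [z] with a remainder at every order. Letting [n] grow gives analyticity;
    [n = 1] at [h = 0] identifies [b 0] with the value, and [n = 2] identifies [b 1] with the
    derivative. *)
Lemma pser_recenter (V : normedModType R[i]) rho M (a : nat -> V) f (z : R[i]) s t :
  banach V -> pser rho M a f -> nrm z <= s -> 0 < t -> s + t <= rho ->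
  exists2 b : nat -> V,
    forall j, tends (fun K => \sum_(k < K) (z ^+ (k - j) *+ 'C(k, j)) *: a k) (b j) &
    forall (h : R[i]) n, nrm h <= t ->
      nrm (f (z + h) - \sum_(j < n) h ^+ j *: b j) <= (nrm h / t) ^+ n * M.
Proof.
move=> bV [aM hf] zs t0 st; have s0 := le_trans (nrm_ge0 z) zs.
have sumM (c : nat -> R) (A : R) K : 0 <= A -> (forall k, nrm (a k) * c k <= A * (nrm (a k) * rho ^+ k)) ->
    \sum_(k < K) nrm (a k) * c k <= A * M.
  move=> A0 hc; rewrite (le_trans _ (ler_wpM2l A0 (aM K)))// mulr_sumr.
  by rewrite ler_sum// => k _.
have /choice[b hb] : forall j, exists l,
    tends (fun K => \sum_(k < K) (z ^+ (k - j) *+ 'C(k, j)) *: a k) l.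
  move=> j; apply: (bV (fun k => (z ^+ (k - j) *+ 'C(k, j)) *: a k) ((t ^+ j)^-1 * M)) => K.
  rewrite (eq_bigr (fun k : 'I_K => nrm (a k) * nrm (z ^+ (k - j) *+ 'C(k, j)))); last first.
    by move=> k _; rewrite nrmZ mulrC.
  apply: (sumM (fun k => nrm (z ^+ (k - j) *+ 'C(k, j)))) => [|k].
    by rewrite invr_ge0 exprn_ge0// ltW.
  rewrite mulrCA ler_wpM2l ?nrm_ge0// ler_pdivlMl ?exprn_gt0//.
  apply: (@le_trans _ _ ((s + t) ^+ k)); last first.
    by rewrite lerXn2r ?nnegrE ?addr_ge0 ?(ltW t0)//; apply: le_trans st; rewrite addr_ge0// ltW.
  (* The term of index [j] alone in the expansion of [(s + t) ^+ k] gives the bound, which plays the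
     role of Cauchy's estimate. *)
  rewrite (binom_widen s t k j.+1).
  have jn : (j < j.+1 + k.+1)%N by rewrite addSn ltnS leq_addr.
  rewrite (bigD1 (Ordinal jn))//= nrmMn nrmX -[leLHS]addr0 lerD//.
    rewrite ler_wpM2l ?exprn_ge0 ?(ltW t0)// lerMn2r lerXn2r ?orbT ?nnegrE ?nrm_ge0//.
  rewrite sumr_ge0// => i _; rewrite mulr_ge0 ?mulrn_wge0 ?exprn_ge0//; exact: ltW.
exists b => // h n ht.
have zh : nrm (z + h) <= rho.
  by rewrite (le_trans _ st)// (le_trans (nrmD _ _))// lerD.
rewrite -[X in nrm X]subr0.
have H1 := hf _ zh.
have H2 : tends (fun K => \sum_(j < n) h ^+ j *: (\sum_(k < K) (z ^+ (k - j) *+ 'C(k, j)) *: a k))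
    (\sum_(j < n) h ^+ j *: b j).
  apply: (tends_sum (s := fun j K => h ^+ j *: (\sum_(k < K) (z ^+ (k - j) *+ 'C(k, j)) *: a k))
    (l := fun j => h ^+ j *: b j)) => j; exact: tendsZ.
have H3 := tendsD H1 (tendsZ (-1) H2); rewrite scaleN1r in H3.
apply: (tends_le (n0 := 0) H3) => K _; rewrite subr0 scaleN1r.
have -> : \sum_(k < K) (z + h) ^+ k *: a k -
    \sum_(j < n) h ^+ j *: (\sum_(k < K) (z ^+ (k - j) *+ 'C(k, j)) *: a k) =
    \sum_(k < K) ((z + h) ^+ k - \sum_(j < n) h ^+ j * (z ^+ (k - j) *+ 'C(k, j))) *: a k.
  under [X in _ - X]eq_bigr do rewrite scaler_sumr.
  rewrite exchange_big/= -sumrB; apply: eq_bigr => k _.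
  rewrite scalerBl scaler_suml; congr (_ - _); apply: eq_bigr => j _.
  by rewrite scalerA.
rewrite (le_trans (nrm_sum _ _ _))//.
under eq_bigr do rewrite nrmZ mulrC.
apply: (sumM (fun k => nrm ((z + h) ^+ k - \sum_(j < n) h ^+ j * (z ^+ (k - j) *+ 'C(k, j))))) => [|k].
  by rewrite exprn_ge0// divr_ge0 ?nrm_ge0// ltW.
rewrite mulrCA ler_wpM2l ?nrm_ge0//; exact: (binom_remainder k n zs (lexx _) ht t0 st).
Qed.

Lemma pser_analytic (V : normedModType R[i]) rho M (a : nat -> V) f (z : R[i]) :
  banach V -> pser rho M a f -> nrm z < rho -> analytic_at f z.
Proof.
move=> bV hf zr; have t0 : 0 < rho - nrm z by rewrite subr_gt0.
have st : nrm z + (rho - nrm z) <= rho by rewrite subrKC.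
have [b _ hb] := pser_recenter bV hf (lexx _) t0 st.
exists b, (rho - nrm z); split=> // w wz.
apply/tends_cvg; pose q := nrm (w - z) / (rho - nrm z).
have q01 : 0 <= q < 1 by rewrite divr_ge0 ?nrm_ge0 ?(ltW t0)//= ltr_pdivrMr// mul1r.
apply: tends_squeeze (vanishingM (pser_ge0 hf) (vanishing_expr q01)) _ => n.
have := hb _ n (ltW wz); rewrite subrKC nrm_distC mulrC.
by rewrite /series/= big_mkord.
Qed.

Lemma derive1_eq (V : normedModType R[i]) (f : R[i] -> V) (z : R[i]) (l : V) (c t : R) :
  0 < t -> (forall h : R[i], nrm h <= t ->
    nrm (f (z + h) - f z - h *: l) <= c * nrm h ^+ 2) ->
  derive1 f z = l.
Proof.
move=> t0 hf; rewrite /derive1; apply: cvg_lim => //; apply/cvgrPdist_le => e e0.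
have eE : e = (complex.Re e)%:C%C.
  by move: e0; rewrite ltcE/= => /andP[/eqP + _]; case: (e) => x y /= ->.
have r0 : 0 < complex.Re e by move: e0; rewrite {1}eE ltcR.
have c0 : 0 < `|c| + 1 by rewrite ltr_wpDl.
near=> h.
have h0 : h != 0 by near: h; exact: nbhs_dnbhs_neq.
have nh0 : 0 < nrm h.
  by rewrite lt_neqAle nrm_ge0 andbT eq_sym; apply: contra h0 => /eqP/nrm0_eq0->.
have hlt (r : R) : `|h| < r%:C%C -> nrm h < r by rewrite nrmE ltcR.
have ht : nrm h < t by apply: hlt; near: h; apply: dnbhs0_lt; rewrite ltcR.
have he : nrm h < complex.Re e / (`|c| + 1).
  by apply: hlt; near: h; apply: dnbhs0_lt; rewrite ltcR divr_gt0.
rewrite nrmE eE lecR nrm_distC (addrC h z).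
have -> : h^-1 *: (f (z + h) - f z) - l = h^-1 *: (f (z + h) - f z - h *: l).
  by rewrite [in RHS]scalerBr scalerA mulVf// scale1r.
have hh : nrm h^-1 = (nrm h)^-1.
  by apply: (mulfI (lt0r_neq0 nh0)); rewrite -nrmcM !mulfV ?nrm1// gt_eqF.
rewrite nrmZ hh ler_pdivrMl// (le_trans (hf _ (ltW ht)))//.
rewrite expr2 mulrCA ler_wpM2l ?nrm_ge0//.
move: he; rewrite ltr_pdivlMr// => /ltW; apply: le_trans.
by rewrite mulrC ler_wpM2l ?nrm_ge0// (le_trans (ler_norm _))// lerDl.
Unshelve. all: by end_near. Qed.

(** Halving the radius absorbs the factor [k.+1], because [k.+1 <= 2 ^ k]. The sum of the
    differentiated series is the coefficient [b 1] of the expansion recentered at [z]. *)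
Lemma pser_derive1 (V : normedModType R[i]) rho M (a : nat -> V) f :
  banach V -> 0 < rho -> pser rho M a f ->
  pser (rho / 2) (M / rho) (fun k => a k.+1 *+ k.+1) (derive1 f).
Proof.
move=> bV r0 hf; have [aM _] := hf; have r2 : 0 < rho / 2 by rewrite divr_gt0.
have rr : rho / 2 + rho / 2 = rho by rewrite -splitr.
split=> [n|z zr].
  rewrite ler_pdivlMr// (le_trans _ (aM n.+1))// big_ord_recl -[leLHS]add0r lerD//.
    by rewrite mulr_ge0 ?nrm_ge0.
  rewrite mulr_suml ler_sum// => k _; rewrite lift0 nrmMn exprMn exprVn exprS.
  have k2 : k.+1%:R / 2 ^+ k <= 1 :> R.
    by rewrite ler_pdivrMr ?exprn_gt0// mul1r -natrX ler_nat ltn_expl.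
  rewrite -[leRHS]mulr1 (le_trans _ (ler_wpM2l _ k2)) ?mulr_ge0 ?nrm_ge0 ?exprn_ge0 ?(ltW r0)//.
  by rewrite -[nrm _ *+ _]mulr_natr le_eqVlt; apply/orP; left; apply/eqP; ring.
have st : rho / 2 + rho / 2 <= rho by rewrite rr.
have [b hb1 hb2] := pser_recenter bV hf zr r2 st.
have b0 : b 0%N = f z.
  have := hb2 0 1%N; rewrite nrm0 mul0r expr1 mul0r big_ord1 addr0 scale1r.
  by move=> /(_ (ltW r2))/nrm_le0/eqP; rewrite subr_eq0 => /eqP.
have -> : derive1 f z = b 1%N.
  apply: (@derive1_eq _ _ _ _ (M / (rho / 2) ^+ 2) _ r2) => h /(hb2 h 2%N).
  rewrite big_ord_recr big_ord1/= scale1r expr1 b0 opprD addrA => /le_trans; apply.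
  by rewrite expr_div_n mulrAC [leRHS]mulrAC (mulrC M).
move=> e e0; have [N hN] := hb1 1%N e e0; exists N => n Nn.
have := hN n.+1 (leqW Nn); rewrite big_ord_recl/= bin0n mulr0n scale0r add0r.
congr (nrm (_ - _) <= _); apply: eq_bigr => k _; rewrite bin1 subn1/=.
by rewrite -scalerMnl -scalerMnr.
Qed.

End Pser.

(** * The Banach algebra of bounded operators *)

Section OpRing.
Context {R : realType} {V : normedModType R[i]}.
Implicit Types S T : bop V V.

Lemma bcompA : associative (@bcomp R V V V). Proof. by move=> A B C; exact: bop_ext. Qed.
Lemma bcomp1l : left_id (bid V) (@bcomp R V V V). Proof. by move=> A; exact: bop_ext. Qed.
Lemma bcomp1r : right_id (bid V) (@bcomp R V V V). Proof. by move=> A; exact: bop_ext. Qed.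
Lemma bcompDl : left_distributive (@bcomp R V V V) +%R.
Proof. by move=> A B C; exact: bop_ext. Qed.
Lemma bcompDr : right_distributive (@bcomp R V V V) +%R.
Proof. by move=> A B C; apply: bop_ext => x; rewrite /= bopD. Qed.

(** Composition becomes the product. The zero ring is allowed because [V] may be trivial. *)
HB.instance Definition _ := GRing.Zmodule_isPzRing.Build (bop V V)
  bcompA bcomp1l bcomp1r bcompDl bcompDr.

Lemma bopM S T : bcomp S T = S * T. Proof. by []. Qed.

Lemma bopME S T x : (S * T) x = S (T x). Proof. by []. Qed.

Lemma bop1E x : (1 : bop V V) x = x. Proof. by []. Qed.

Lemma bpowE T n : bpow T n = T ^+ n.
Proof. by elim: n => // n IH; rewrite exprS -IH. Qed.

Lemma bopZl (c : R[i]) S T : (c *: S) * T = c *: (S * T).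
Proof. exact: bop_ext. Qed.

Lemma bopZr (c : R[i]) S T : S * (c *: T) = c *: (S * T).
Proof. by apply: bop_ext => x; rewrite bopME !bopZE linearZ. Qed.

Lemma nrm_opM S T : nrm (S * T) <= nrm S * nrm T.
Proof. exact: (bilin_nrm (bilin_bcomp V V V)). Qed.

Lemma nrm_op1 : nrm (1 : bop V V) <= 1.
Proof. by apply: nrm_bop_le => // x; rewrite mul1r. Qed.

Lemma nrm_opX T n : nrm (T ^+ n) <= nrm T ^+ n.
Proof.
elim: n => [|n IH]; first exact: nrm_op1.
by rewrite !exprS (le_trans (nrm_opM _ _))// ler_wpM2l ?nrm_ge0.
Qed.

Lemma bopZX (c : R[i]) T n : (c *: T) ^+ n = c ^+ n *: T ^+ n.
Proof.
elim: n => [|n IH]; first by rewrite !expr0 scale1r.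
by rewrite !exprS IH bopZl bopZr scalerA.
Qed.

Definition inverse_of T S := T * S = 1 /\ S * T = 1.

Lemma geometric_sum_le (r : R) n : 0 <= r < 1 -> \sum_(k < n) r ^+ k <= (1 - r)^-1.
Proof.
move=> /andP[r0 r1]; have r1' : 0 < 1 - r by rewrite subr_gt0.
rewrite -[leRHS]mul1r ler_pdivlMr// mulrC -opprB mulNr -subrX1 opprB.
by rewrite gerBl exprn_ge0.
Qed.

Lemma neumann T (r : R) : banach V -> nrm T <= r -> r < 1 ->
  exists2 Z, inverse_of (1 - T) Z & nrm Z <= (1 - r)^-1.
Proof.
move=> bV Tr r1; have r0 := le_trans (nrm_ge0 T) Tr.
have r01 : 0 <= r < 1 by rewrite r0.
have TX k : nrm (T ^+ k) <= r ^+ k.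
  by rewrite (le_trans (nrm_opX _ _))// lerXn2r ?nnegrE ?nrm_ge0.
have [|Z hZ] := banach_bop (V := V) bV (a := fun k => T ^+ k) (M := (1 - r)^-1).
  by move=> n; rewrite (le_trans _ (geometric_sum_le n r01))// ler_sum.
have T1 : tends (fun n => 1 - T ^+ n) (1 : bop V V).
  apply: tends_squeeze (vanishing_expr r01) _ => n.
  by rewrite addrAC subrr add0r nrmN.
exists Z; last first.
  rewrite -[Z]subr0; apply: (tends_le (n0 := 0) hZ) => n _; rewrite subr0.
  rewrite (le_trans (nrm_sum _ _ _))// (le_trans _ (geometric_sum_le n r01))//.
  by rewrite ler_sum.
split.
  apply: tends_unique T1; apply: eq_tends
    (tends_map (M := nrm (1 - T)) (F := fun S => (1 - T) * S) _ hZ) => [n|x y].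
    by rewrite -[RHS]opprB subrX1 -mulNr opprB.
  by rewrite -mulrBr nrm_opM.
apply: tends_unique T1; apply: eq_tends
  (tends_map (M := nrm (1 - T)) (F := fun S => S * (1 - T)) _ hZ) => [n|x y].
  have -> : (\sum_(k < n) T ^+ k) * (1 - T) = (1 - T) * (\sum_(k < n) T ^+ k).
    rewrite mulrBl mulrBr mul1r mulr1; congr (_ - _).
    by rewrite mulr_suml mulr_sumr; apply: eq_bigr => k _; rewrite -exprS -exprSr.
  by rewrite -[RHS]opprB subrX1 -mulNr opprB.
by rewrite -mulrBl (le_trans (nrm_opM _ _))// mulrC.
Qed.

(** If [Y] inverts [1 - T ^+ m = (1 - T) * G], then [G * Y] inverts [1 - T]. Each of the [m] terms
    of [G] has norm at most [b ^+ m] because [1 <= b]. *)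
Lemma neumann_pow T (r b : R) m : banach V -> nrm (T ^+ m) <= r -> r < 1 ->
  nrm T <= b -> 1 <= b ->
  exists2 Z, inverse_of (1 - T) Z & nrm Z <= b ^+ m *+ m * (1 - r)^-1.
Proof.
move=> bV Tr r1 Tb b1; have [Y [Y1 Y2] nY] := neumann bV Tr r1.
pose G := \sum_(k < m) T ^+ k.
have G1 : (1 - T) * G = 1 - T ^+ m by rewrite -[RHS]opprB subrX1 -mulNr opprB.
have G2 : G * (1 - T) = 1 - T ^+ m.
  rewrite -G1 mulrBl mulrBr mul1r mulr1; congr (_ - _).
  by rewrite mulr_suml mulr_sumr; apply: eq_bigr => k _; rewrite -exprS -exprSr.
exists (G * Y).
  split; first by rewrite mulrA G1.
  (* [Y * G] is a left inverse of [1 - T] and [G * Y] a right inverse, so they coincide. *)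
  have -> : G * Y = Y * G.
    have -> : G * Y = Y * G * (1 - T) * (G * Y) by rewrite -[Y * G * _]mulrA G2 Y2 mul1r.
    by rewrite -mulrA [(1 - T) * _]mulrA G1 Y1 mulr1.
  by rewrite -mulrA G2.
rewrite (le_trans (nrm_opM _ _))// ler_pM ?nrm_ge0//.
rewrite (le_trans (nrm_sum _ _ _))// (@le_trans _ _ (\sum_(k < m) b ^+ m))//.
  rewrite ler_sum// => k _; rewrite (le_trans (nrm_opX _ _))//.
  apply: (@le_trans _ _ (b ^+ k)).
    by rewrite lerXn2r ?nnegrE ?nrm_ge0// (le_trans _ b1).
  by rewrite ler_weXn2l// ltnW.
by rewrite sumr_const card_ord.
Qed.

End OpRing.

Section Unit.
Context {R : realType} {V W : normedModType R[i]}.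

Lemma bopB (T : bop V W) x y : T (x - y) = T x - T y.
Proof. exact: linearB. Qed.

Lemma nrm_bop_le1 (T : bop V W) (M : R) :
  (forall x, nrm x <= 1 -> nrm (T x) <= M) -> nrm T <= M.
Proof.
move=> h; rewrite bop_nrmE; apply: ge_sup; last by move=> _ [x /= /h + <-].
by exists (nrm (T 0)), 0 => //=; rewrite nrm0.
Qed.
End Unit.

Lemma dualZ (R : realType) (V : normedModType R[i]) (p : dual V) (c : R[i]) x :
  p (c *: x) = c * p x.
Proof. exact: bopZ. Qed.

(** * Invariant functional and reduced resolvent of an operator with a contracting power *)

Section Ergodic.
Context d (X : measurableType d) (R : realType).
Local Notation V := (bmfun X R).

Lemma ev_subproof (x : X) : (fun f : V => f x) \in bounded_linear V R[i].
Proof.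
apply/bounded_linearP; split => //; exists 1 => f; rewrite mul1r.
exact: nrm_bm_app.
Qed.

Definition ev x : dual V := BOp (ev_subproof x).

Lemma bmBE (f g : V) x : (f - g) x = f x - g x. Proof. by []. Qed.
Lemma bmZE (c : R[i]) (f : V) x : (c *: f) x = c * f x. Proof. by []. Qed.

(* [A] is the part of norm [<= r] in the splitting [P = 1 (x) nu + A] of
   [P = T ^+ m]; the invariant functional is [nu (1 - A)^-1]. *)
Lemma ergodic (T : bop V V) (e : V) (r : R) m : (forall x, e x = 1) ->
  T e = e -> nrm T <= 1 -> 0 < r < 1 -> (0 < m)%N ->
  (forall f x y, nrm f <= 1 -> nrm ((T ^+ m) f x - (T ^+ m) f y) <= r) ->
  exists (p : dual V) (S : bop V V),
    [/\ p e = 1, nrm p <= 1 & forall f, p (T f) = p f] /\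
    [/\ S e = 0, forall f, p (S f) = 0, (1 - T) * S = 1 - tensor e p,
        S * (1 - T) = 1 - tensor e p & nrm S <= 2 ^+ m *+ m * (1 - r)^-1 + 1] /\
    nrm ((T - tensor e p) ^+ m) <= r.
Proof.
move=> e1 Te T1 /andP[r0 r1] m0 hT; set P := T ^+ m.
have bV : banach V := @banach_bmfun _ X R.
have ne : nrm e <= 1 by apply: nrm_bm_le => x; rewrite e1 nrm1.
have hP f x y : nrm (P f x - P f y) <= r * nrm f.
  have h : nrm (bcomp (ev x - ev y) P) <= r by apply: nrm_bop_le1 => {}f; exact: hT.
  by rewrite (le_trans (nrm_app (bcomp (ev x - ev y) P) f))// ler_wpM2r ?nrm_ge0.
have Pe : P e = e by rewrite /P; elim: (m) => // n IH; rewrite exprS bopME IH.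
have P1 k : nrm (P ^+ k) <= 1.
  by rewrite -exprM (le_trans (nrm_opX _ _))// exprn_ile1 ?nrm_ge0.
(* An oscillation bound becomes a sup norm bound after subtracting the value at any one point. *)
have centered (b : R) (f : V) c : (forall x y, nrm (f x - f y) <= b) -> nrm (f - f c *: e) <= b.
  by move=> h; apply: nrm_bm_le => x; rewrite bmBE bmZE e1 mulr1.
pose nu := bcomp (ev point) P; pose A := P - tensor e nu.
have nuE f : nu f = P f point by [].
have AE f : A f = P f - nu f *: e by [].
have Ar : nrm A <= r.
  apply: nrm_bop_le => [|f]; first exact: ltW.
  by rewrite AE nuE; apply: centered => x y; exact: hP.
have Ae : A e = 0 by rewrite AE nuE Pe e1 scale1r subrr.
have [Z [Z1 Z2] _] := neumann bV Ar r1.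
have Z2E f : Z (f - A f) = f by have := congr1 (fun S : bop V V => S f) Z2.
have Ze : Z e = e by have := Z2E e; rewrite Ae subr0.
pose p := bcomp nu Z.
have pe : p e = 1 by rewrite /p/= Ze Pe e1.
have pA f : p (A f) = p f - nu f.
  have := congr1 nu (Z2E f); rewrite -[nu (Z _)]/(p (f - A f)) bopB => <-.
  by rewrite subKr.
have PE f : P f = A f + nu f *: e by rewrite AE subrK.
have pP f : p (P f) = p f.
  by rewrite PE bopD bopZ pA pe [_ *: 1]mulr1 subrK.
(* So far [p] is invariant under [P = T ^+ m] only. The functional [q = p \o T] is invariant under
   [P] too and equals 1 at [e], which forces [q \o (1 - A) = nu] and hence [q = nu \o Z = p]. *)
have pT f : p (T f) = p f.
  pose q := bcomp p T.
  have qP g : q (P g) = q g.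
    rewrite /q/= -[T (P g)]/((T * P) g) -[RHS]pP -[P (T g)]/((P * T) g).
    by rewrite /P -exprS -exprSr.
  have qe : q e = 1 by rewrite /q/= Te.
  have qA g : q (g - A g) = nu g.
    by rewrite bopB -{1}qP PE bopD bopZ qe [_ *: 1]mulr1 addrAC subrr add0r.
  have := congr1 (fun S : bop V V => S f) Z1; rewrite bopME bopBE => E.
  have {}E : Z f - A (Z f) = f := E.
  by rewrite -[LHS]/(q f) -{1}E qA.
have osc k f x y : nrm ((P ^+ k.+1) f x - (P ^+ k.+1) f y) <= r ^+ k.+1 * nrm f.
  elim: k x y => [|k IH] x y; first exact: hP.
  set g := (P ^+ k.+1) f in IH *; rewrite exprS bopME -/g.
  have -> : P g x - P g y = P (g - g point *: e) x - P (g - g point *: e) y.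
    by rewrite bopB bopZ Pe !bmBE !bmZE !e1 opprB addrA subrK.
  by rewrite (le_trans (hP _ _ _))// exprS -mulrA ler_wpM2l ?(ltW r0)// centered.
have pPk k f : p ((P ^+ k) f) = p f.
  by elim: k => // k IH; rewrite exprS bopME pP.
(* The Neumann construction alone would give a bound that degenerates as [r] tends to 1. Instead
   [p f = p (P ^+ N.+1 f)], where the iterate is within [r ^+ N.+1 * nrm f] of a constant no larger
   than [nrm f]. *)
have p1 : nrm p <= 1.
  apply: nrm_bop_le => // f; rewrite mul1r -subr_le0; apply: eq0_of_small => eps eps0.
  have [||N hN] := @vanishingM R (nrm p * nrm f) (fun n => r ^+ n) _ _ eps eps0.
  - by rewrite mulr_ge0 ?nrm_ge0.
  - by apply: vanishing_expr; rewrite (ltW r0).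
  apply: le_trans (hN N.+1 (leqnSn N)); rewrite lerBlDr.
  set g := (P ^+ N.+1) f; rewrite -(pPk N.+1 f) -/g.
  have -> : p g = p (g - g point *: e) + g point.
    by rewrite bopB bopZ pe [_ *: 1]mulr1 subrK.
  rewrite (le_trans (nrmD _ _))// lerD//.
    rewrite (le_trans (nrm_app _ _))// -mulrA ler_wpM2l ?nrm_ge0// mulrC.
    by apply: centered => x y; exact: osc.
  rewrite (le_trans (nrm_bm_app _ _))// (le_trans (nrm_app _ _))//.
  by rewrite -[leRHS]mul1r ler_wpM2r ?nrm_ge0.
pose Pi := tensor e p; pose N0 := T - Pi.
have PiE f : Pi f = p f *: e by [].
have TPi : T * Pi = Pi by apply: bop_ext => f; rewrite bopME PiE bopZ Te.
have PiT : Pi * T = Pi by apply: bop_ext => f; rewrite bopME !PiE pT.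
have PiPi : Pi * Pi = Pi.
  by apply: bop_ext => f; rewrite bopME !PiE bopZ pe [_ *: 1]mulr1.
have N0X n : N0 ^+ n.+1 = T ^+ n.+1 - Pi.
  elim: n => [//|n IH]; rewrite exprS IH mulrBl !mulrBr TPi PiPi -exprS.
  have -> : Pi * T ^+ n.+1 = Pi by elim: (n.+1) => [|k IHk]; rewrite ?mulr1// exprS mulrA PiT.
  by rewrite subrr subr0.
have N0m : nrm (N0 ^+ m) <= r.
  have -> : N0 ^+ m = P - Pi by have := N0X m.-1; rewrite (prednK m0).
  apply: nrm_bop_le => [|f]; first exact: ltW.
  (* Invariance replaces [p f] by [p (P f)]; then [h x - p h] is the value of [p] at the centered
     function [h x *: e - h], so the oscillation of [P f] is all that counts. *)
  rewrite bopBE PiE; apply: nrm_bm_le => x; rewrite bmBE bmZE e1 mulr1 -(pP f).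
  set h := P f; have -> : h x - p h = p (h x *: e - h).
    by rewrite bopB bopZ pe [_ *: 1]mulr1.
  rewrite (le_trans (nrm_app _ _))// (le_trans (ler_wpM2r (nrm_ge0 _) p1))// mul1r.
  by rewrite nrm_distC; apply: centered => u v; exact: hP.
have nPi : nrm Pi <= 1.
  rewrite (le_trans (bilin_nrm (bilin_tensor V) e p))//.
  by rewrite -[leRHS]mulr1 ler_pM ?nrm_ge0.
have N02 : nrm N0 <= 2 by rewrite (le_trans (nrmB _ _))// -[2]/(1 + 1) lerD.
have [|Y [Y1 Y2] nY] := neumann_pow bV N0m r1 N02; first by rewrite ler1n.
have PiN0 : Pi * N0 = 0 by rewrite mulrBr PiT PiPi subrr.
have N0Pi : N0 * Pi = 0 by rewrite mulrBl TPi PiPi subrr.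
have PiY : Pi * Y = Pi.
  by rewrite -{1}[Pi]subr0 -PiN0 -{1}[Pi]mulr1 -mulrBr -mulrA Y1 mulr1.
have YPi : Y * Pi = Pi.
  by rewrite -{1}[Pi]subr0 -N0Pi -{1}[Pi]mul1r -mulrBl mulrA Y2 mul1r.
have T1E : 1 - T = (1 - N0) - Pi by rewrite /N0 opprB addrA addrAC addrK.
have Pie : Pi e = e by rewrite PiE pe scale1r.
(* [Y] inverts [1 - N0] and is the identity on the line of [e]; removing [Pi] makes it vanish there.
   The bound is that of [neumann_pow] with [nrm N0 <= 2], plus 1 for [Pi]. *)
exists p, (Y - Pi); split; [by split|split=> //]; split.
- by rewrite bopBE Pie -{1}Pie -bopME YPi Pie subrr.
- move=> f; rewrite bopBE bopB PiE bopZ pe [_ *: 1]mulr1.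
  apply/eqP; rewrite subr_eq0; apply/eqP.
  have := congr1 (fun S : bop V V => S f) PiY; rewrite bopME !PiE.
  by move=> /(congr1 p); rewrite !bopZ pe ![_ *: 1]mulr1.
- by rewrite T1E mulrBl !mulrBr Y1 PiY PiPi mulrBl mul1r N0Pi subr0 subrr subr0.
- by rewrite T1E mulrBr !mulrBl Y2 YPi PiPi mulrBr mulr1 PiN0 subr0 subrr subr0.
- by rewrite (le_trans (nrmB _ _))// lerD.
Qed.

End Ergodic.

(** * Perturbation of a simple isolated eigenvalue *)

(** Course-of-values recursion. [w n] lists the first [n.+1] values, and the locality hypothesis on
    [G] makes the default [x0] beyond the end of the list harmless. *)
Lemma strong_rec (T : Type) (x0 : T) (G : nat -> (nat -> T) -> T) :
  (forall n f g, (forall i, (i <= n)%N -> f i = g i) -> G n f = G n g) ->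
  exists v, v 0%N = x0 /\ forall n, v n.+1 = G n v.
Proof.
move=> hG.
pose w := fix w n := if n is n'.+1 then rcons (w n') (G n' (nth x0 (w n'))) else [:: x0].
have sw n : size (w n) = n.+1 by elim: n => //= n IH; rewrite size_rcons IH.
have wv N i : (i <= N)%N -> nth x0 (w N) i = nth x0 (w i) i.
  elim: N => [|N IH]; first by rewrite leqn0 => /eqP ->.
  rewrite leq_eqVlt => /orP[/eqP -> //|]; rewrite ltnS => iN.
  by rewrite /= nth_rcons sw ltnS iN IH.
exists (fun n => nth x0 (w n) n); split=> // n.
rewrite /= nth_rcons sw ltnn eqxx; apply: hG => i; exact: wv.
Qed.

Section Geo.
Context {R : realType} {V : normedModType R[i]}.
Hypothesis bV : banach V.

Lemma pserB rho M M' (a b : nat -> V) f g : 0 <= rho -> pser rho M a f ->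
  pser rho M' b g -> pser rho (M + M') (fun k => a k - b k) (fun z => f z - g z).
Proof.
move=> r0 h h'; apply: (pserD r0 h); rewrite -[M']mul1r.
apply: (pser_map (F := -%R) _ _ r0 _ h') => // [c x y|x].
  by rewrite opprD scalerN.
by rewrite nrmN mul1r.
Qed.

(** This is [phi = p (1 - Lz)^-1] computed on coefficients, so that the result is again a power
    series. [L 0 = 0] makes the recursion strict, and [ell <= 1 / 2] propagates the bound, since
    [nrm p + 2 * nrm p * ell <= 2 * nrm p]. *)
Lemma geometric_functional (p : dual V) rho ell (L : nat -> bop V V) Lz :
  0 <= rho -> pser rho ell L Lz -> L 0%N = 0 -> ell <= 2^-1 ->
  exists (c : nat -> dual V) phi, [/\ pser rho (2 * nrm p) c phi, c 0%N = p &
    forall z : R[i], nrm z <= rho -> forall f, phi z f = p f + phi z (Lz z f)].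
Proof.
move=> r0 hL L0 ell2.
have [|c [c0 cS]] := @strong_rec (dual V) p
    (fun n c => \sum_(i < n.+1) bcomp (c i) (L (n.+1 - i)%N)).
  by move=> n f g fg; apply: eq_bigr => i _; rewrite fg// -ltnS.
pose x i := nrm (c i) * rho ^+ i; pose y j := nrm (L j.+1) * rho ^+ j.+1.
have x0 i : 0 <= x i by rewrite mulr_ge0 ?nrm_ge0 ?exprn_ge0.
have y0 i : 0 <= y i by rewrite mulr_ge0 ?nrm_ge0 ?exprn_ge0.
have yl n : \sum_(j < n) y j <= ell.
  by have := hL.1 n.+1; rewrite big_ord_recl L0 nrm0 mul0r add0r.
have xc n : \sum_(k < n) x k <= 2 * nrm p.
  elim: n => [|n IH]; first by rewrite big_ord0 mulr_ge0 ?nrm_ge0.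
  rewrite big_ord_recl {1}/x c0 mulr1.
  suff : \sum_(i < n) x i.+1 <= nrm p by lra.
  apply: (@le_trans _ _ (\sum_(k < n) \sum_(i < k.+1) x i * y (k - i)%N)).
    rewrite ler_sum// => k _; rewrite /x cS.
    rewrite (le_trans (ler_wpM2r _ (nrm_sum _ _ _))) ?exprn_ge0// mulr_suml ler_sum// => i _.
    have ik : (i <= k)%N by rewrite -ltnS.
    rewrite /x /y subSn// mulrACA -exprD addnS subnKC// ler_wpM2r ?exprn_ge0//.
    exact: (bilin_nrm (bilin_bcomp _ _ _)).
  rewrite (le_trans (conv_sum_le _ _ _))//.
  rewrite (@le_trans _ _ (2 * nrm p * 2^-1))//; last by rewrite mulrAC mulfV// mul1r.
  by rewrite ler_pM ?sumr_ge0// (le_trans (yl n)).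
have [phi hphi] := pser_exists (V := dual V)
  (banach_bop (@banach_complex R)) xc.
exists c, phi; split=> // z zr f.
have bc0 (q : dual V) : bcomp q (0 : bop V V) = 0.
  exact: (lin0 (bilin_r (bilin_bcomp V V (R[i] : normedModType R[i])) q)).
have h1 := pser_bilin (bilin_bcomp V V (R[i] : normedModType R[i])) r0 hphi hL.
have h2 := pserD r0 (pser_cst rho p) h1.
have h3 := eq_pser (b := c) (g := fun z => p + bcomp (phi z) (Lz z)) h2.
have {}h3 := h3 _ (fun _ _ => erefl).
rewrite {1}(pser_uniq hphi (h3 _) zr)// => -[|n].
  by rewrite big_ord1 L0 bc0 addr0 c0.
by rewrite add0r cS big_ord_recr/= subnn L0 bc0 addr0.
Qed.

End Geo.

Section Eigen.
Context {R : realType} {V : normedModType R[i]}.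
Hypothesis bV : banach V.
Variables (rho MA eps s : R) (A : nat -> bop V V) (Qz : R[i] -> bop V V).
Variables (e : V) (p : dual V) (S : bop V V).
Hypotheses (r0 : 0 <= rho) (hA : pser rho MA A Qz).
Hypotheses (ne : nrm e <= 1) (np : nrm p <= 1) (pe : p e = 1).
Hypotheses (A0e : A 0%N e = e) (pA0 : forall f, p (A 0%N f) = p f).
Hypotheses (Se : S e = 0) (pS : forall f, p (S f) = 0).
Hypotheses (S1 : (1 - A 0%N) * S = 1 - tensor e p).
Hypotheses (S2 : S * (1 - A 0%N) = 1 - tensor e p).
Hypotheses (nS : nrm S <= s) (s1 : 1 <= s) (eps0 : 0 <= eps).
Hypothesis hB : forall n, \sum_(k < n) nrm (A k.+1) * rho ^+ k.+1 <= eps.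
Hypothesis small : 24 * (s * eps) <= 1.

(* Identification of the coefficients of [z ^+ n.+1] in
   [Qz z (ups z) = lam z *: ups z], solved for [v n.+1] with the reduced
   resolvent [S]; applying [p] determines [l n.+1]. *)
Lemma eigen_coefs : exists (v : nat -> V) (l : nat -> R[i]),
  [/\ v 0%N = e, l 0%N = 1,
    forall n, l n.+1 = p (\sum_(j < n.+1) A j.+1 (v (n - j)%N)) &
    forall n, v n.+1 =
      S (\sum_(k < n.+1) (A k.+1 (v (n - k)%N) - l k.+1 *: v (n - k)%N))].
Proof.
pose lam (v : nat -> V) n := if n is k.+1 then p (\sum_(j < k.+1) A j.+1 (v (k - j)%N)) else 1.
have [|v [v0 vS]] := @strong_rec V e (fun n v =>
    S (\sum_(k < n.+1) (A k.+1 (v (n - k)%N) - lam v k.+1 *: v (n - k)%N))).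
  move=> n f g fg; congr (S _); apply: eq_bigr => k _.
  rewrite fg ?leq_subr//; congr (_ - _ *: _); rewrite /lam; congr (p _).
  apply: eq_bigr => j _; rewrite fg// (leq_trans (leq_subr _ _))// -ltnS.
  exact: ltn_ord.
by exists v, (lam v).
Qed.

(* The functional [phi] solves the linear equation
   [phi = p + phi \o ((Q - A 0 - (lam - 1)) S - (ups - e) (x) p)]. This gives
   [phi ups = 1] on [e], and [phi (Q - lam)] proportional to [p] on the range of
   [1 - A 0], the factor being zero because of the value at [ups]. *)
Lemma eigen_pser : exists (l : nat -> R[i]) (v : nat -> V) (c : nat -> dual V) lam ups phi,
  [/\ pser rho 2 l lam, pser rho 2 v ups & pser rho 2 c phi] /\
  [/\ l 0%N = 1, v 0%N = e & c 0%N = p] /\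
  forall z : R[i], nrm z <= rho ->
    [/\ Qz z (ups z) = lam z *: ups z, forall f, phi z (Qz z f) = lam z * phi z f,
      phi z (ups z) = 1, p (ups z) = 1 &
      nrm (lam z - 1) <= 2 * eps /\ nrm (ups z - e) <= 6 * (s * eps)].
Proof.
have [v [l [v0 l0 lS vS]]] := eigen_coefs.
have sm : 24 * (s * eps) <= 1 := small.
have e0 : 0 <= eps := eps0.
have np1 : nrm p <= 1 := np.
have se : eps <= s * eps by rewrite ler_peMl.
have s0 : 0 <= s by rewrite (le_trans _ s1).
pose a j := nrm (A j.+1) * rho ^+ j.+1; pose y j := nrm (v j) * rho ^+ j.
pose la j := nrm (l j.+1) * rho ^+ j.+1.
have a0 i : 0 <= a i by rewrite mulr_ge0 ?nrm_ge0 ?exprn_ge0.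
have y0 i : 0 <= y i by rewrite mulr_ge0 ?nrm_ge0 ?exprn_ge0.
have la0 i : 0 <= la i by rewrite mulr_ge0 ?nrm_ge0 ?exprn_ge0.
(* Weight [eps] of the perturbation times weight 2 of the eigenvector. *)
have Lam n : \sum_(k < n) y k <= 2 -> \sum_(k < n) la k <= 2 * eps.
  move=> y2; apply: (@le_trans _ _ (\sum_(k < n) \sum_(j < k.+1) a j * y (k - j)%N)).
    rewrite ler_sum// => k _; rewrite /la lS.
    rewrite (le_trans (ler_wpM2r _ (nrm_app _ _))) ?exprn_ge0// -mulrA.
    rewrite -[leRHS]mul1r ler_pM ?mulr_ge0 ?nrm_ge0 ?exprn_ge0//.
    rewrite (le_trans (ler_wpM2r _ (nrm_sum _ _ _))) ?exprn_ge0// mulr_suml ler_sum// => j _.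
    have jk : (j <= k)%N by rewrite -ltnS.
    rewrite /a /y mulrACA -exprD addSn subnKC// ler_wpM2r ?exprn_ge0//.
    exact: nrm_app.
  rewrite (le_trans (conv_sum_le _ _ _))// mulrC ler_pM ?sumr_ge0//.
(* The constant is [s * (eps + 2 * eps) * 2]: resolvent, then perturbation and eigenvalue
   corrections, then weight 2 of the eigenvector. *)
have W n : \sum_(k < n) y k <= 2 -> \sum_(k < n) y k.+1 <= 6 * (s * eps).
  move=> y2; apply: (@le_trans _ _ (s * \sum_(k < n) \sum_(j < k.+1) (a j + la j) * y (k - j)%N)).
    rewrite mulr_sumr ler_sum// => k _; rewrite /y vS.
    rewrite (le_trans (ler_wpM2r _ (nrm_app _ _))) ?exprn_ge0// -mulrA.
    rewrite ler_pM ?mulr_ge0 ?nrm_ge0 ?exprn_ge0//.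
    rewrite (le_trans (ler_wpM2r _ (nrm_sum _ _ _))) ?exprn_ge0// mulr_suml ler_sum// => j _.
    have jk : (j <= k)%N by rewrite -ltnS.
    rewrite /a /la /y -mulrDl mulrACA -exprD addSn subnKC// ler_wpM2r ?exprn_ge0//.
    rewrite (le_trans (nrmB _ _))// mulrDl lerD//; first exact: nrm_app.
    by rewrite nrmZ.
  have := conv_sum_le (x := fun j => a j + la j) (y := y) n
    (fun i => addr_ge0 (a0 i) (la0 i)) y0.
  move=> /(ler_wpM2l s0)/le_trans; apply.
  apply: (@le_trans _ _ (s * (3 * eps * 2))); last by lra.
  rewrite ler_wpM2l// ler_pM ?sumr_ge0// => [i _|]; first by rewrite addr_ge0.
  rewrite big_split/=; have := hB n; have := Lam n y2; rewrite /a; lra.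
(* The recursion for [v n.+1] reads only earlier coefficients, so the bound on [n] terms yields the
   one on [n.+1] terms: at most 1 for [e], plus [6 * (s * eps) <= 1 / 4]. *)
have Y n : \sum_(k < n) y k <= 2.
  elim: n => [|n IH]; first by rewrite big_ord0.
  rewrite big_ord_recl {1}/y v0 mulr1.
  have Wn : \sum_(i < n) y (lift ord0 i) <= 6 * (s * eps) := W n IH.
  by apply: le_trans (lerD ne Wn) _; lra.
have l2 n : \sum_(k < n) nrm (l k) * rho ^+ k <= 2.
  case: n => [|n]; first by rewrite big_ord0.
  rewrite big_ord_recl l0 nrm1 mulr1.
  have Ln : \sum_(i < n) nrm (l (lift ord0 i)) * rho ^+ lift ord0 i <= 2 * eps := Lam n (Y n).
  by apply: le_trans (lerD (lexx 1) Ln) _; lra.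
have [lam hlam] := pser_exists (@banach_complex R) l2.
have [ups hups] := pser_exists bV Y.
have hB' := pser_tail hA hB.
have hlam' := pser_tail hlam (fun n => Lam n (Y n)).
have hups' := pser_tail hups (fun n => W n (Y n)).
have pv n : p (v n.+1) = 0 by rewrite vS pS.
have pups z : nrm z <= rho -> p (ups z) = 1.
  move=> zr; have h : pser rho (1 * 2) (fun k => p (v k)) (fun z => p (ups z)).
    apply: (pser_map (F := p) _ _ r0 _ hups) => // [c f g|f]; first exact: bop_linear.
    by rewrite (le_trans (nrm_app _ _))// ler_wpM2r ?nrm_ge0.
  have {}h : pser rho (1 * 2) (fun k => if k is 0 then (1 : R[i]) else 0) (fun z => p (ups z)).
    by apply: eq_pser h _ _ => // -[|k]; rewrite ?v0.
  exact: (pser_uniq h (pser_cst rho (1 : R[i])) zr).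
have eig z : nrm z <= rho -> Qz z (ups z) = lam z *: ups z.
  move=> zr.
  have h1 := pser_bilin (bilin_app V V) r0 hA hups.
  have h2 := pser_bilin (bilin_scale V) r0 hlam hups.
  suff h3 : pser rho (2 * 2) (fun n => \sum_(i < n.+1) A i (v (n - i)%N))
      (fun z => lam z *: ups z) by exact: (pser_uniq h1 h3 zr).
  apply: eq_pser h2 _ _ => // n; apply/esym; case: n => [|n].
    by rewrite !big_ord1/= l0 v0 A0e scale1r.
  pose X := \sum_(k < n.+1) (A k.+1 (v (n - k)%N) - l k.+1 *: v (n - k)%N).
  (* The choice of [l n.+1] is the solvability condition: since [p X = 0], [1 - tensor e p] fixes
     [X] and [S X] solves [(1 - A 0) v = X]. In the sum with [l], only the last term, with
     [v 0 = e], is seen by [p]. *)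
  have pX : p X = 0.
    rewrite /X sumrB bopB -lS [X in p X]big_ord_recr/= subnn v0 bopD bopZ pe.
    rewrite linear_sum big1/= => [|k _].
      by rewrite add0r [_ *: 1]mulr1 subrr.
    rewrite bopZ -(prednK (_ : 0 < n - k)%N) ?subn_gt0//.
    by rewrite pv scaler0.
  have := congr1 (fun T : bop V V => T X) S1; rewrite bopME !bopBE !bop1E.
  rewrite -vS [tensor e p X]/= pX scale0r subr0 => E.
  have E' : v n.+1 = X + A 0%N (v n.+1) by rewrite -E subrK.
  have RA : \sum_(i < n.+2) A i (v (n.+1 - i)%N) =
      A 0%N (v n.+1) + \sum_(k < n.+1) A k.+1 (v (n - k)%N).
    by rewrite big_ord_recl subn0; congr (_ + _); apply: eq_bigr.
  have RL : \sum_(i < n.+2) l i *: v (n.+1 - i)%N =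
      v n.+1 + \sum_(k < n.+1) l k.+1 *: v (n - k)%N.
    by rewrite big_ord_recl subn0 l0 scale1r; congr (_ + _); apply: eq_bigr.
  by rewrite RA RL [in RHS]E' /X sumrB [RHS]addrAC subrK addrC.
have lF1 : lin (fun c : R[i] => c *: (1 : bop V V)).
  by move=> a' x x'; rewrite scalerDl scalerA.
have nF1 (x : R[i]) : nrm (x *: (1 : bop V V)) <= 1 * nrm x.
  by rewrite nrmZ mulrC ler_wpM2r ?nrm_ge0// nrm_op1.
have h1 := pser_map lF1 ler01 r0 nF1 hlam'.
have lF2 : lin (fun T : bop V V => T * S).
  by move=> a' T T'; rewrite mulrDl bopZl.
have nF2 (T : bop V V) : nrm (T * S) <= s * nrm T.
  by rewrite (le_trans (nrm_opM _ _))// mulrC ler_wpM2r ?nrm_ge0.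
have h2 := pser_map lF2 s0 r0 nF2 (pserB r0 hB' h1).
have lF3 : lin (fun x : V => tensor x p) := bilin_l (bilin_tensor V) p.
have nF3 (x : V) : nrm (tensor x p) <= 1 * nrm x.
  rewrite (le_trans (bilin_nrm (bilin_tensor V) x p))// mulrC.
  by rewrite ler_wpM2r ?nrm_ge0.
have h3 := pser_map lF3 ler01 r0 nF3 hups'.
have hL := pserB r0 h2 h3.
(* The total is [9 * (s * eps)], below one half by [24 * (s * eps) <= 1]. *)
have ell : s * (eps + 1 * (2 * eps)) + 1 * (6 * (s * eps)) <= 2^-1 by lra.
have [|c [phi [hphi c0 phiE]]] := geometric_functional p r0 hL _ ell.
  by rewrite scale0r subr0 mul0r (lin0 lF3) subr0.
have {}hphi : pser rho 2 c phi by apply: pser_mono hphi; lra.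
exists l, v, c, lam, ups, phi; split=> //; split=> // z zr.
have H f : phi z f = p f + (phi z (Qz z (S f) - A 0%N (S f) - (lam z - 1) *: S f) -
    p f * phi z (ups z - e)).
  rewrite {1}(phiE z zr f) bopBE bopME !bopBE bopZE bop1E bopB l0 v0.
  by rewrite [tensor _ _ f]/= bopZ.
have phiups : phi z (ups z) = 1.
  have := H e; rewrite Se !bop0 scaler0 !subr0 bop0 pe mul1r sub0r (bopB (phi z)).
  set x := phi z e; set w := phi z (ups z) => E.
  have -> : w = 1 - (1 - (w - x)) + x by ring.
  by rewrite -E subrK.
have H2 f : phi z (Qz z f) - lam z * phi z f =
    p f * phi z (Qz z e - A 0%N e - (lam z - 1) *: e).
  have SE : S (f - A 0%N f) = f - p f *: e.
    by have := congr1 (fun T : bop V V => T f) S2.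
  have := H (f - A 0%N f).
  rewrite (bopB p) pA0 subrr mul0r subr0 add0r SE.
  rewrite !(bopB, bopZ (Qz z), bopZ (A 0%N), dualZ) => E.
  apply/eqP; rewrite -subr_eq0; move/eqP: E; rewrite -subr_eq0 => /eqP E.
  rewrite -[X in _ == X]oppr0 -[in X in _ == X]E; apply/eqP; ring.
split=> //.
- exact: eig.
- move=> f; have := H2 (ups z).
  rewrite eig// dualZ phiups pups// mul1r !mulr1 subrr => E.
  by apply/eqP; rewrite -subr_eq0 H2 -E mulr0.
- exact: pups.
- split; first by rewrite -l0; exact: pser_bound hlam' zr.
  by rewrite -v0; exact: pser_bound hups' zr.
Qed.

End Eigen.

(** * The complex exponential and twisted kernels *)

Section Cexp.
Context {R : realType}.
Local Open Scope complex_scope.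

Lemma cexpD (a b : R[i]) : cexp (a + b) = cexp a * cexp b.
Proof.
case: a => a1 a2; case: b => b1 b2; rewrite /cexp /= expRD cosD sinD.
apply/eqP; rewrite eq_complex /=; apply/andP; split; apply/eqP; ring.
Qed.

Lemma cvg_vanishing (u : nat -> R) (l : R) : u @ \oo --> l ->
  vanishing (fun n => `|u n - l|).
Proof.
move=> /cvgrPdist_le h e e0; have [N _ hN] := h e e0.
by exists N => n /hN /=; rewrite distrC.
Qed.

Definition ecoef (k : nat) : R[i] := (k`!%:R)^-1.

Lemma ecoefE k : ecoef k = (k`!%:R^-1)%:C.
Proof. by rewrite /ecoef fmorphV rmorph_nat. Qed.

Lemma nrm_real (x : R) : nrm (x%:C) = `|x|.
Proof. by rewrite nrmC /= expr0n addr0 sqrtr_sqr. Qed.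

Lemma exp_series_sum (x : R) n : 0 <= x ->
  \sum_(k < n) nrm (ecoef k) * x ^+ k <= expR x.
Proof.
move=> x0; rewrite (eq_bigr (fun k : 'I_n => exp_coeff x k)); last first.
  by move=> k _; rewrite ecoefE nrm_real ger0_norm ?invr_ge0// mulrC.
rewrite -(big_mkord xpredT (exp_coeff x)).
apply: (@nondecreasing_cvgn_le R (series (exp_coeff x)) _ (is_cvg_series_exp_coeff x) n).
by apply: nondecreasing_series => k *; rewrite divr_ge0 ?exprn_ge0.
Qed.

Lemma tends_exp_real (a : R) :
  tends (fun n => \sum_(k < n) a%:C ^+ k * ecoef k) (expR a)%:C.
Proof.
have E n : \sum_(k < n) a%:C ^+ k * ecoef k = (\sum_(k < n) exp_coeff a k)%:C.
  rewrite rmorph_sum; apply: eq_bigr => k _.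
  by rewrite /= rmorphM/= rmorphXn/= ecoefE.
apply: complex_tends => e e0.
  have [N hN] := cvg_vanishing (is_cvg_series_exp_coeff a) e0.
  by exists N => n /hN; rewrite E /= /series/= big_mkord.
by exists 0%N => n _; rewrite E /= subrr normr0 ltW.
Qed.

Lemma imag_pow (b : R) k : (0 +i* b) ^+ k * ecoef k = cos_coeff b k +i* sin_coeff b k.
Proof.
have ev j : (0 +i* b) ^+ j.*2 = ((-1) ^+ j * b ^+ j.*2)%:C.
  rewrite -mul2n !exprM -exprMn rmorphXn; congr (_ ^+ _).
  by rewrite mulN1r !expr2; apply/eqP; rewrite eq_complex/=; apply/andP; split; apply/eqP; ring.
rewrite -(odd_double_half k); case: (odd k); move: (k./2) => j.
  rewrite add1n exprS ev ecoefE /cos_coeff /sin_coeff/= odd_double/= doubleK.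
  by apply/eqP; rewrite eq_complex/=; apply/andP; split; apply/eqP; rewrite ?exprS; ring.
rewrite add0n ev ecoefE /cos_coeff /sin_coeff/= odd_double/= doubleK -exprnP.
by apply/eqP; rewrite eq_complex/=; apply/andP; split; apply/eqP; ring.
Qed.

Lemma tends_exp_imag (b : R) :
  tends (fun n => \sum_(k < n) (0 +i* b) ^+ k * ecoef k) (cos b +i* sin b).
Proof.
have E n : \sum_(k < n) (0 +i* b) ^+ k * ecoef k =
    (\sum_(k < n) cos_coeff b k) +i* (\sum_(k < n) sin_coeff b k).
  elim: n => [|n IH]; first by rewrite !big_ord0.
  by rewrite !big_ord_recr/= IH imag_pow.
have cE : cos b = limn (series (cos_coeff b)) by rewrite unlock.
have sE : sin b = limn (series (sin_coeff b)) by rewrite unlock.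
apply: complex_tends => e e0.
  have [N hN] := cvg_vanishing (@is_cvg_series_cos_coeff R b) e0.
  by exists N => n /hN; rewrite E /= cE /series/= big_mkord.
have [N hN] := cvg_vanishing (@is_cvg_series_sin_coeff R b) e0.
by exists N => n /hN; rewrite E /= sE /series/= big_mkord.
Qed.

Lemma ecoefM i k : (i <= k)%N -> ecoef i * ecoef (k - i) = ecoef k *+ 'C(k, i).
Proof.
move=> ik; rewrite -[RHS]mulr_natl /ecoef -(bin_fact ik) natrM invfM mulrA mulfV.
  by rewrite mul1r natrM invfM.
by rewrite pnatr_eq0 -lt0n bin_gt0.
Qed.

(** The argument [w] sits in the coefficients and the series is evaluated at 1 only, so that two
    different exponents can be multiplied as power series in the same variable. *)
Lemma exp_scaled_pser (w : R[i]) : exists f,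
  pser 1 (expR (nrm w)) (fun k => w ^+ k * ecoef k : R[i]) f.
Proof.
apply: pser_exists; first exact: banach_complex.
move=> n; apply: le_trans (exp_series_sum n (nrm_ge0 w)).
by rewrite ler_sum// => k _; rewrite expr1n mulr1 nrmcM nrmX mulrC.
Qed.

(** [cexp] is defined from real functions. Its series is obtained from the real exponential and from
    cosine and sine on the imaginary axis, joined by a Cauchy product and the binomial theorem. *)
Lemma tends_cexp (w : R[i]) : tends (fun n => \sum_(k < n) w ^+ k * ecoef k) (cexp w).
Proof.
case: w => a b.
have [f hf] := exp_scaled_pser a%:C; have [g hg] := exp_scaled_pser (0 +i* b).
have n1 : nrm (1 : R[i]) <= 1 by rewrite nrm1.
have one (h : R[i] -> R[i]) M c l : pser 1 M c h ->
    tends (fun n => \sum_(k < n) c k) l -> h 1 = l.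
  move=> [_ /(_ 1 n1) hc]; apply: tends_unique; apply: eq_tends hc => n.
  by apply: eq_bigr => k _; rewrite expr1n scale1r.
have fE := one _ _ _ _ hf (tends_exp_real a).
have gE := one _ _ _ _ hg (tends_exp_imag b).
have hfg := pser_bilin (bilin_scale (R[i] : normedModType R[i])) ler01 hf hg.
have -> : cexp (a +i* b) = f 1 *: g 1.
  by rewrite fE gE /cexp/=; apply/eqP; rewrite eq_complex/=; apply/andP; split; apply/eqP; ring.
have [_ /(_ 1 n1)] := hfg; apply: eq_tends => n.
apply: eq_bigr => k _; rewrite expr1n scale1r.
have -> : (a +i* b) = (0 +i* b) + a%:C.
  by apply/eqP; rewrite eq_complex/= add0r addr0 !eqxx.
rewrite exprDn mulr_suml; apply: eq_bigr => i _.
have ik : (i <= k)%N by rewrite -ltnS.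
rewrite [_ *: _]mulrACA ecoefM// mulrnAr mulrnAl; congr (_ * _ *+ _).
exact: mulrC.
Qed.

Lemma nrm_ecoef k : nrm (ecoef k) <= 1.
Proof.
by rewrite ecoefE nrm_real ger0_norm ?invr_ge0// invf_le1 ?ltr0n ?fact_gt0// ler1n fact_gt0.
Qed.

Lemma cexp_sub1 (w : R[i]) : nrm w <= 2^-1 -> nrm (cexp w - 1) <= 2 * nrm w.
Proof.
move=> w2; apply: (tends_le (n0 := 1) (tends_cexp w)) => -[//|n] _.
rewrite big_ord_recl expr0 mul1r /ecoef fact0 invr1 addrAC subrr add0r.
rewrite (le_trans (nrm_sum _ _ _))//.
apply: (@le_trans _ _ (\sum_(k < n) nrm w * 2^-1 ^+ k)).
  rewrite ler_sum// => k _; rewrite nrmcM nrmX -[leRHS]mulr1 ler_pM ?nrm_ge0 ?exprn_ge0 ?nrm_ge0//.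
    by rewrite lift0 exprS ler_wpM2l ?nrm_ge0// lerXn2r ?nnegrE ?nrm_ge0// invr_ge0.
  exact: nrm_ecoef.
rewrite -mulr_sumr mulrC ler_wpM2r ?nrm_ge0//.
have half : 1 - 2^-1 = 2^-1 :> R by lra.
by rewrite (le_trans (geometric_sum_le _ _)) ?half ?invrK//; lra.
Qed.

(** Factoring out [cexp b], of norm at most 2, leaves [cexp (a - b) - 1]; the bound 1/4 on both
    arguments keeps [a - b] within the range of [cexp_sub1]. *)
Lemma cexp_lipschitz (a b : R[i]) : nrm a <= 4^-1 -> nrm b <= 4^-1 ->
  nrm (cexp a - cexp b) <= 4 * nrm (a - b).
Proof.
move=> ha hb; rewrite -{1}(subrK b a) cexpD.
have -> : cexp (a - b) * cexp b - cexp b = (cexp (a - b) - 1) * cexp b by ring.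
have ab : nrm (a - b) <= 2^-1 by apply: le_trans (nrmB _ _) _; lra.
have b2 : nrm b <= 2^-1 by lra.
have cb : nrm (cexp b) <= 2.
  by have := nrm_sub (cexp b) 1; have := cexp_sub1 b2; rewrite nrm1; lra.
rewrite nrmcM; apply: (@le_trans _ _ (2 * nrm (a - b) * 2)); last by lra.
by rewrite ler_pM ?nrm_ge0// cexp_sub1.
Qed.

Lemma cexp_tail (w : R[i]) (q : R) n : nrm w <= q -> q <= 2^-1 ->
  nrm (cexp w - \sum_(k < n) w ^+ k * ecoef k) <= 2 * q ^+ n.
Proof.
move=> wq q2; have q0 := le_trans (nrm_ge0 w) wq.
apply: (@absum_tends_tail _ _ (fun k => w ^+ k * ecoef k) _ (fun n => 2 * q ^+ n) (tends_cexp w)) => {}n k.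
apply: (@le_trans _ _ (\sum_(n <= i < n + k) q ^+ i)).
  rewrite ler_sum// => i _; rewrite nrmcM nrmX -[leRHS]mulr1.
  by rewrite ler_pM ?nrm_ge0 ?exprn_ge0 ?nrm_ge0 ?nrm_ecoef// lerXn2r ?nnegrE ?nrm_ge0.
rewrite -{1}[n]add0n big_addn addKn big_mkord.
under eq_bigr do rewrite exprD.
rewrite -mulr_suml ler_wpM2r ?exprn_ge0//.
rewrite (le_trans (geometric_sum_le _ _))//; first lra.
rewrite -[leRHS]invrK lef_pV2 ?posrE; lra.
Qed.

End Cexp.

(** * Integral operators of kernels and their iterates *)

Section KernelIntegral.
Context d (X : measurableType d) (R : realType).
Local Notation V := (bmfun X R).

Lemma bounded_integrable (mu : {measure set X -> \bar R}) (h : X -> R) (M : R) :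
  (mu setT <= 1)%E -> measurable_fun setT h -> (forall y, `|h y| <= M) ->
  mu.-integrable setT (EFin \o h).
Proof.
move=> mu1 mh hM; apply: measurable_bounded_integrable => //.
  by rewrite (le_lt_trans mu1)// ltry.
exists M; split; first exact: num_real.
by move=> r Mr y _; apply: le_trans (hM y) (ltW Mr).
Qed.

Lemma Rintegral_bounded (mu : {measure set X -> \bar R}) (h : X -> R) (M : R) :
  mu setT = 1%E -> measurable_fun setT h -> (forall y, `|h y| <= M) ->
  `|\int[mu]_y h y| <= M.
Proof.
move=> mu1 mh hM; have mu1' : (mu setT <= 1)%E by rewrite mu1.
apply: le_trans (le_normr_Rintegral _ _) _ => //; first exact: bounded_integrable hM.
apply: (@le_trans _ _ (\int[mu]_y (fun=> M) y)).
  apply: le_Rintegral => //.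
  - apply: (@bounded_integrable _ _ M) => // [|y]; first exact: measurableT_comp.
    by rewrite normr_id.
  - by apply: (@bounded_integrable _ _ `|M|).
by rewrite Rintegral_cst // mu1 /= mulr1.
Qed.

Lemma bm_Re_le (f : V) y : `|complex.Re (f y)| <= nrm f.
Proof. exact: le_trans (le_Re_nrm _) (bmfun_le_norm _ _). Qed.

Lemma bm_Im_le (f : V) y : `|complex.Im (f y)| <= nrm f.
Proof. exact: le_trans (le_Im_nrm _) (bmfun_le_norm _ _). Qed.

Lemma complex_rotation (w : R[i]) : w != 0 ->
  exists2 c : R[i], nrm c = 1 & complex.Re (c * w) = nrm w.
Proof.
move=> w0; have n0 : nrm w != 0 by apply: contra w0 => /eqP/nrm0_eq0->.
have n2 : complex.Re w ^+ 2 + complex.Im w ^+ 2 = nrm w ^+ 2.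
  by rewrite nrmC sqr_sqrtr// addr_ge0 ?sqr_ge0.
case: w {w0} n0 n2 => a b; set n := nrm _ => n0 /= n2.
(* The rotation is the conjugate of [w] divided by its norm. *)
exists (a / n +i* - (b / n))%C => /=.
  apply/eqP; rewrite -(@eqrXn2 _ 2)// ?nrm_ge0//; rewrite nrmC sqr_sqrtr ?addr_ge0 ?sqr_ge0//=.
  by rewrite sqrrN !expr_div_n -mulrDl n2 divff ?expr1n// expf_neq0.
have -> : a / n * a - - (b / n) * b = (a ^+ 2 + b ^+ 2) / n by ring.
by rewrite n2 expr2 mulfK.
Qed.

(* Rotating by a unimodular constant makes the value of the integral real and
   nonnegative, so that only the bound for real integrands is needed. *)
Lemma nrm_kint (k : R.-pker X ~> X) : nrm (kint k) <= 1.
Proof.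
apply: nrm_bop_le => // f; rewrite mul1r; apply: nrm_bm_le => x.
set w := kint k f x; have [w0|w0] := eqVneq w 0; first by rewrite w0 nrm0 nrm_ge0.
have [c nc cw] := complex_rotation w0.
have {}cw : complex.Re (kint k (c *: f) x) = nrm w by rewrite bopZ bmZE.
rewrite -cw (le_trans (ler_norm _))//.
have kx : k x setT = 1%E by rewrite prob_kernel.
have := Rintegral_bounded kx (bmfun_measurable (c *: f)).1 (bm_Re_le (c *: f)).
by move=> /le_trans; apply; rewrite nrmZ nc mul1r.
Qed.

Lemma kint_const (k : R.-pker X ~> X) (e : V) : (forall x, e x = 1) -> kint k e = e.
Proof.
move=> e1; apply/val_inj/funext => x; rewrite /= /cint e1.
have -> : (fun y => complex.Re (e y)) = fun=> 1 by apply/funext => y; rewrite e1.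
have -> : (fun y => complex.Im (e y)) = fun=> 0 by apply/funext => y; rewrite e1.
by rewrite !Rintegral_cst// prob_kernel /= !mulr1.
Qed.

Lemma spker_le1 (k : R.-spker X ~> X) x : (k x setT <= 1)%E.
Proof. exact: sprob_kernel_le1. Qed.

Lemma measurable_Rintegral (k : R.-spker X ~> X) (h : X -> R) :
  measurable_fun setT h -> (forall y, 0 <= h y) ->
  measurable_fun setT (fun x => \int[k x]_y h y).
Proof.
move=> mh h0; apply: (measurableT_comp (f := fine)); first exact: fine_measurable.
apply: (measurable_fun_integral_kernel (l := k)).
- exact: measurable_kernel.
- by move=> y; rewrite lee_fin.
- exact/measurable_EFinP.
Qed.

Lemma Rintegral_kcomp_ge0 (k : R.-pker X ~> X) (k' : R.-spker X ~> X) x (h : X -> R) (M : R) :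
  measurable_fun setT h -> (forall y, 0 <= h y <= M) ->
  \int[mkcomp_noparam k k' x]_y h y = \int[k x]_y (\int[k' y]_z h z).
Proof.
move=> mh hM; have h0 y : 0 <= h y by have /andP[] := hM y.
have hM' y : `|h y| <= M by rewrite ger0_norm//; have /andP[] := hM y.
rewrite /Rintegral; congr fine.
transitivity (\int[kcomp k (kernel.kernel_snd k') x]_y (h y)%:E)%E.
  exact: eq_measure_integral.
rewrite integral_kcomp//; last exact/measurable_EFinP.
apply: eq_integral => y _; rewrite fineK//.
apply: integrable_fin_num => //; apply: (bounded_integrable _ mh hM'); exact: spker_le1.
Qed.

(** The nonnegative case is applied to [h + M] and to the constant [M], and the results are
    subtracted. The constant stays under the integral because [k'] may have total mass below 1. *)
Lemma Rintegral_kcomp (k : R.-pker X ~> X) (k' : R.-spker X ~> X) x (h : X -> R) (M : R) :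
  measurable_fun setT h -> (forall y, `|h y| <= M) ->
  \int[mkcomp_noparam k k' x]_y h y = \int[k x]_y (\int[k' y]_z h z).
Proof.
move=> mh hM; have M0 : 0 <= M := le_trans (normr_ge0 _) (hM point).
pose u y := h y + M.
have mu : measurable_fun setT u by exact: measurable_funD.
have uM y : 0 <= u y <= M + M by have := hM y; rewrite /u ler_norml; lra.
have cM (y : X) : 0 <= (fun=> M) y <= M by rewrite M0/=.
have mM : measurable_fun [set: X] (fun=> M) by exact: measurable_cst.
have iu (m : {measure set X -> \bar R}) : (m setT <= 1)%E -> m.-integrable setT (EFin \o u).
  move=> m1; apply: (bounded_integrable (M := M + M) m1 mu) => y.
  by have /andP[u0 u1] := uM y; rewrite ger0_norm.
have iM (m : {measure set X -> \bar R}) : (m setT <= 1)%E ->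
    m.-integrable setT (EFin \o (fun=> M)).
  by move=> m1; apply: (bounded_integrable (M := M) m1 mM) => y; rewrite ger0_norm.
have hu (m : {measure set X -> \bar R}) : (m setT <= 1)%E ->
    \int[m]_y h y = \int[m]_y u y - \int[m]_y (fun=> M) y.
  move=> m1; rewrite -RintegralB//; [|exact: iu|exact: iM].
  by apply: eq_Rintegral => y _; rewrite /u addrK.
rewrite hu; last exact: spker_le1.
rewrite (Rintegral_kcomp_ge0 k k' x mu uM) (Rintegral_kcomp_ge0 k k' x mM cM).
have kx1 : (k x setT <= 1)%E by rewrite prob_kernel.
have bd (v : X -> R) B : measurable_fun setT v -> (forall y, 0 <= v y <= B) ->
    (k x).-integrable setT (EFin \o (fun y => \int[k' y]_z v z)).
  move=> mv vB; apply: (bounded_integrable (M := B) kx1).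
    by apply: measurable_Rintegral => // y; have /andP[] := vB y.
  have B0 : 0 <= B by have /andP[] := vB point; exact: le_trans.
  have iv y : (k' y).-integrable setT (EFin \o v).
    apply: (bounded_integrable (M := B) (spker_le1 k' y) mv) => z.
    by have /andP[v0 v1] := vB z; rewrite ger0_norm.
  move=> y; rewrite ger0_norm; last by apply: Rintegral_ge0 => z _; have /andP[] := vB z.
  apply: (@le_trans _ _ (\int[k' y]_z (fun=> B) z)).
    apply: le_Rintegral => //.
      apply: (bounded_integrable (M := B) (spker_le1 k' y)) => // z.
      by rewrite ger0_norm.
    by move=> z _; have /andP[] := vB z.
  rewrite Rintegral_cst// -[leRHS]mulr1 ler_wpM2l// -lee_fin fineK.
    exact: spker_le1.
  by rewrite ge0_fin_numE// (le_lt_trans (spker_le1 k' y))// ltry.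
rewrite -RintegralB//; [|exact: bd uM|exact: bd cM].
by apply: eq_Rintegral => y _; rewrite hu//; exact: spker_le1.
Qed.

(** Bridge from the total variation hypothesis on iterated kernels to powers of the operator
    [kint k]. *)
Lemma cint_kpow (k : R.-pker X ~> X) n (f : V) x :
  cint (kpow k n x) f = (kint k ^+ n) f x.
Proof.
have [mRe mIm] := bmfun_measurable f.
elim: n x => [|n IH] x.
  rewrite expr0 bop1E /cint /= /Rintegral !integral_dirac//=.
  - by rewrite !indicT !mul1r; case: (f x).
  - exact/measurable_EFinP.
  - exact/measurable_EFinP.
rewrite exprS bopME /=.
rewrite {1}/cint /= (Rintegral_kcomp k (kpow k n) x mRe (bm_Re_le f)).
rewrite (Rintegral_kcomp k (kpow k n) x mIm (bm_Im_le f)).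
by rewrite /cint; congr (_ +i* _)%C; apply: eq_Rintegral => y _; rewrite -IH.
Qed.

End KernelIntegral.

(** * Twisted operators as power series in the twist parameter *)

Section Twisted.
Context d (X : measurableType d) (R : realType).
Local Notation V := (bmfun X R).
Local Open Scope complex_scope.

Variables (k : R.-pker X ~> X) (h : X -> R) (K rho : R).
Hypotheses (mh : measurable_fun setT h) (hK : forall y, `|h y| <= K).
Hypotheses (r0 : 0 <= rho) (rK : rho * K <= 4^-1).

Definition hcoef n : V := bm_of (fun y => (h y)%:C ^+ n * ecoef n).

Lemma hcoefE n y : hcoef n y = (h y)%:C ^+ n * ecoef n.
Proof.
rewrite /hcoef bm_ofE//; apply/bmP; split.
- rewrite [X in measurable_fun _ X](_ : _ = (fun y => h y ^+ n / n`!%:R)); last first.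
    by apply/funext => z /=; rewrite ecoefE -rmorphXn -rmorphM.
  by apply: measurable_funM => //; exact: measurable_funX.
- rewrite [X in measurable_fun _ X](_ : _ = cst 0); last first.
    by apply/funext => z /=; rewrite ecoefE -rmorphXn -rmorphM.
  exact: measurable_cst.
- exists (K ^+ n) => z; rewrite nrmcM nrmX nrm_real -[leRHS]mulr1.
  have K0 : 0 <= K := le_trans (normr_ge0 _) (hK z).
  by rewrite ler_pM ?exprn_ge0 ?nrm_ge0 ?nrm_ecoef// lerXn2r ?nnegrE.
Qed.

Lemma hcexpE (z : R[i]) y :
  (bm_of (fun y => cexp (z * (h y)%:C)) : V) y = cexp (z * (h y)%:C).
Proof. by rewrite bm_ofE//; exact: bm_cexp hK. Qed.

(** Since [rho * K <= 1 / 4], the weights are dominated by the geometric series of ratio 1/2, whose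
    sum is 2, and [cexp_tail] bounds the remainder uniformly in [y], hence in sup norm. *)
Lemma exp_mult_pser : pser rho 2 hcoef (fun z => bm_of (fun y => cexp (z * (h y)%:C))).
Proof.
have K0 : 0 <= K := le_trans (normr_ge0 _) (hK point).
have half : 1 - 2^-1 = 2^-1 :> R by lra.
split=> [n|z zr].
  have := @geometric_sum_le R (2^-1) n; rewrite half invrK => H.
  apply: le_trans (H _); last by lra.
  rewrite ler_sum// => j _; apply: (@le_trans _ _ (K ^+ j * rho ^+ j)).
    rewrite ler_wpM2r ?exprn_ge0//; apply: nrm_bm_le => y.
    rewrite hcoefE nrmcM nrmX nrm_real -[leRHS]mulr1.
    by rewrite ler_pM ?exprn_ge0 ?nrm_ge0 ?nrm_ecoef// lerXn2r ?nnegrE.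
  rewrite -exprMn lerXn2r ?nnegrE ?mulr_ge0// ?invr_ge0//.
  by rewrite mulrC (le_trans rK)//; lra.
have q01 : 0 <= (4^-1 : R) < 1 by lra.
have two0 : 0 <= (2 : R) by lra.
apply: tends_squeeze (vanishingM two0 (vanishing_expr q01)) _ => n.
rewrite nrm_distC; apply: nrm_bm_le => y; rewrite bmBE hcexpE bm_sumE.
have -> : \sum_(i < n) (z ^+ i *: hcoef i) y = \sum_(i < n) (z * (h y)%:C) ^+ i * ecoef i.
  by apply: eq_bigr => i _; rewrite bmZE hcoefE exprMn mulrA.
apply: cexp_tail; last by lra.
rewrite nrmcM nrm_real; apply: le_trans rK.
by rewrite ler_pM ?nrm_ge0.
Qed.

Lemma nrm_bmul (f : V) : nrm (bmul f) <= nrm f.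
Proof.
apply: nrm_bop_le => [|g]; first exact: nrm_ge0.
apply: nrm_bm_le => y /=; rewrite nrmcM ler_pM ?nrm_ge0//; exact: nrm_bm_app.
Qed.

Lemma lin_bmul : lin (fun f : V => bcomp (kint k) (bmul f)).
Proof.
move=> c f g; have -> : bmul (c *: f + g) = c *: bmul f + bmul g.
  apply: bop_ext => u; apply/val_inj/funext => x /=.
  rewrite -[RHS]/(c * (f x * u x) + g x * u x) mulrA -mulrDl.
  by [].
exact: (bilin_r (bilin_bcomp _ _ _) (kint k)).
Qed.

Lemma twisted_pser : pser rho 2 (fun n => bcomp (kint k) (bmul (hcoef n))) (twisted k h).
Proof.
rewrite -[2]mul1r.
apply: (pser_map (F := fun f : V => bcomp (kint k) (bmul f)) lin_bmul ler01 r0 _ exp_mult_pser).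
move=> f; rewrite (le_trans (bilin_nrm (bilin_bcomp _ _ _) _ _))//.
by rewrite ler_pM ?nrm_ge0 ?nrm_kint ?nrm_bmul.
Qed.

Lemma twisted_coef0 : bcomp (kint k) (bmul (hcoef 0)) = kint k.
Proof.
apply: bop_ext => f; congr (kint k _); apply/val_inj/funext => y /=.
by rewrite hcoefE expr0 /ecoef fact0 invr1 !mul1r.
Qed.

End Twisted.

Section TwistedLipschitz.
Context d (X : measurableType d) (R : realType).
Local Notation V := (bmfun X R).
Local Open Scope complex_scope.

Lemma bmul_sub (f f' : V) : bmul f - bmul f' = bmul (f - f').
Proof.
apply: bop_ext => u; apply/val_inj/funext => x.
by rewrite -[LHS]/(f x * u x - f' x * u x) -mulrBl.
Qed.

Lemma twisted_lipschitz (k k' : R.-pker X ~> X) (h h' : X -> R) (K rho B B' : R) (z : R[i]) :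
  measurable_fun setT h -> measurable_fun setT h' ->
  (forall y, `|h y| <= K) -> (forall y, `|h' y| <= K) -> rho * K <= 4^-1 ->
  nrm z <= rho -> rho <= 1 ->
  nrm (kint k - kint k') <= B -> (forall y, `|h y - h' y| <= B') ->
  nrm (twisted k h z - twisted k' h' z) <= 2 * B + 4 * B'.
Proof.
move=> mh mh' hK hK' rK zr r1 kB hB.
have r0 : 0 <= rho := le_trans (nrm_ge0 z) zr.
set G := bmul (bm_of (fun y => cexp (z * (h y)%:C))).
set G' := bmul (bm_of (fun y => cexp (z * (h' y)%:C))).
(* The change of kernel is multiplied by an exponential of norm at most 2; the change of exponent
   passes through [kint k'], of norm at most 1. *)
have -> : twisted k h z - twisted k' h' z = (kint k - kint k') * G + kint k' * (G - G').
  by rewrite mulrBl mulrBr addrA subrK.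
have zh (u : X -> R) y : (forall y, `|u y| <= K) -> nrm (z * (u y)%:C) <= 4^-1.
  move=> uK; rewrite nrmcM nrm_real; apply: le_trans rK.
  by rewrite ler_pM ?nrm_ge0.
have B0 : 0 <= B' := le_trans (normr_ge0 _) (hB point).
rewrite (le_trans (nrmD _ _))// lerD// (le_trans (nrm_opM _ _))//.
  rewrite mulrC ler_pM ?nrm_ge0// (le_trans (nrm_bmul _))//.
  exact: pser_bound (exp_mult_pser mh hK r0 rK) zr.
have GG : nrm (G - G') <= 4 * B'.
  rewrite /G /G' bmul_sub; apply: le_trans (nrm_bmul _) _.
  apply: nrm_bm_le => y; rewrite bmBE (hcexpE mh hK) (hcexpE mh' hK').
  rewrite (le_trans (cexp_lipschitz (zh _ _ hK) (zh _ _ hK')))// ler_wpM2l//.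
  rewrite -mulrBr -rmorphB nrmcM nrm_real -[leRHS]mul1r ler_pM ?nrm_ge0//.
  exact: le_trans zr r1.
by rewrite -[leRHS]mul1r; apply: ler_pM GG; rewrite ?nrm_ge0 ?nrm_kint.
Qed.

End TwistedLipschitz.

(** * Derivatives, spectrum and Lipschitz dependence *)

Section Derivatives.
Context {R : realType} {V : normedModType R[i]}.
Hypothesis bV : banach V.

(** Differentiating on the disc of radius [rho / 2 ^+ j] costs a factor [2 ^+ j / rho]. All [j]
    factors are replaced by the largest admissible one to obtain a single power. *)
Lemma pser_derive1n rho M (a : nat -> V) f j : 0 < rho -> pser rho M a f ->
  exists c, pser (rho / 2 ^+ j) (M * (2 ^+ j / rho) ^+ j) c (derive1n j f).
Proof.
move=> r0 hf; elim: j => [|j [c hc]].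
  by exists a; rewrite expr0 divr1 expr0 mulr1.
have M0 := pser_ge0 hf.
exists (fun k => c k.+1 *+ k.+1); rewrite derive1nS.
have r1 : 0 < rho / 2 ^+ j by rewrite divr_gt0// exprn_gt0.
have h := pser_derive1 bV r1 hc.
have -> : rho / 2 ^+ j.+1 = rho / 2 ^+ j / 2 by rewrite exprSr invfM mulrA.
apply: pser_mono h; rewrite -mulrA ler_wpM2l// invf_div -exprSr.
have p0 : 0 <= 2 ^+ j / rho by rewrite divr_ge0 ?exprn_ge0// ltW.
have pq : 2 ^+ j / rho <= 2 ^+ j.+1 / rho.
  by rewrite ler_wpM2r ?invr_ge0 ?(ltW r0)// ler_weXn2l// ler1n.
by rewrite lerXn2r ?nnegrE// (le_trans p0).
Qed.

Lemma derive1n_bound rho M (a : nat -> V) f j (z : R[i]) : 0 < rho -> pser rho M a f ->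
  (j <= 3)%N -> nrm z <= rho / 8 -> nrm (derive1n j f z) <= M * (1 + 8 / rho) ^+ 3.
Proof.
move=> r0 hf j3 zr; have [c hc] := pser_derive1n j r0 hf; have M0 := pser_ge0 hf.
have j8 : 2 ^+ j <= 8 :> R.
  have -> : (8 : R) = 2 ^+ 3 by rewrite -natrX.
  by rewrite ler_weXn2l// ler1n.
have q0 : 0 <= 8 / rho by rewrite divr_ge0// ltW.
rewrite (le_trans (pser_bound hc _))//.
  by rewrite (le_trans zr)// ler_wpM2l ?(ltW r0)// lef_pV2 ?posrE ?exprn_gt0.
rewrite ler_wpM2l// (@le_trans _ _ ((1 + 8 / rho) ^+ j))//; last first.
  by rewrite ler_weXn2l// lerDl.
rewrite lerXn2r ?nnegrE ?addr_ge0 ?divr_ge0 ?exprn_ge0 ?(ltW r0)//.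
by rewrite -[leLHS]add0r lerD// ler_wpM2r ?invr_ge0 ?(ltW r0).
Qed.

Lemma pser_pow rho M (a : nat -> bop V V) f n : 0 <= rho -> pser rho M a f ->
  exists2 c, pser rho (M ^+ n) c (fun z => f z ^+ n) & c 0%N = a 0%N ^+ n.
Proof.
move=> r0 hf; elim: n => [|n [c hc c0]].
  exists (fun k => if k is 0 then 1 else 0) => //.
  exact: pser_mono nrm_op1 (pser_cst rho (1 : bop V V)).
have h := pser_bilin (bilin_bcomp V V V) r0 hf hc.
exists (fun n0 => \sum_(i < n0.+1) bcomp (a i) (c (n0 - i)%N)); last first.
  by rewrite big_ord1 subn0 c0 exprS.
by rewrite exprS; apply: eq_pser h _ _ => // z _; rewrite exprS.
Qed.

(** Write [n = m * (n %/ m) + n %% m]. Blocks of length [m] have weight at most 1, so only the fewer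
    than [m] leftover factors cost anything, and the bound is uniform in [n]. *)
Lemma pser_pow_bounded rho M r (a : nat -> bop V V) f m n : 0 <= rho -> pser rho M a f ->
  (0 < m)%N -> 0 <= r <= 1 -> (exists c, pser rho r c (fun z => f z ^+ m)) ->
  exists c, pser rho ((1 + M) ^+ m) c (fun z => f z ^+ n).
Proof.
move=> r0 hf m0 /andP[r_0 r_1] [c hc].
have [c1 h1 _] := pser_pow (n %/ m) r0 hc; have [c2 h2 _] := pser_pow (n %% m) r0 hf.
have h := pser_bilin (bilin_bcomp V V V) r0 h1 h2.
exists (fun k => \sum_(i < k.+1) bcomp (c1 i) (c2 (k - i)%N)).
have M0 := pser_ge0 hf.
have hb : r ^+ (n %/ m) * M ^+ (n %% m) <= (1 + M) ^+ m.
  rewrite -[leRHS]mul1r ler_pM ?exprn_ge0 ?exprn_ile1//.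
  apply: (@le_trans _ _ ((1 + M) ^+ (n %% m))).
    by rewrite lerXn2r ?nnegrE ?addr_ge0// lerDr.
  by rewrite ler_weXn2l ?lerDl// ltnW// ltn_mod.
apply: eq_pser (pser_mono hb h) _ _ => // z _.
by rewrite bopM -exprM -exprD mulnC -divn_eq.
Qed.

End Derivatives.

(** * Separation of the leading eigenvalue from the remaining spectrum *)

Section Spectral.
Context {R : realType} {V : normedModType R[i]}.
Hypothesis bV : banach V.
Variables (Q : bop V V) (lam : R[i]) (v : V) (phi : dual V).
Variables (m : nat) (r q : R).
Hypotheses (Qv : Q v = lam *: v) (phiQ : forall f, phi (Q f) = lam * phi f).
Hypothesis phiv : phi v = 1.
Let Pi := tensor v phi.
Let N := Q - lam *: Pi.
Hypotheses (Nr : nrm (N ^+ m) <= r) (rq : r < q ^+ m) (q0 : 0 < q) (ql : q < nrm lam).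

Let PiE f : Pi f = phi f *: v. Proof. by []. Qed.

Let PiPi : Pi * Pi = Pi.
Proof. by apply: bop_ext => f; rewrite bopME !PiE dualZ phiv mulr1. Qed.

Let QPi : Q * Pi = lam *: Pi.
Proof. by apply: bop_ext => f; rewrite bopME bopZE !PiE bopZ Qv !scalerA mulrC. Qed.

Let PiQ : Pi * Q = lam *: Pi.
Proof. by apply: bop_ext => f; rewrite bopME bopZE !PiE phiQ scalerA. Qed.

Let NPi : N * Pi = 0.
Proof. by rewrite mulrBl bopZl PiPi QPi subrr. Qed.

Let PiN : Pi * N = 0.
Proof. by rewrite mulrBr bopZr PiPi PiQ subrr. Qed.

Let lam0 : lam != 0.
Proof. by apply: contraTneq ql => ->; rewrite nrm0 -leNgt ltW. Qed.

Lemma eigenvector_neq0 : v != 0.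
Proof. by apply/eqP => v0; move: phiv; rewrite v0 bop0 => /esym/eqP; rewrite oner_eq0. Qed.

(** For [q <= nrm mu] the m-th power of [mu^-1 *: N] has norm at most [r / q ^+ m < 1], so
    [neumann_pow] applies although [N] itself may be large. *)
Lemma resolvent_remainder (mu : R[i]) : q <= nrm mu -> exists S, inverse_of (mu *: (1 : bop V V) - N) S.
Proof.
move=> qmu; have n0 : 0 < nrm mu := lt_le_trans q0 qmu.
have mu0 : mu != 0 by apply: contraTneq n0 => ->; rewrite nrm0 ltxx.
have hr : nrm ((mu^-1 *: N) ^+ m) <= r / q ^+ m.
  rewrite bopZX nrmZ nrmX mulrC ler_pM ?nrm_ge0 ?exprn_ge0 ?nrm_ge0//.
  have -> : nrm mu^-1 = (nrm mu)^-1.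
    by apply: (mulfI (lt0r_neq0 n0)); rewrite -nrmcM !mulfV ?nrm1// gt_eqF.
  by rewrite exprVn lef_pV2 ?posrE ?exprn_gt0// lerXn2r ?nnegrE// ltW.
have rq1 : r / q ^+ m < 1 by rewrite ltr_pdivrMr ?exprn_gt0// mul1r.
have b1 : 1 <= 1 + nrm (mu^-1 *: N) by rewrite lerDl nrm_ge0.
have nb : nrm (mu^-1 *: N) <= 1 + nrm (mu^-1 *: N) by rewrite lerDr.
have [Z [Z1 Z2] _] := neumann_pow bV hr rq1 nb b1.
exists (mu^-1 *: Z).
have -> : mu *: (1 : bop V V) - N = mu *: (1 - mu^-1 *: N) by rewrite scalerBr scalerA mulfV// scale1r.
by split; rewrite bopZl bopZr scalerA ?mulfV ?mulVf// scale1r.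
Qed.

Lemma spectrum_remainder (mu : R[i]) : spectrum N mu -> nrm mu < q.
Proof.
move=> hmu; rewrite ltNge; apply/negP => /resolvent_remainder[S [S1 S2]].
by apply: hmu; exists S.
Qed.

Lemma spectrum_operator (mu : R[i]) : spectrum Q mu -> mu != lam -> nrm mu < q.
Proof.
move=> hmu mul; rewrite ltNge; apply/negP => qmu.
have [S [S1 S2]] := resolvent_remainder qmu.
have mu0 : mu != 0.
  by apply: contraTneq (lt_le_trans q0 qmu) => ->; rewrite nrm0 ltxx.
have SPi : S * Pi = mu^-1 *: Pi.
  have := congr1 (fun T => T * Pi) S2; rewrite mul1r -mulrA mulrBl NPi subr0 bopZl mul1r bopZr.
  by move=> {2}<-; rewrite scalerA mulVf// scale1r.
have PiS : Pi * S = mu^-1 *: Pi.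
  have := congr1 (fun T => Pi * T) S1; rewrite mulr1 mulrA mulrBr PiN subr0 bopZr mulr1 bopZl.
  by move=> {2}<-; rewrite scalerA mulVf// scale1r.
have mlE : mu *: (1 : bop V V) - Q = (mu *: (1 : bop V V) - N) - lam *: Pi.
  by rewrite /N opprB addrA addrAC addrK.
have ml0 : mu - lam != 0 by rewrite subr_eq0.
(* [S] acts on the range of [Pi] as [mu^-1], whereas the resolvent of [Q] must act there as
   [(mu - lam)^-1]; adding [c *: Pi] corrects this and changes nothing on the kernel of [Pi]. *)
pose c := (mu - lam)^-1 - mu^-1.
have cE : - (lam * mu^-1) + (mu - lam) * c = 0.
  rewrite /c mulrBr mulfV// mulrBl mulfV//; ring.
have SQ : S * (mu *: (1 : bop V V) - Q) = 1 - (lam * mu^-1) *: Pi.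
  by rewrite mlE mulrBr S2 bopZr SPi scalerA.
have QS : (mu *: (1 : bop V V) - Q) * S = 1 - (lam * mu^-1) *: Pi.
  by rewrite mlE mulrBl S1 bopZl PiS scalerA.
have PiQ' : Pi * (mu *: (1 : bop V V) - Q) = (mu - lam) *: Pi.
  by rewrite mulrBr bopZr mulr1 PiQ -scalerBl.
have QPi' : (mu *: (1 : bop V V) - Q) * Pi = (mu - lam) *: Pi.
  by rewrite mulrBl bopZl mul1r QPi -scalerBl.
apply: hmu; exists (S + c *: Pi); split.
  change ((S + c *: Pi) * (mu *: (1 : bop V V) - Q) = 1).
  rewrite mulrDl bopZl SQ PiQ' scalerA -scaleNr -addrA -scalerDl.
  by rewrite [c * _]mulrC cE scale0r addr0.
change ((mu *: (1 : bop V V) - Q) * (S + c *: Pi) = 1).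
rewrite mulrDr bopZr QS QPi' scalerA -scaleNr -addrA -scalerDl.
by rewrite [c * _]mulrC cE scale0r addr0.
Qed.

Lemma eigenvalue_leading : leading_eigenvalue Q lam.
Proof.
split; first by exists v => //; exact: eigenvector_neq0.
by move=> mu hmu mul; exact: lt_trans (spectrum_operator hmu mul) ql.
Qed.

Lemma eigenvalue_isolated : isolated_in_spectrum Q lam.
Proof.
split.
  move=> [S [S1 _]]; have := congr1 (fun T : bop V V => T v) S1.
  rewrite -[LHS]/(S (lam *: v - Q v)) Qv subrr bop0 => /esym v0.
  by have := eigenvector_neq0; rewrite -[v]/(bid V v) v0 eqxx.
exists (nrm lam - q) => [|mu hmu mul]; first by rewrite subr_gt0.
have := spectrum_operator hmu mul; have := nrm_sub lam mu.
by rewrite (nrm_distC lam mu); lra.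
Qed.

Lemma eigenvalue_simple : simple_eigenvalue Q lam.
Proof.
exists v; first exact: eigenvector_neq0.
have [S [_ S2]] := resolvent_remainder (ltW ql).
pose D := Q - lam *: (1 : bop V V).
have DPi : D * Pi = 0 by rewrite mulrBl bopZl mul1r QPi subrr.
have PiD : Pi * D = 0 by rewrite mulrBr bopZr mulr1 PiQ subrr.
(* On the kernel of [Pi], which [D] preserves, [D] agrees with [N - lam], and this is injective
   because [lam] lies outside the spectrum of [N]. *)
have inj n k : Pi k = 0 -> (D ^+ n) k = 0 -> k = 0.
  elim: n k => [|n IH] k; first by rewrite expr0.
  rewrite exprSr bopME => Pk /IH Dk; have {Dk} : D k = 0.
    by apply: Dk; rewrite -bopME PiD.
  have NE : lam *: (1 : bop V V) - N = lam *: Pi - D by rewrite /N /D !opprB addrCA.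
  have := congr1 (fun T : bop V V => T k) S2; rewrite bopME NE bopBE bopZE Pk => + Dk.
  by rewrite Dk scaler0 subr0 bop0 => /esym.
move=> h; split=> [[n]|[a ->]]; rewrite ?bpowE.
  rewrite -/(D ^+ n) => Dh; exists (phi h); apply/eqP; rewrite -subr_eq0; apply/eqP.
  (* The extra power guarantees a factor [D] to annihilate [Pi h], even for [n = 0]. *)
  apply: (inj n.+1); first by rewrite bopB -PiE -!bopME PiPi subrr.
  have E : (D ^+ n.+1) (Pi h) = 0 by rewrite -bopME exprSr -mulrA DPi mulr0.
  by rewrite bopB -PiE E subr0 exprS bopME Dh bop0.
exists 1%N; rewrite bpowE expr1 bopBE bopZE.
by rewrite bopZ Qv scalerA mulrC -scalerA [bid V _]/= subrr.
Qed.

Lemma eigenline_direct_sum : direct_sum [set a *: v | a in [set: R[i]]] [set h | phi h = 0].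
Proof.
move=> x; exists (phi x *: v, x - phi x *: v); split=> /=.
  split; first by exists (phi x).
    by rewrite bopB dualZ phiv mulr1 subrr.
  by rewrite subrKC.
move=> [_ h] /= [[a _ <-] h0 ->].
by rewrite bopD h0 dualZ phiv mulr1 addr0 addrAC subrr add0r.
Qed.

Lemma eigen_remainderE : N = bcomp Q (bid V - Pi).
Proof.
rewrite bopM; change (N = Q * (1 - Pi)).
by rewrite mulrBr mulr1 QPi.
Qed.

End Spectral.

(** * Comparison of the spectral data of two nearby operators *)

Section Lipschitz.
Context {R : realType} {V : normedModType R[i]}.

(* [A] is the unperturbed operator [Q_{u,0}] and [Q] the operator [Q_{u,z}]. *)
Record eigen_at (s eps : R) (A Q : bop V V) (e : V) (p : dual V) (S : bop V V)
    (lam : R[i]) (ups : V) (phi : dual V) : Prop := EigenAt {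
  ea_p : nrm p <= 1;
  ea_pe : p e = 1;
  ea_pA : forall f, p (A f) = p f;
  ea_S1 : (1 - A) * S = 1 - tensor e p;
  ea_S2 : S * (1 - A) = 1 - tensor e p;
  ea_S : nrm S <= s;
  ea_Q : nrm (Q - A) <= eps;
  ea_eig : Q ups = lam *: ups;
  ea_eigl : forall f, phi (Q f) = lam * phi f;
  ea_phiups : phi ups = 1;
  ea_pups : p ups = 1;
  ea_lam : nrm (lam - 1) <= 2 * eps;
  ea_ups : nrm (ups - e) <= 6 * (s * eps);
  ea_ups2 : nrm ups <= 2;
  ea_phi2 : nrm phi <= 2 }.

Variables (s eps d : R) (A Q A' Q' : bop V V) (e : V) (p p' : dual V).
Variables (S S' : bop V V) (lam lam' : R[i]) (ups ups' : V) (phi phi' : dual V).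
Hypotheses (s1 : 1 <= s) (small : 48 * (s * eps) <= 1) (eps0 : 0 <= eps) (e1 : nrm e <= 1).
Hypotheses (E : eigen_at s eps A Q e p S lam ups phi).
Hypotheses (E' : eigen_at s eps A' Q' e p' S' lam' ups' phi').
Hypotheses (dA : nrm (A - A') <= d) (dQ : nrm (Q - Q') <= d).

Let d0 : 0 <= d. Proof. exact: le_trans (nrm_ge0 _) dA. Qed.
Let s0 : 0 <= s. Proof. exact: le_trans s1. Qed.
Let se : eps <= s * eps. Proof. by rewrite ler_peMl. Qed.
Let sd : d <= s * d. Proof. by rewrite ler_peMl. Qed.

Lemma nrm_app_le (U W : normedModType R[i]) (T : bop U W) x (a b : R) :
  nrm T <= a -> nrm x <= b -> nrm (T x) <= a * b.
Proof. by move=> h h'; rewrite (le_trans (nrm_app _ _))// ler_pM ?nrm_ge0. Qed.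

(** Pairing the left eigenvector of one operator with the right eigenvector of the other gives [(lam
    - lam') * phi ups' = phi ((Q - Q') ups')]. The pairing [phi ups'] is at least 1/2 because [ups]
    and [ups'] are both close to [e]; this is where [48 * (s * eps) <= 1] is sharp. *)
Lemma lipschitz_lam : nrm (lam - lam') <= 8 * d.
Proof.
have hd := d0; have hs := small; have hse := se.
have h1 : nrm (phi ups' - 1) <= 2 * (12 * (s * eps)).
  rewrite -(ea_phiups E) -bopB; apply: nrm_app_le; first exact: ea_phi2 E.
  have := nrm_distD e ups' ups; rewrite (nrm_distC e ups).
  have := ea_ups E; have := ea_ups E'; lra.
have h2 : 2^-1 <= nrm (phi ups').
  have := nrm_sub (1 : R[i]) (phi ups'); rewrite (nrm_distC (1 : R[i])) nrm1; lra.
have h3 : nrm ((lam - lam') * phi ups') <= 2 * (d * 2).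
  have -> : (lam - lam') * phi ups' = phi ((Q - Q') ups').
    by rewrite bopBE bopB (ea_eigl E) (ea_eig E') dualZ mulrBl.
  apply: nrm_app_le; first exact: ea_phi2 E.
  apply: nrm_app_le => //; exact: ea_ups2 E'.
rewrite nrmcM in h3; have := ler_wpM2l (nrm_ge0 (lam - lam')) h2; lra.
Qed.

(** Applying [p'] to [(1 - A) S = 1 - e (x) p] and using its invariance under [A'] yields
    [p - p' = p' (A - A') S]. *)
Lemma lipschitz_p : nrm (p - p') <= s * d.
Proof.
apply: nrm_bop_le => [|f]; first by rewrite mulr_ge0// d0.
have -> : (p - p') f = p' ((A - A') (S f)).
  have := congr1 (fun T : bop V V => T f) (ea_S1 E); rewrite bopME !bopBE !bop1E.
  rewrite [tensor _ _ f]/= => h.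
  have := congr1 p' h; rewrite !bopB dualZ (ea_pe E') mulr1 => h'.
  by rewrite (ea_pA E') -[LHS]opprB -h' opprB.
rewrite (le_trans (nrm_app_le (ea_p E') (nrm_app_le dA (nrm_app_le (ea_S E) (lexx _)))))//.
by rewrite mul1r mulrA [d * s]mulrC.
Qed.

Let pert g : nrm (((Q - Q') - (lam - lam') *: (1 : bop V V)) g) <= 9 * d * nrm g.
Proof.
apply: nrm_app_le => //; rewrite (le_trans (nrmB _ _))// nrmZ.
have h : nrm (lam - lam') * nrm (1 : bop V V) <= 8 * d * 1.
  by rewrite ler_pM ?nrm_ge0 ?nrm_op1 ?lipschitz_lam.
have := dQ; lra.
Qed.

Let near : nrm (Q - A - (lam - 1) *: (1 : bop V V)) <= 3 * eps.
Proof.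
rewrite (le_trans (nrmB _ _))// nrmZ.
have h : nrm (lam - 1) * nrm (1 : bop V V) <= 2 * eps * 1.
  by rewrite ler_pM ?nrm_ge0 ?nrm_op1 ?(ea_lam E).
have := ea_Q E; lra.
Qed.

(** Subtracting the eigenvalue equations expresses [(1 - A) D] by a small multiple of [D] and a term
    of size [18 * d]; [S] inverts this up to [p D *: e], and the normalizations reduce [p D] to
    [(p' - p) ups']. The coefficient of [nrm D] on the right is at most 1/16, and the constant 40 is
    twice [18 + 2]. *)
Lemma lipschitz_ups : nrm (ups - ups') <= 40 * (s * d).
Proof.
have hd := d0; have hs := small; have hse := se; have he := eps0; have hs0 := s0.
set D := ups - ups'; set w := ((Q - Q') - (lam - lam') *: (1 : bop V V)) ups'.
have w18 : nrm w <= 18 * d.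
  have := pert ups'; have := ler_wpM2l (mulr_ge0 (ler0n R 9) hd) (ea_ups2 E'); rewrite -/w; lra.
have AD : (1 - A) D = (Q - A - (lam - 1) *: (1 : bop V V)) D + w.
  rewrite /w !(bopBE, bopZE, bop1E) /D !bopB (ea_eig E) (ea_eig E').
  rewrite !scalerBl scale1r -/D.
  have K : lam *: ups - Q ups' + (Q ups' - lam' *: ups' - (lam *: ups' - lam' *: ups')) = lam *: D.
    by rewrite /D scalerBr opprB !subrKA.
  by rewrite [RHS]addrAC [X in _ = X - _]addrAC K [RHS]addrAC subKr.
have DE : D = S ((Q - A - (lam - 1) *: (1 : bop V V)) D + w) + p D *: e.
  have := congr1 (fun T : bop V V => T D) (ea_S2 E); rewrite bopME AD => ->.
  by rewrite bopBE bop1E [tensor _ _ _]/= subrK.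
have pD : nrm (p D) <= s * d * 2.
  rewrite /D bopB (ea_pups E) -(ea_pups E') -bopBE nrm_distC.
  by rewrite -bopBE; apply: nrm_app_le lipschitz_p (ea_ups2 E').
have h1 : nrm (S ((Q - A - (lam - 1) *: (1 : bop V V)) D + w)) <= s * (3 * eps * nrm D + 18 * d).
  apply: nrm_app_le; first exact: ea_S E.
  by rewrite (le_trans (nrmD _ _))// lerD// nrm_app_le// near.
have h2 : nrm (p D *: e) <= s * d * 2.
  by rewrite nrmZ -[leRHS]mulr1 ler_pM ?nrm_ge0.
have : nrm D <= s * (3 * eps * nrm D + 18 * d) + s * d * 2.
  by rewrite {1}DE (le_trans (nrmD _ _))// lerD.
have : (s * eps) * nrm D <= 48^-1 * nrm D.
  by rewrite ler_wpM2r ?nrm_ge0//; lra.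
have sd0 : 0 <= s * d by rewrite mulr_ge0.
lra.
Qed.

(** Dual argument: [F f] splits into [p f * F e] and [F] on the range of [1 - A]. The value [F e] is
    not normalized directly, but [phi ups = phi' ups' = 1] turns it into
    [phi' (ups' - ups) - F (ups - e)]. The terms in [nrm F] have total coefficient at most 9/48, and
    196 is twice [80 + 18]. *)
Lemma lipschitz_phi : nrm (phi - phi') <= 196 * (s * d).
Proof.
have hd := d0; have hs := small; have hse := se; have he := eps0; have hs0 := s0.
set F := phi - phi'.
have Fe : nrm (F e) <= 80 * (s * d) + nrm F * (6 * (s * eps)).
  have -> : F e = phi' (ups' - ups) - F (ups - e).
    rewrite /F !bopBE !bopB (ea_phiups E) (ea_phiups E'); ring.
  rewrite (le_trans (nrmB _ _))// lerD//.
    apply: le_trans (nrm_app_le (ea_phi2 E') (lexx _)) _.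
    rewrite nrm_distC; have := lipschitz_ups; lra.
  by apply: nrm_app_le => //; exact: ea_ups E.
have FA g : F ((1 - A) g) = F ((Q - A - (lam - 1) *: (1 : bop V V)) g) +
    phi' (((Q - Q') - (lam - lam') *: (1 : bop V V)) g).
  rewrite /F !(bopBE, bopZE, bop1E) !(bopB, dualZ) (ea_eigl E) (ea_eigl E'); ring.
have : nrm F <= 80 * (s * d) + nrm F * (6 * (s * eps)) +
    (nrm F * (3 * eps * s) + 2 * (9 * d * s)).
  have B0 : 0 <= 80 * (s * d) + nrm F * (6 * (s * eps)).
    by rewrite addr_ge0 ?mulr_ge0 ?nrm_ge0.
  apply: nrm_bop_le => [|f]; first by rewrite !addr_ge0 ?mulr_ge0 ?nrm_ge0.
  have := congr1 (fun T : bop V V => F (T f)) (ea_S1 E); rewrite bopME FA.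
  have -> : F ((1 - tensor e p) f) = F f - p f * F e by rewrite -dualZ -bopB.
  move=> h.
  have -> : F f = p f * F e + (F ((Q - A - (lam - 1) *: (1 : bop V V)) (S f)) +
      phi' (((Q - Q') - (lam - lam') *: (1 : bop V V)) (S f))) by rewrite h; ring.
  have Sf : nrm (S f) <= s * nrm f by exact: nrm_app_le (ea_S E) (lexx _).
  rewrite (le_trans (nrmD _ _))// mulrDl lerD//.
    rewrite nrmcM mulrC ler_pM ?nrm_ge0//.
    by rewrite -[leRHS]mul1r; exact: nrm_app_le (ea_p E) (lexx _).
  rewrite (le_trans (nrmD _ _))// mulrDl lerD//.
    rewrite -!mulrA; apply: nrm_app_le => //; rewrite mulrA.
    by apply: nrm_app_le; [exact: near|].
  rewrite -!mulrA; apply: nrm_app_le; first exact: ea_phi2 E'.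
  by rewrite (le_trans (pert _))// -mulrA ler_wpM2l// ler_wpM2l.
have : nrm F * (s * eps) <= nrm F * 48^-1.
  by rewrite ler_wpM2l ?nrm_ge0//; lra.
have sd0 : 0 <= s * d by rewrite mulr_ge0.
lra.
Qed.

(** The three factors of [lam *: tensor ups phi] are changed one at a time; since [d <= s * d], the
    bounds add up to [1 + 32 + 2 * (80 + 392) = 977] times [s * d]. *)
Lemma lipschitz_remainder :
  nrm ((Q - lam *: tensor ups phi) - (Q' - lam' *: tensor ups' phi')) <= 1000 * (s * d).
Proof.
have hd := d0; have hs := small; have hse := se; have he := eps0; have hs0 := s0; have hsd := sd.
have l2 : nrm lam' <= 2.
  by have := nrm_sub lam' (1 : R[i]); rewrite nrm1; have := ea_lam E'; lra.
have -> : (Q - lam *: tensor ups phi) - (Q' - lam' *: tensor ups' phi') =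
    (Q - Q') - ((lam - lam') *: tensor ups phi +
      lam' *: (tensor (ups - ups') phi + tensor ups' (phi - phi'))).
  rewrite (linB (bilin_l (bilin_tensor V) phi)) (linB (bilin_r (bilin_tensor V) ups')).
  rewrite subrKA scalerBl scalerBr subrKA.
  by rewrite !opprB addrACA [RHS]addrACA; congr (_ + _); exact: addrC.
have bt := bilin_nrm (bilin_tensor V).
have h1 : nrm ((lam - lam') *: tensor ups phi) <= 8 * d * (2 * 2).
  rewrite nrmZ ler_pM ?nrm_ge0 ?lipschitz_lam// (le_trans (bt _ _))//.
  by rewrite ler_pM ?nrm_ge0 ?(ea_ups2 E) ?(ea_phi2 E).
have h2 : nrm (lam' *: (tensor (ups - ups') phi + tensor ups' (phi - phi'))) <=
    2 * (40 * (s * d) * 2 + 2 * (196 * (s * d))).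
  rewrite nrmZ ler_pM ?nrm_ge0// (le_trans (nrmD _ _))// lerD// (le_trans (bt _ _))//.
    by rewrite ler_pM ?nrm_ge0 ?lipschitz_ups ?(ea_phi2 E).
  by rewrite ler_pM ?nrm_ge0 ?lipschitz_phi ?(ea_ups2 E').
rewrite (le_trans (nrmB _ _))//.
have := nrmD ((lam - lam') *: tensor ups phi)
  (lam' *: (tensor (ups - ups') phi + tensor ups' (phi - phi'))).
have := dQ; lra.
Qed.

End Lipschitz.

(** * Choice of the constants *)

Lemma bernoulli (R : realDomainType) (x : R) n : 0 <= x <= 1 -> 1 - x *+ n <= (1 - x) ^+ n.
Proof.
move=> /andP[x0 x1]; elim: n => [|n IH]; first by rewrite mulr0n subr0.
have y0 : 0 <= 1 - x by rewrite subr_ge0.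
rewrite exprS; apply: le_trans (ler_wpM2l y0 IH).
rewrite mulrBl mul1r mulrBr mulr1 mulrSr.
have : 0 <= x * (x *+ n) by rewrite mulr_ge0// mulrn_wge0.
lra.
Qed.

(** A substitute for an m-th root: with [q = 1 - x], Bernoulli gives [q ^+ m >= 1 - m x], and
    [x = (1 - r) / (m + 2)] leaves a surplus of [2 x] above [r]. *)
Lemma exists_root_between (R : realFieldType) (r : R) m : 0 <= r < 1 ->
  exists q, 0 < q < 1 /\ r < q ^+ m.
Proof.
move=> /andP[r0 r1]; pose x := (1 - r) / m.+2%:R.
have m2 : 0 < m.+2%:R :> R by rewrite ltr0n.
have x0 : 0 < x by rewrite divr_gt0// subr_gt0.
have xm : x *+ m.+2 = 1 - r by rewrite -mulr_natr divfK ?gt_eqF.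
have xr : x < 1 - r by rewrite -xm mulrS ltrDl pmulrn_lgt0.
have x1 : 0 <= x <= 1 by lra.
exists (1 - x); split; first by lra.
apply: lt_le_trans (bernoulli m x1).
by move: xm; rewrite 2!mulrSr; lra.
Qed.

(** [s] is the bound on the reduced resolvent. [2 * eps <= (1 - q) / 2] keeps [nrm lam] above
    [(1 + q) / 2], and [rho * K <= 1 / 4] controls the exponential. The factor
    [(1 - r0) / 2 / 10 ^+ m] brings a series of weight [10 ^+ m] down to the gap between [r0] and
    [(1 + r0) / 2]. *)
Lemma small_constants (R : realFieldType) (m : nat) (r0 K s : R) :
  0 < r0 < 1 -> 0 <= K -> s = 2 ^+ m *+ m * (1 - r0)^-1 + 1 ->
  exists q eps rho rho2 : R,
    [/\ 1 <= s, 0 < q, q < 1 & (1 + r0) / 2 < q ^+ m] /\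
    [/\ 0 < eps, eps <= 1, 48 * (s * eps) <= 1 & 2 * eps <= (1 - q) / 2] /\
    [/\ 0 < rho, rho <= 1 & rho * K <= 4^-1] /\
    [/\ rho2 = (1 - r0) / 2 / 10 ^+ m * (eps / 2 * rho), 0 < rho2 & rho2 <= rho].
Proof.
move=> /andP[r0_gt0 r0_lt1] K0 sE.
have s1 : 1 <= s.
  by rewrite sE lerDr mulr_ge0 ?mulrn_wge0 ?exprn_ge0// invr_ge0; lra.
have r1 : 0 <= (1 + r0) / 2 < 1 by lra.
have [q [/andP[q0 q1] rq]] := exists_root_between m r1.
have s0 : 0 < s by rewrite (lt_le_trans _ s1).
(* With this [eps], [48 * (s * eps)] equals [(1 - q) / 2], which covers both smallness conditions
   since [1 <= s]. *)
have eps0 : 0 < (1 - q) / 96 / s by rewrite !divr_gt0// subr_gt0.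
have : s * ((1 - q) / 96 / s) = (1 - q) / 96 by rewrite mulrC divfK ?gt_eqF.
have : (1 - q) / 96 / s <= s * ((1 - q) / 96 / s) by rewrite ler_peMl// ltW.
move: ((1 - q) / 96 / s) eps0 => eps eps0 epss seps; clear sE.
have K10 : 0 < 4 * (K + 1) by lra.
have rho0 : 0 < (4 * (K + 1))^-1 by rewrite invr_gt0.
have rK : (4 * (K + 1))^-1 * K <= 4^-1 by rewrite mulrC ler_pdivrMr//; lra.
have rho1 : (4 * (K + 1))^-1 <= 1 by rewrite invf_le1//; lra.
move: (4 * (K + 1))^-1 rho0 rK rho1 => rho rho0 rK rho1.
have ten1 : 1 <= 10 ^+ m :> R by rewrite exprn_ege1//; lra.
exists q, eps, rho, ((1 - r0) / 2 / 10 ^+ m * (eps / 2 * rho)).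
split; first by split.
split; first by split=> //; lra.
split; first by split.
split=> //; first by rewrite !mulr_gt0// ?invr_gt0 ?exprn_gt0//; lra.
rewrite mulrA ler_piMl ?(ltW rho0)// mulr_ile1//; last 2 first.
- by rewrite ler_pdivrMr ?exprn_gt0// mul1r; lra.
- lra.
- by rewrite !divr_ge0 ?exprn_ge0//; lra.
- lra.
Qed.

(** The weights to be covered are 2 for [lam], [ups] and [phi], 10 for [N] and [11 ^+ m] for its
    powers; the second summand is the Lipschitz constant. *)
Lemma large_constant (R : realFieldType) (m : nat) (s B rho : R) :
  0 < s -> 0 < B -> 0 < rho ->
  exists C : R, [/\ 0 < C,
    forall M, M <= 11 ^+ m + 10 -> M * (1 + 8 / rho) ^+ 3 <= C & 1000 * (s * B) <= C].
Proof.
move=> s0 B0 r0; have sB0 : 0 < s * B by rewrite mulr_gt0.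
have D1 : 0 <= (1 + 8 / rho) ^+ 3 by rewrite exprn_ge0// addr_ge0// divr_ge0// ltW.
have m11 : 0 <= 11 ^+ m :> R by rewrite exprn_ge0.
have M00 : 0 <= (11 ^+ m + 10) * (1 + 8 / rho) ^+ 3 by rewrite mulr_ge0// addr_ge0.
exists ((11 ^+ m + 10) * (1 + 8 / rho) ^+ 3 + 1000 * (s * B)); split.
- lra.
- by move=> M hM; have := ler_wpM2r D1 hM; lra.
- lra.
Qed.

Lemma midpoint_bounds (R : realFieldType) (r : R) : 0 < r < 1 ->
  [/\ 0 <= (1 + r) / 2 <= 1, 0 <= (1 - r) / 2, (1 - r) / 2 <= 1 &
    r + (1 - r) / 2 = (1 + r) / 2].
Proof. by move=> r01; split; lra. Qed.

(** * Spectral data of one twisted kernel, with bounds independent of the kernel *)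

Section PerturbedKernel.
Context d (X : measurableType d) (R : realType).
Local Notation V := (bmfun X R).
Variables (m : nat) (r0 K eps rho s rho2 : R).
Let rho1 := eps / 2 * rho.
Let theta : R := (1 - r0) / 2 / 10 ^+ m.
Hypotheses (sE : s = 2 ^+ m *+ m * (1 - r0)^-1 + 1) (rho2E : rho2 = theta * rho1).
Hypotheses (m0 : (0 < m)%N) (r01 : 0 < r0 < 1) (eps0 : 0 < eps) (eps1 : eps <= 1).
Hypotheses (small : 48 * (s * eps) <= 1) (rho0 : 0 < rho) (rK : rho * K <= 4^-1).

(** All constants are fixed before [k] and [h] are introduced, so applying this to each [u]
    separately gives bounds uniform in [u]. *)
Lemma perturbed_kernel (e : V) (k : R.-pker X ~> X) (h : X -> R) :
  (forall x, e x = 1) -> measurable_fun setT h -> (forall y, `|h y| <= K) ->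
  (forall f x y, nrm f <= 1 -> nrm ((kint k ^+ m) f x - (kint k ^+ m) f y) <= r0) ->
  exists (p : dual V) (S : bop V V) (lam : R[i] -> R[i]) (ups : R[i] -> V)
      (phi : R[i] -> dual V),
    let N z := twisted k h z - lam z *: tensor (ups z) (phi z) in
    [/\ exists l, pser rho2 2 l lam, exists v, pser rho2 2 v ups,
      exists c, pser rho2 2 c phi &
      forall n, exists b, pser rho2 (11 ^+ m) b (fun z => N z ^+ n)] /\
    (exists b, pser rho2 10 b N) /\
    forall z : R[i], nrm z <= rho2 ->
      eigen_at s eps (kint k) (twisted k h z) e p S (lam z) (ups z) (phi z) /\
      nrm (N z ^+ m) <= (1 + r0) / 2.
Proof.
move=> e1 mh hK hcontr; have /andP[r0_gt0 r0_lt1] := r01.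
have bV : banach V := @banach_bmfun _ X R.
have ne : nrm e <= 1 by apply: nrm_bm_le => x; rewrite e1 nrm1.
have Te := kint_const k e1.
have [p [S [[pe np pT] [[Se pS S1 S2 nS] Nm]]]] :=
  ergodic e1 Te (nrm_kint k) r01 m0 hcontr.
have [mid0 half0 half1 midE] := midpoint_bounds r01.
have rho_ge0 := ltW rho0; have eps_ge0 := ltW eps0.
have s1 : 1 <= s.
  by rewrite sE lerDr mulr_ge0 ?mulrn_wge0 ?exprn_ge0// invr_ge0; lra.
rewrite -sE in nS.
have se : eps <= s * eps by rewrite ler_peMl.
have hQ := twisted_pser k mh hK rho_ge0 rK.
have e201 : 0 <= eps / 2 <= 1.
  by rewrite divr_ge0//= ler_pdivrMr// mul1r (le_trans eps1)// ler1n.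
have rho1_ge0 : 0 <= rho1 by rewrite /rho1 mulr_ge0// divr_ge0.
have rho11 : 0 <= rho1 <= rho.
  by rewrite rho1_ge0/= ler_piMl//; case/andP: e201.
have hQ1 := pser_rad rho11 hQ.
have A0 := twisted_coef0 k mh hK.
(* The series has weight 2 on [rho], so shrinking by [eps / 2] leaves [eps] for the nonconstant
   part. *)
have tail n : \sum_(j < n) nrm (bcomp (kint k) (bmul (hcoef h j.+1))) * rho1 ^+ j.+1 <= eps.
  by have := pser_shrink_tail rho_ge0 e201 hQ n; rewrite divfK.
have sm24 : 24 * (s * eps) <= 1.
  by apply: le_trans small; rewrite ler_wpM2r ?ler_nat// mulr_ge0// (le_trans _ s1).
have [] := eigen_pser bV rho1_ge0 hQ1 ne np pe _ _ Se pS _ _ nS s1 eps_ge0 tail sm24.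
- by rewrite A0.
- by rewrite A0.
- by rewrite A0.
- by rewrite A0.
move=> l [v [c [lam [ups [phi [[hlam hups hphi] [[l0 v0 c0] hz]]]]]]].
exists p, S, lam, ups, phi => N.
have ht := pser_bilin (bilin_tensor V) rho1_ge0 hups hphi.
have hlt := pser_bilin (bilin_scale (bop V V : normedModType R[i])) rho1_ge0 hlam ht.
have hN' := pserB rho1_ge0 hQ1 hlt.
set b := (X in pser _ _ X) in hN'.
(* [10 = 2 + 2 * (2 * 2)]: the operator, plus eigenvalue times the two eigenvectors. *)
have hN : pser rho1 10 b N by apply: pser_mono hN'; rewrite -!natrM -natrD ler_nat.
have b0 : b 0%N = kint k - tensor e p.
  by rewrite /b !big_ord1 l0 v0 c0 scale1r A0.
have [bm hbm bm0] := pser_pow m rho1_ge0 hN.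
have ten : 0 < 10 ^+ m :> R by rewrite exprn_gt0.
have th0 : 0 <= theta by rewrite /theta !divr_ge0// ?subr_ge0 ltW.
have ten1 : 1 <= 10 ^+ m :> R by rewrite exprn_ege1// ler1n.
have th1 : theta <= 1.
  by rewrite /theta ler_pdivrMr// mul1r (le_trans half1).
have th01 : 0 <= theta <= 1 by rewrite th0.
(* The constant coefficient is the unperturbed power, of norm at most [r0]; the rest contributes
   [theta * 10 ^+ m = (1 - r0) / 2]. *)
have hNm : pser rho2 ((1 + r0) / 2) bm (fun z => N z ^+ m).
  rewrite rho2E.
  apply: pser_mono (pser_shrink rho1_ge0 th01 hbm).
  rewrite bm0 b0 /theta divfK ?gt_eqF//.
  by rewrite -midE lerD2r.
have rho2_ge0 : 0 <= rho2 by rewrite rho2E mulr_ge0.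
have rho21 : 0 <= rho2 <= rho1 by rewrite rho2_ge0/= rho2E ler_piMl.
split; [split|split].
- by exists l; exact: pser_rad hlam.
- by exists v; exact: pser_rad hups.
- by exists c; exact: pser_rad hphi.
- move=> n; have hN2 := pser_rad rho21 hN.
  have [b' hb'] := pser_pow_bounded n rho2_ge0 hN2 m0 mid0 (ex_intro _ bm hNm).
  exists b'; have -> : (11 : R) = 1 + 10 by ring.
  exact: hb'.
- by exists b; exact: pser_rad hN.
move=> z zr; have zr1 : nrm z <= rho1 by rewrite (le_trans zr)//; case/andP: rho21.
split; last exact: pser_bound hNm zr.
have [h1 h2 h3 h4 [h5 h6]] := hz z zr1.
split=> //.
- by rewrite -A0; exact: pser_bound (pser_tail hQ1 tail) zr1.
- exact: pser_bound hups zr1.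
- exact: pser_bound hphi zr1.
Qed.

End PerturbedKernel.

Theorem theorem16 (R : realType) (E : pmetricType R)
    (Q : R -> R.-pker borel E ~> borel E) (g : R -> E -> R)
    (L : R) (m : nat) (r0 K Cg : R)
    (g_measurable : measurable_fun [set p : R * borel E | 0 <= p.1 <= 1]
       (fun p : R * borel E => g p.1 p.2))
    (g_bounded : exists M : R,
       forall (u : R) (x : E), 0 <= u <= 1 -> `|g u x| <= M)
    (L_gt0 : 0 < L)
    (Q_lipschitz : forall u v : R, 0 <= u <= 1 -> 0 <= v <= 1 ->
       (ereal_sup [set tv (Q u x) (Q v x) | x in [set: borel E]]
          <= (L * `|u - v|)%:E)%E)
    (m_ge1 : (1 <= m)%N) (r0_01 : 0 < r0 < 1)
    (Q_contracting : forall u : R, 0 <= u <= 1 ->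
       (ereal_sup [set tv (kpow (Q u) m p.1) (kpow (Q u) m p.2) |
          p in [set: borel E * borel E]] <= r0%:E)%E)
    (g_le : forall u : R, 0 <= u <= 1 ->
       (ereal_sup [set `|g u x|%:E | x in [set: E]] <= K%:E)%E)
    (Cg_ge0 : 0 <= Cg)
    (g_lipschitz : forall (u v : R) (x : E), 0 <= u <= 1 -> 0 <= v <= 1 ->
       `|g u x - g v x| <= Cg * `|u - v|) :
  exists (delta C kappa : R)
    (lam : R -> R[i] -> R[i])
    (ups : R -> R[i] -> bmfun (borel E) R)
    (phi : R -> R[i] -> dual (bmfun (borel E) R))
    (N : R -> R[i] -> bop (bmfun (borel E) R) (bmfun (borel E) R)),
  let Qz u z := twisted (Q u) (g u) z in
  let Pi u z := tensor (ups u z) (phi u z) in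
  [/\ 0 < delta, 0 < C & 0 < kappa < 1] /\
  (forall (u : R) (z : R[i]), 0 <= u <= 1 -> nrm z < delta ->
    [/\ Qz u z = lam u z *: Pi u z + N u z,
        [/\ leading_eigenvalue (Qz u z) (lam u z),
            simple_eigenvalue (Qz u z) (lam u z) &
            isolated_in_spectrum (Qz u z) (lam u z)],
        [/\ Qz u z (ups u z) = lam u z *: ups u z,
            bcomp (phi u z) (Qz u z) = lam u z *: phi u z &
            phi u z (ups u z) = 1],
        direct_sum [set a *: ups u z | a in [set: R[i]]]
                   [set h | phi u z h = 0] &
        N u z = bcomp (Qz u z) (bid _ - Pi u z) /\ lam u z != 0]) /\
  (ereal_sup [set spectral_radius (N p.1 p.2) / (nrm (lam p.1 p.2))%:E |
     p in [set p : R * R[i] | (0 <= p.1 <= 1)%R /\ (nrm p.2 < delta)%R]]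
     < kappa%:E)%E /\
  (forall (u : R) (z : R[i]) (n : nat), 0 <= u <= 1 -> nrm z < delta -> (0 < n)%N ->
     nrm (derive1n 2 (fun w => bpow (N u w) n) z) <= C) /\
  (forall (u : R) (z : R[i]), 0 <= u <= 1 -> nrm z < delta ->
    [/\ analytic_at (lam u) z, analytic_at (ups u) z,
        analytic_at (phi u) z & analytic_at (N u) z]) /\
  (forall (j : nat) (u : R) (z : R[i]), (1 <= j <= 3)%N -> 0 <= u <= 1 -> nrm z < delta ->
    [/\ nrm (derive1n j (lam u) z) <= C, nrm (derive1n j (ups u) z) <= C,
        nrm (derive1n j (phi u) z) <= C & nrm (derive1n j (N u) z) <= C]) /\
  (forall (u v : R) (z : R[i]), 0 <= u <= 1 -> 0 <= v <= 1 -> nrm z < delta ->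
    [/\ nrm (lam u z - lam v z) <= C * `|u - v|,
        nrm (ups u z - ups v z) <= C * `|u - v|,
        nrm (phi u z - phi v z) <= C * `|u - v| &
        nrm (N u z - N v z) <= C * `|u - v|]).
Proof.
have bV : banach (bmfun (borel E) R) := @banach_bmfun _ (borel E) R.
have bC := @banach_complex R.
have bD : banach (dual (bmfun (borel E) R) : normedModType R[i]) := banach_bop bC.
have bB : banach (bop (bmfun (borel E) R) (bmfun (borel E) R) : normedModType R[i]) := banach_bop bV.
have gK u x : 0 <= u <= 1 -> `|g u x| <= K.
  move=> u01; rewrite -lee_fin; apply: le_trans (g_le u u01).
  by apply: ereal_sup_ubound; exists x.
have u0 : 0 <= (0 : R) <= 1 by rewrite lexx ler01.
have K0 : 0 <= K := le_trans (normr_ge0 _) (gK 0 point u0).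
(* Joint measurability is given on the slab over the unit interval, so the section at [u] is
   composed through the measurable set [D]. *)
have mg u : 0 <= u <= 1 -> measurable_fun setT (g u : borel E -> R).
  move=> u01; pose D := [set p : R * borel E | 0 <= p.1 <= 1].
  have mD : measurable D.
    have -> : D = `[0, 1]%classic `*` setT.
      by apply/seteqP; split=> [[a b]|[a b]] /=; rewrite in_itv/= => // -[].
    by apply: measurableX => //; exact: measurable_itv.
  apply: (measurable_comp mD _ g_measurable (pair1_measurable u)).
  by move=> _ [y _ <-].
have m0 : (0 < m)%N by [].
have [s sE] : exists s : R, s = 2 ^+ m *+ m * (1 - r0)^-1 + 1 by eexists.
have [q [eps [rho [rho2 [[s1 q0 q1 rq] [[eps0 eps1 small eps2] [[rho0 rho1 rK]
  [rho2E rho2_gt0 rho2_le]]]]]]]] := small_constants r0_01 K0 sE.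
have s0 : 0 < s by rewrite (lt_le_trans _ s1).
pose e : (bmfun (borel E) R) := bm_of (fun=> 1).
have e1 x : e x = 1.
  rewrite /e bm_ofE//; apply/bmP; split; [exact: measurable_cst|exact: measurable_cst|].
  by exists 1 => y; rewrite nrm1.
have ne : nrm e <= 1 by apply: nrm_bm_le => x; rewrite e1 nrm1.
have contr u : 0 <= u <= 1 -> forall (f : (bmfun (borel E) R)) x y, nrm f <= 1 ->
    nrm ((kint (Q u) ^+ m) f x - (kint (Q u) ^+ m) f y) <= r0.
  move=> u01 f x y f1; rewrite -!cint_kpow -lee_fin; apply: le_trans (Q_contracting u u01).
  apply: (@le_trans _ _ (tv (kpow (Q u) m x) (kpow (Q u) m y))).
    by apply: ereal_sup_ubound; exists f.
  by apply: ereal_sup_ubound; exists (x, y).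
have lipT u v : 0 <= u <= 1 -> 0 <= v <= 1 -> nrm (kint (Q u) - kint (Q v)) <= L * `|u - v|.
  move=> u01 v01; apply: nrm_bop_le1 => f f1; apply: nrm_bm_le => x.
  rewrite bopBE bmBE -lee_fin; apply: le_trans (Q_lipschitz u v u01 v01).
  apply: (@le_trans _ _ (tv (Q u x) (Q v x))).
    by apply: ereal_sup_ubound; exists f.
  by apply: ereal_sup_ubound; exists x.
pose goal (u : R) (t : dual (bmfun (borel E) R) *
    bop (bmfun (borel E) R) (bmfun (borel E) R) * (R[i] -> R[i]) *
    (R[i] -> bmfun (borel E) R) * (R[i] -> dual (bmfun (borel E) R))) :=
  let: (p, Sr, lam, ups, phi) := t in
  let N z := twisted (Q u) (g u) z - lam z *: tensor (ups z) (phi z) in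
    [/\ exists l, pser rho2 2 l lam, exists v, pser rho2 2 v ups,
      exists c, pser rho2 2 c phi &
      forall n, exists b, pser rho2 (11 ^+ m) b (fun z => N z ^+ n)] /\
    (exists b, pser rho2 10 b N) /\
    forall z : R[i], nrm z <= rho2 ->
      eigen_at s eps (kint (Q u)) (twisted (Q u) (g u) z) e p Sr (lam z) (ups z) (phi z) /\
      nrm (N z ^+ m) <= (1 + r0) / 2.
(* One choice selects all five objects simultaneously; outside the unit interval they are set to
   0. *)
have /choice[F HF] : forall u, exists t, 0 <= u <= 1 -> goal u t.
  move=> u; have [u01|u01] := boolP (0 <= u <= 1); last first.
    by exists (0, 0, fun=> 0, fun=> 0, fun=> 0).
  have [p [S [lam [ups [phi H]]]]] := perturbed_kernel sE rho2E m0 r0_01 eps0 eps1 small rho0 rK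
    e1 (mg u u01) (fun x => gK u x u01) (contr u u01).
  by exists (p, S, lam, ups, phi) => _; exact: H.
pose lam u := (F u).1.1.2; pose ups u := (F u).1.2; pose phi u := (F u).2.
pose p u := (F u).1.1.1.1; pose S u := (F u).1.1.1.2.
pose Qz u z := twisted (Q u) (g u) z.
pose N u z := Qz u z - lam u z *: tensor (ups u z) (phi u z).
have H u : 0 <= u <= 1 -> 
    [/\ exists l, pser rho2 2 l (lam u), exists v, pser rho2 2 v (ups u),
      exists c, pser rho2 2 c (phi u) &
      forall n, exists b, pser rho2 (11 ^+ m) b (fun z => N u z ^+ n)] /\
    (exists b, pser rho2 10 b (N u)) /\
    forall z : R[i], nrm z <= rho2 ->
      eigen_at s eps (kint (Q u)) (Qz u z) e (p u) (S u) (lam u z) (ups u z) (phi u z) /\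
      nrm (N u z ^+ m) <= (1 + r0) / 2.
  by move=> /HF; rewrite /goal /N /Qz /lam /ups /phi /p /S; case: (F u) => [[[[? ?] ?] ?] ?].
clearbody lam ups phi p S; clear F HF.
(* Three derivatives halve the radius three times. *)
have [delta deltaE] : exists delta, delta = rho2 / 8 by eexists.
have delta0 : 0 < delta by rewrite deltaE divr_gt0.
have dr : delta < rho2 by rewrite deltaE ltr_pdivrMr// ltr_pMr// ltr1n.
have zd8 (z : R[i]) : nrm z < delta -> nrm z <= rho2 / 8 by rewrite -deltaE => /ltW.
have [B [BE B0]] : exists B, B = 2 * L + 4 * Cg /\ 0 < B.
  by eexists; split; first reflexivity; rewrite ltr_wpDr ?mulr_gt0 ?mulr_ge0.
have [C [C0 Cd CB]] := large_constant m s0 B0 rho2_gt0.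
have m11 : 0 <= 11 ^+ m :> R by rewrite exprn_ge0.
have [M2 M10 M11] : [/\ 2 <= 11 ^+ m + 10 :> R, 10 <= 11 ^+ m + 10 :> R &
    11 ^+ m <= 11 ^+ m + 10 :> R].
  by split; rewrite ?lerDl ?lerDr//; apply: le_trans (_ : 10 <= _); rewrite ?lerDr// ler_nat.
(* [k0] bounds the quotient of the spectral radius by [nrm lam] at each point. A supremum only
   inherits a weak inequality, so [kappa] is taken midway between [k0] and 1. *)
have [k0 [kappa [k0E k01 /andP[kappa0 kappa1]]]] : exists k0 kappa : R,
    [/\ k0 = q / ((1 + q) / 2), k0 < kappa & 0 < kappa < 1].
  have q12 : 0 < (1 + q) / 2 by rewrite divr_gt0// addr_gt0.
  have : q / ((1 + q) / 2) < 1 by rewrite ltr_pdivrMr// mul1r; clear -q1; lra.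
  have : 0 < q / ((1 + q) / 2) by rewrite divr_gt0.
  move: (q / _) => k k_gt0 k_lt1; exists k, ((1 + k) / 2).
  by clear -k_gt0 k_lt1; split=> //; lra.
(* [nrm lam >= 1 - 2 * eps >= 1 - (1 - q) / 2]. *)
have lamq u z : 0 <= u <= 1 -> nrm z <= rho2 -> (1 + q) / 2 <= nrm (lam u z).
  move=> /H[_ [_ h]] /h[ea _]; have := ea_lam ea.
  have := nrm_sub (1 : R[i]) (lam u z); rewrite nrm_distC nrm1; clear -eps2; lra.
have lamq' u z : 0 <= u <= 1 -> nrm z <= rho2 -> q < nrm (lam u z).
  by move=> u01 zr; apply: lt_le_trans (lamq u z u01 zr); clear -q1; lra.
exists delta, C, kappa, lam, ups, phi, N; split; [|split; [|split; [|split; [|split; [|split]]]]].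
- by split=> //; rewrite kappa0.
- move=> u z u01 zd; have zr := ltW (lt_trans zd dr).
  have [_ [_ /(_ z zr)[ea Nm]]] := H u u01; have lq := lamq' u z u01 zr.
  have Qv := ea_eig ea; have phiQ := ea_eigl ea; have pv := ea_phiups ea.
  split.
  + by rewrite /N subrKC.
  + split.
    * exact: (eigenvalue_leading bV Qv phiQ pv Nm rq q0 lq).
    * exact: (eigenvalue_simple bV Qv phiQ pv Nm rq q0 lq).
    * exact: (eigenvalue_isolated bV Qv phiQ pv Nm rq q0 lq).
  + by split=> //; apply: bop_ext => f; exact: phiQ.
  + exact: eigenline_direct_sum.
  + split; first exact: (eigen_remainderE _ Qv).
    by apply: contraTneq lq => ->; rewrite nrm0 -leNgt ltW.
- apply: (@le_lt_trans _ _ k0%:E); last by rewrite lte_fin.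
  apply: ge_ereal_sup => _ [[u z] /= [u01 zd] <-].
  have zr := ltW (lt_trans zd dr).
  have [_ [_ /(_ z zr)[ea Nm]]] := H u u01; have lq := lamq u z u01 zr.
  have l0 : 0 < nrm (lam u z) := lt_trans q0 (lamq' u z u01 zr).
  rewrite inver gt_eqF// lee_pdivrMr//.
  apply: (@le_trans _ _ q%:E).
    apply: ge_ereal_sup => _ [mu hmu <-]; rewrite lee_fin ltW//.
    exact: (spectrum_remainder bV Nm rq q0 hmu).
  rewrite -EFinM lee_fin k0E mulrAC ler_pdivlMr; last by rewrite divr_gt0// addr_gt0.
  by rewrite ler_wpM2l// ltW.
- move=> u z n u01 zd _; have [[_ _ _ /(_ n)[b hb]] _] := H u u01.
  have -> : (fun w => bpow (N u w) n) = (fun w => N u w ^+ n).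
    by apply/funext => w; rewrite bpowE.
  apply: le_trans (derive1n_bound bB rho2_gt0 hb _ (zd8 z zd)) _ => //.
  exact: Cd.
- move=> u z u01 zd; have zr := lt_trans zd dr.
  have [[[l hl] [v hv] [c hc] _] [[b hb] _]] := H u u01.
  by split; [exact: pser_analytic bC hl zr|exact: pser_analytic bV hv zr|
    exact: pser_analytic bD hc zr|exact: pser_analytic bB hb zr].
- move=> j u z /andP[_ j3] u01 /zd8 zd.
  have [[[l hl] [v hv] [c hc] _] [[b hb] _]] := H u u01.
  split.
  + by apply: le_trans (derive1n_bound bC rho2_gt0 hl j3 zd) _; exact: Cd.
  + by apply: le_trans (derive1n_bound bV rho2_gt0 hv j3 zd) _; exact: Cd.
  + by apply: le_trans (derive1n_bound bD rho2_gt0 hc j3 zd) _; exact: Cd.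
  + by apply: le_trans (derive1n_bound bB rho2_gt0 hb j3 zd) _; exact: Cd.
move=> u v z u01 v01 /lt_trans/(_ dr)/ltW zr.
have [_ [_ /(_ z zr)[ea _]]] := H u u01; have [_ [_ /(_ z zr)[ea' _]]] := H v v01.
(* [B = 2 * L + 4 * Cg] is the constant of [twisted_lipschitz] and dominates [L], so one distance
   controls both the untwisted and the twisted operators. *)
have [dd ddE] : exists dd, dd = B * `|u - v| by eexists.
have dA : nrm (kint (Q u) - kint (Q v)) <= dd.
  apply: le_trans (lipT u v u01 v01) _; rewrite ddE ler_wpM2r// BE.
  by clear -L_gt0 Cg_ge0; lra.
have dQ : nrm (Qz u z - Qz v z) <= dd.
  have zr' := le_trans zr rho2_le.
  apply: le_trans (twisted_lipschitz (mg u u01) (mg v v01) (fun y => gK u y u01) (fun y => gK v y v01)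
    rK zr' rho1 (lipT u v u01 v01) (fun y => g_lipschitz u v y u01 v01)) _.
  by rewrite ddE BE le_eqVlt; apply/orP; left; apply/eqP; ring.
have dd0 : 0 <= dd by rewrite ddE mulr_ge0// ltW.
have sdd : dd <= s * dd by rewrite ler_peMl.
have CE : 1000 * (s * dd) <= C * `|u - v|.
  have -> : 1000 * (s * dd) = 1000 * (s * B) * `|u - v| by rewrite ddE !mulrA.
  by rewrite ler_wpM2r.
have [c1 c2 c3] : [/\ 8 * dd <= C * `|u - v|, 40 * (s * dd) <= C * `|u - v| &
    196 * (s * dd) <= C * `|u - v|].
  by clear -dd0 sdd CE; split; lra.
have epsg := ltW eps0.
split.
- exact: le_trans (lipschitz_lam s1 small epsg ea ea' dA dQ) c1.
- exact: le_trans (lipschitz_ups s1 small epsg ne ea ea' dA dQ) c2.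
- exact: le_trans (lipschitz_phi s1 small epsg ne ea ea' dA dQ) c3.
- exact: le_trans (lipschitz_remainder s1 small epsg ne ea ea' dA dQ) CE.
Qed.
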